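(* Let $G$ be a two-party communication gadget. Suppose that for every partial Boolean function $f$ we have $\mathrm{Q}_0^{\mathrm{cc}}(f\circ G)=\widetilde{\Omega}(\mathrm{Q}_0(f))$ (a lifting theorem for zero-error quantum query complexity with gadget $G$). Then for every partial Boolean function $f$ we have $\mathrm{Q}^{\mathrm{cc}}(f\circ G)=\widetilde{\Omega}(\mathrm{Q}(f))$.
   Context: Quantum query model: the oracle $O_x$ acts by $O_x|i,b\rangle=|i,b\oplus x_i\rangle$. An algorithm alternates input-independent unitaries with $O_x$ starting from $|0^m\rangle$ and measures at the end. - $\mathrm{Q}(f)$ is the minimum number of queries of a quantum algorithm that outputs $f(x)$ with probability at least $2/3$ on every $x\in\mathrm{Dom}(f)$. - $\mathrm{Q}_0(f)$ is the minimum number of queries of a quantum algorithm that, on every $x\in\mathrm{Dom}(f)$, outputs $f(x)$ or ''?'', never outputs a wrong answer, and outputs ''?'' with probability at most $1/2$. A gadget is a function $G:\mathcal{X}\times\mathcal{Y}\to\{0,1\}$. For a partial function $f$ on $n$ bits, $f\circ G$ is the two-party partial function in which Alice holds $(a_1,\dots,a_n)\in\mathcal{X}^n$ and Bob holds $(b_1,\dots,b_n)\in\mathcal{Y}^n$. Its value is $f(G(a_1,b_1),\dots,G(a_n,b_n))$, defined when this string lies in $\mathrm{Dom}(f)$. - $\mathrm{Q}^{\mathrm{cc}}(F)$ is the bounded-error (success probability at least $2/3$) quantum communication complexity of a two-party partial function $F$. - $\mathrm{Q}_0^{\mathrm{cc}}(F)$ is its zero-error quantum communication complexity: the protocol never errs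 and outputs ''?'' with probability at most $1/2$. The notation $\widetilde{\Omega}(g)$ means $\Omega(g/\log^c g)$ for some constant $c$. *)

(* Defs.v *)
From HB Require Import structures.
From mathcomp Require Import all_boot all_order all_algebra.
From mathcomp Require Import complex.
From mathcomp Require Import boolp reals Rstruct exp.

Set Implicit Arguments.
Unset Strict Implicit.
Unset Printing Implicit Defensive.
Import Order.TTheory GRing.Theory Num.Theory.
Local Open Scope ring_scope.

Notation Real := Rdefinitions.R.
Notation Cx := (complex Real).

Definition cconj (z : Cx) : Cx := let: Complex a b := z in Complex a (- b).
Definition sqmod (z : Cx) : Real := let: Complex a b := z in a ^+ 2 + b ^+ 2.

(** Linear operators / vectors on the Hilbert space with orthonormal basis T. *)
Definition op (T : finType) := T -> T -> Cx.      (* U t s = <t|U|s> *)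
Definition vec (T : finType) := T -> Cx.
Definition apply (T : finType) (U : op T) (v : vec T) : vec T :=
  fun t => \sum_(s : T) U t s * v s.
Definition ket (T : finType) (s : T) : vec T := fun t => (t == s)%:R.
(** U^dagger U = I (for finite dimension this is unitarity) *)
Definition unitary (T : finType) (U : op T) : Prop :=
  forall s s' : T, \sum_(t : T) cconj (U t s) * U t s' = (s == s')%:R.
Definition prob (T : finType) (v : vec T) (P : pred T) : Real :=
  \sum_(t : T | P t) sqmod (v t).

(** least natural number satisfying P (0 if none; never used since the
    complexities below are always attained) *)
Definition nat_min (P : nat -> Prop) : nat :=
  match pselect (exists n, P n) with
  | left h =>
      @ex_minn (fun n => `[< P n >])
        (let: ex_intro n hn := h in ex_intro _ n (asboolT hn))
  | right _ => 0%N
  end.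

(** Partial Boolean functions on n bits: None = outside the domain. *)
Definition pfun (n : nat) := {ffun 'I_n -> bool} -> option bool.

(** Quantum query algorithms.  Basis states |i, b, z>: query index
    register (None = a basis value on which the oracle acts trivially),
    answer bit b, workspace z. *)
Definition qbasis (n w : nat) := (option 'I_n * bool * 'I_w.+1)%type.

Definition oracle_flip (n w : nat) (x : {ffun 'I_n -> bool}) (s : qbasis n w)
  : qbasis n w :=
  let: (i, b, z) := s in
  (i, b (+) (if i is Some j then x j else false), z).

Definition oracle (n w : nat) (x : {ffun 'I_n -> bool}) : op (qbasis n w) :=
  fun t s => (t == oracle_flip x s)%:R.

Record qalg (n : nat) := QAlg {
  qa_w : nat;
  qa_T : nat;
  qa_U : nat -> op (qbasis n qa_w);
  qa_out : qbasis n qa_w -> option bool    (* None = "?" *)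
}.
Arguments qa_w {n}. Arguments qa_T {n}. Arguments qa_U {n}. Arguments qa_out {n}.

Definition qalg_valid (n : nat) (A : qalg n) : Prop :=
  forall k, (k <= qa_T A)%N -> unitary (qa_U A k).

Fixpoint qrun (n : nat) (A : qalg n) (x : {ffun 'I_n -> bool}) (k : nat)
  : vec (qbasis n (qa_w A)) :=
  match k with
  | 0 => apply (qa_U A 0) (ket (None, false, ord0))
  | k'.+1 => apply (qa_U A k) (apply (oracle x) (@qrun n A x k'))
  end.
Arguments qrun {n} A x k.

Definition qalg_prob (n : nat) (A : qalg n) (x : {ffun 'I_n -> bool})
  (o : option bool) : Real :=
  prob (qrun A x (qa_T A)) (fun t => qa_out A t == o).

Definition bounded_query_alg (n : nat) (f : pfun n) (T : nat) : Prop :=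
  exists A : qalg n, [/\ qa_T A = T, qalg_valid A &
    forall x v, f x = Some v -> qalg_prob A x (Some v) >= 2 / 3].

Definition zero_error_query_alg (n : nat) (f : pfun n) (T : nat) : Prop :=
  exists A : qalg n, [/\ qa_T A = T, qalg_valid A &
    forall x v, f x = Some v ->
      qalg_prob A x (Some (~~ v)) = 0 /\ qalg_prob A x None <= 1 / 2].

Definition Qquery (n : nat) (f : pfun n) : nat := nat_min (bounded_query_alg f).
Definition Q0query (n : nat) (f : pfun n) : nat := nat_min (zero_error_query_alg f).

(** Quantum communication protocols (no prior entanglement).  Global basis
    |a, c, b>: Alice's private register a, a one-qubit channel c, Bob's
    private register b.  Operation j = 0..k is a unitary applied by Alice on
    (a,c) if j is even, by Bob on (c,b) if j is odd; after each of the first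
    k operations the channel qubit is sent to the other party, so k qubits
    are communicated.  After operation k, the party holding the channel
    measures its registers (and the channel) in the computational basis
    and outputs a function of the outcome (None = "?"). *)
Definition cbasis (da db : nat) := ('I_da.+1 * bool * 'I_db.+1)%type.

Record qprot (IA IB : Type) := QProt {
  qp_da : nat;
  qp_db : nat;
  qp_k : nat;
  qp_UA : nat -> IA -> op ('I_qp_da.+1 * bool)%type;
  qp_UB : nat -> IB -> op (bool * 'I_qp_db.+1)%type;
  qp_outA : ('I_qp_da.+1 * bool)%type -> option bool;
  qp_outB : (bool * 'I_qp_db.+1)%type -> option bool
}.
Arguments qp_da {IA IB}. Arguments qp_db {IA IB}. Arguments qp_k {IA IB}.
Arguments qp_UA {IA IB}. Arguments qp_UB {IA IB}.
Arguments qp_outA {IA IB}. Arguments qp_outB {IA IB}.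

Definition qprot_valid (IA IB : Type) (P : qprot IA IB) : Prop :=
  forall j, (j <= qp_k P)%N ->
    (forall x, unitary (qp_UA P j x)) /\ (forall y, unitary (qp_UB P j y)).

Definition liftA (da db : nat) (U : op ('I_da.+1 * bool)%type) : op (cbasis da db) :=
  fun t s => let: (a', c', b') := t in let: (a, c, b) := s in
             U (a', c') (a, c) * (b' == b)%:R.

Definition liftB (da db : nat) (U : op (bool * 'I_db.+1)%type) : op (cbasis da db) :=
  fun t s => let: (a', c', b') := t in let: (a, c, b) := s in
             (a' == a)%:R * U (c', b') (c, b).

Arguments liftA {da} db U.
Arguments liftB da {db} U.

Definition qp_step (IA IB : Type) (P : qprot IA IB) (x : IA) (y : IB) (j : nat)
  : op (cbasis (qp_da P) (qp_db P)) :=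
  if odd j then liftB (qp_da P) (qp_UB P j y) else liftA (qp_db P) (qp_UA P j x).

Arguments qp_step {IA IB} P x y j.

Fixpoint qp_run (IA IB : Type) (P : qprot IA IB) (x : IA) (y : IB) (j : nat)
  : vec (cbasis (qp_da P) (qp_db P)) :=
  match j with
  | 0 => apply (qp_step P x y 0) (ket (ord0, false, ord0))
  | j'.+1 => apply (qp_step P x y j) (@qp_run IA IB P x y j')
  end.
Arguments qp_run {IA IB} P x y j.

Definition qp_output (IA IB : Type) (P : qprot IA IB) (t : cbasis (qp_da P) (qp_db P))
  : option bool :=
  let: (a, c, b) := t in
  if odd (qp_k P) then qp_outB P (c, b) else qp_outA P (a, c).

Arguments qp_output {IA IB} P t.

Definition qprot_prob (IA IB : Type) (P : qprot IA IB) (x : IA) (y : IB)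
  (o : option bool) : Real :=
  prob (qp_run P x y (qp_k P)) (fun t => qp_output P t == o).

Definition bounded_prot (IA IB : Type) (F : IA -> IB -> option bool) (k : nat) : Prop :=
  exists P : qprot IA IB, [/\ qp_k P = k, qprot_valid P &
    forall x y v, F x y = Some v -> qprot_prob P x y (Some v) >= 2 / 3].

Definition zero_error_prot (IA IB : Type) (F : IA -> IB -> option bool) (k : nat) : Prop :=
  exists P : qprot IA IB, [/\ qp_k P = k, qprot_valid P &
    forall x y v, F x y = Some v ->
      qprot_prob P x y (Some (~~ v)) = 0 /\ qprot_prob P x y None <= 1 / 2].

Definition Qcc (IA IB : Type) (F : IA -> IB -> option bool) : nat :=
  nat_min (bounded_prot F).
Definition Q0cc (IA IB : Type) (F : IA -> IB -> option bool) : nat :=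
  nat_min (zero_error_prot F).

Definition lift_fun (X Y : Type) (G : X -> Y -> bool) (n : nat) (f : pfun n)
  : ('I_n -> X) -> ('I_n -> Y) -> option bool :=
  fun a b => f [ffun i => G (a i) (b i)].

Definition omega_tilde_all (A B : forall n : nat, pfun n -> nat) : Prop :=
  exists (K : Real) (c N : nat), 0 < K /\
    forall (n : nat) (f : pfun n), (N <= B n f)%N ->
      K * (B n f)%:R / (@ln Real (B n f)%:R) ^+ c <= (A n f)%:R.

(* Main.v *)
Require Import Defs.
From mathcomp Require Import all_boot all_order all_algebra.
From mathcomp Require Import complex.
From mathcomp Require Import boolp reals Rstruct exp.
From mathcomp Require Import perm sequences ring lra zify.

(** Given [f] with [B = Q(f)] large, let [k ~ log B], let [D] be a power of [log B] and
    let [S = B / polylog(B)]. The partial function [f'] takes inputs [x_1, .., x_k] of [f] and an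
    array of [2^k] cells, each made of two [S]-bit strings; all of these strings have even
    parity, except the [v]-th string of the cell with index [l = (f(x_1), .., f(x_k))], and
    the value of [f'] is [v].

    A bounded-error protocol for [f o G] gives a zero-error protocol for [f' o G]: guess [l],
    then read cell [l] by a zero-error protocol for [G]; a wrong guess is detected,
    because it leads to a cell without odd parity.

    Conversely, a zero-error algorithm for [f'] with [T <= S D] queries must query cell [l]
    with total weight at least [T / (512 D^2)], even when all parities are even (adversary
    argument for parity: each of the [S] positions of a string is sensitive). By a minimax
    argument, if this were no help in deciding [f], then pairs of a 0-input and a 1-input of
    [f] could be drawn so that the weights of the [2^k] cells hardly depend on [l], and they
    would add up to more than 1. So [f] can be decided with [T polylog(B)] queries, which is
    less than [B]; hence [Q_0(f') > S D]. Comparing both bounds through the hypothesis yields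
    [Q^cc(f o G) >= S]. The zero-error protocol for [G] comes from the hypothesis as well,
    applied to the exclusive or of a fixed [f] with one additional input bit. *)

Set Implicit Arguments.
Unset Strict Implicit.
Unset Printing Implicit Defensive.
Import Order.TTheory GRing.Theory Num.Theory.
Local Open Scope ring_scope.

(** The construction separates two costs. A protocol learns [l] through [f], paying for [f o G], and
    then reads a single cell for about [S]. A zero-error algorithm too weak to decide [f] has to
    spread its queries over [2^k] cells. The parameter [D] must outweigh every polylogarithmic loss
    between the two sides: in [D = k^(c+3)], [c] powers pay for the logarithms of the hypothesis,
    two for guessing [k] values reliably, and the last one beats the constants. Also
    [2048 D^2 <= 2^k] is needed, so that an average cell is too light; a [k] of order [log B]
    achieves this. Weights are compared on arrays with only even parities, which lie outside the
    domain of [f']: such an array carries no trace of [l], so it stays fixed while [x_1, .., x_k]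
    change. The sets [X] and [Y] may be infinite whereas protocols have finite registers, so a
    protocol need not exist at all. Existence, for [f o G] as for [G], is extracted from the
    hypothesis, whose lower bound excludes the default value 0 of [nat_min]. *)

Local Notation RR := Rdefinitions.R.

(** * Operators and norms *)

Lemma cconjE : cconj = @conjc _.
Proof. by apply/boolp.funext => -[a b]. Qed.

Lemma sqmodC (z : Cx) : (sqmod z)%:C%C = cconj z * z.
Proof. by case: z => a b; simpc; congr (_ +i* _)%C; ring. Qed.

Lemma sqmod0 : sqmod 0 = 0.
Proof. by rewrite /sqmod /= expr0n addr0. Qed.

Lemma sqmod_ge0 (z : Cx) : 0 <= sqmod z.
Proof. by case: z => a b /=; rewrite addr_ge0 ?sqr_ge0. Qed.

Lemma sqmodM (z w : Cx) : sqmod (z * w) = sqmod z * sqmod w.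
Proof. by case: z w => a b [c d]; rewrite /sqmod /=; ring. Qed.

Lemma sqmodR (a : RR) : sqmod a%:C%C = a ^+ 2.
Proof. by rewrite /sqmod /=; ring. Qed.

Lemma sqmod1 : sqmod 1 = 1.
Proof. by rewrite /sqmod /=; ring. Qed.

Lemma sqmod_eq0 (z : Cx) : sqmod z = 0 -> z = 0.
Proof.
case: z => a b /= /eqP; rewrite paddr_eq0 ?sqr_ge0 //.
by rewrite !sqrf_eq0 => /andP[/eqP -> /eqP ->].
Qed.

Lemma sqmod_natr (b : bool) : sqmod (b%:R : Cx) = b%:R.
Proof. by case: b; rewrite ?sqmod1 ?sqmod0. Qed.

Definition norm2 (T : finType) (v : vec T) : RR := \sum_t sqmod (v t).

Lemma norm2_ket (T : finType) (s : T) : norm2 (ket s) = 1.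
Proof.
rewrite /norm2 (bigD1 s) //= /ket eqxx sqmod1 big1 ?addr0 // => t /negbTE ->.
exact: sqmod0.
Qed.

Lemma norm2_apply (T : finType) (U : op T) (v : vec T) :
  unitary U -> norm2 (apply U v) = norm2 v.
Proof.
move=> HU; apply: (@complexI RR); rewrite /norm2 !rmorph_sum /=.
under eq_bigr do rewrite sqmodC /apply cconjE rmorph_sum mulr_suml.
under eq_bigr do under eq_bigr do rewrite rmorphM mulr_sumr.
rewrite exchange_big; under eq_bigr do rewrite exchange_big /=.
apply: eq_bigr => s _.
rewrite (eq_bigr (fun s' => conjc (v s) * v s' * (s == s')%:R)); last first.
  move=> s' _; rewrite -HU mulr_sumr cconjE; apply: eq_bigr => t _.
  ring.
rewrite (bigD1 s) //= eqxx mulr1 big1 ?addr0 ?sqmodC ?cconjE // => s'.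
by rewrite eq_sym => /negbTE ->; rewrite mulr0.
Qed.

Lemma apply_ket (T : finType) (U : op T) (s : T) : apply U (ket s) = U^~ s.
Proof.
apply/funext => t; rewrite /apply (bigD1 s) //= /ket eqxx mulr1 big1 ?addr0 //.
by move=> s' /negbTE ->; rewrite mulr0.
Qed.

Lemma applyB (T : finType) (U : op T) (v w : vec T) :
  apply U (fun t => v t - w t) = (fun t => apply U v t - apply U w t).
Proof.
by apply/funext => t; rewrite /apply -sumrB; apply: eq_bigr => s _; rewrite mulrBr.
Qed.

Definition idop (T : finType) : op T := fun t s => (t == s)%:R.

Definition permop (T : finType) (phi : T -> T) : op T :=
  fun t s => (t == phi s)%:R.

Lemma unitary_permop (T : finType) (phi : T -> T) :
  injective phi -> unitary (permop phi).
Proof.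
move=> inj s s'; rewrite (bigD1 (phi s)) //= /permop eqxx (inj_eq inj).
rewrite big1 ?addr0; last by move=> t /negbTE ->; rewrite cconjE rmorph0 mul0r.
by rewrite cconjE rmorph1 mul1r.
Qed.

Lemma apply_permop (T : finType) (phi : T -> T) (v : vec T) :
  involutive phi -> apply (permop phi) v = (fun t => v (phi t)).
Proof.
move=> phiK; apply/funext => t; rewrite /apply (bigD1 (phi t)) //= /permop phiK.
rewrite eqxx mul1r big1 ?addr0 // => s; rewrite -(inj_eq (inv_inj phiK)) phiK.
by rewrite eq_sym => /negbTE ->; rewrite mul0r.
Qed.

Lemma unitary_idop (T : finType) : unitary (@idop T).
Proof. exact: (@unitary_permop T id). Qed.

Lemma apply_idop (T : finType) (v : vec T) : apply (@idop T) v = v.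
Proof. exact: (@apply_permop T id). Qed.

(** * Implementable kernels *)

Definition upd (K : finType) (V : Type) (g : {ffun K -> V}) (h : K) (v : V) : {ffun K -> V} :=
  [ffun a => if a == h then v else g a].

(* [impl k D]: with cost [k] and on input [w : W], a classical outcome [o] distributed as
   [D p w o] can be produced; [p] is classical information obtained earlier. *)
Record model (W : Type) := Model {
  impl : forall P O : finType, nat -> (P -> W -> O -> RR) -> Prop;
  impl_ge0 : forall (P O : finType) k (D : P -> W -> O -> RR),
    impl k D -> forall p w o, 0 <= D p w o;
  impl_sum1 : forall (P O : finType) k (D : P -> W -> O -> RR),
    impl k D -> forall p w, \sum_o D p w o = 1;
  impl_pure : forall (P O : finType) (g : P -> O),
    impl 0 (fun p (_ : W) o => (o == g p)%:R);
  impl_pull : forall (P P' O : finType) k (D : P -> W -> O -> RR) (h : P' -> P),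
    impl k D -> impl k (fun p => D (h p));
  impl_bind : forall (P O1 O2 : finType) k1 k2 (D1 : P -> W -> O1 -> RR)
      (D2 : (P * O1)%type -> W -> O2 -> RR),
    impl k1 D1 -> impl k2 D2 ->
    impl (k1 + k2) (fun p w o => \sum_o1 D1 p w o1 * D2 (p, o1) w o)
}.

Section Loops.
Variables (W : Type) (M : model W).

Lemma impl_le1 (P O : finType) k (D : P -> W -> O -> RR) :
  impl M k D -> forall p w o, D p w o <= 1.
Proof.
move=> HD p w o; rewrite -(impl_sum1 HD p w) (bigD1 o) //= lerDl.
by apply: sumr_ge0 => *; exact: impl_ge0 HD _ _ _.
Qed.

Lemma impl_map (P O1 O2 : finType) k (D : P -> W -> O1 -> RR) (g : P * O1 -> O2) :
  impl M k D -> impl M k (fun p w o => \sum_(o1 | g (p, o1) == o) D p w o1).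
Proof.
move=> HD; have := impl_bind HD (impl_pure M g); rewrite addn0.
congr (impl M _ _); apply/funext => p; apply/funext => w; apply/funext => o.
rewrite [RHS]big_mkcond; apply: eq_bigr => o1 _ /=.
by rewrite eq_sym; case: eqP => _; rewrite ?mulr1 ?mulr0.
Qed.

(** * Sequential iteration of a kernel *)

Section Fold.
Variables (P J S : finType).

Fixpoint foldk (D : P * (J * S) -> W -> S -> RR) (js : seq J) :
    P * S -> W -> S -> RR :=
  if js is j :: js' then
    fun ps w o => \sum_s D (ps.1, (j, ps.2)) w s * foldk D js' (ps.1, s) w o
  else fun ps w o => (o == ps.2)%:R.

Variables (k : nat) (D : P * (J * S) -> W -> S -> RR).
Hypothesis HD : impl M k D.

Lemma impl_fold js : impl M (size js * k) (foldk D js).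
Proof.
elim: js => [|j js IH]; first exact: (impl_pure M (fun ps : P * S => ps.2)).
rewrite /= mulSn.
have H1 := impl_pull (fun ps : P * S => (ps.1, (j, ps.2))) HD.
exact: (impl_bind H1 (impl_pull (fun q : P * S * S => (q.1.1, q.2)) IH)).
Qed.

(** Union bound: the errors [d] of the steps add up, because [(1 - x) * (1 - y) >= 0] gives
    [x + y - 1 <= x * y]. *)
Lemma foldk_ideal (step : J -> S -> S) p w (d : RR) :
  (forall j s, 1 - d <= D (p, (j, s)) w (step j s)) ->
  forall js s,
    1 - (size js)%:R * d <= foldk D js (p, s) w (foldl (fun s j => step j s) s js).
Proof.
move=> Hd; elim=> [|j js IH] s; first by rewrite /= eqxx mul0r subr0.
rewrite /= (bigD1 (step j s)) //= -[X in X <= _]addr0.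
apply: lerD; last first.
  by apply: sumr_ge0 => s' _; apply: mulr_ge0;
    [exact: impl_ge0 HD _ _ _ | exact: impl_ge0 (impl_fold js) _ _ _].
have := Hd j s; have := IH (step j s).
have := impl_le1 HD (p, (j, s)) w (step j s).
have := impl_le1 (impl_fold js) (p, step j s) w
  (foldl (fun s j => step j s) (step j s) js).
set x := D _ _ _; set y := foldk _ _ _ _ _ => hy hx h1 h2.
have : 0 <= (1 - x) * (1 - y) by rewrite mulr_ge0 ?subr_ge0.
by rewrite -natr1; lra.
Qed.

(** The zero-error counterpart of [foldk_ideal]: [bad] is an absorbing failure flag, so a run that
    ever leaves the ideal path is seen at the end to have failed. *)
Lemma foldk_support (step : J -> S -> S) (bad : pred S) p w :
  (forall j s s', D (p, (j, s)) w s' != 0 -> s' = step j s \/ bad s') ->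
  (forall j s s', bad s -> D (p, (j, s)) w s' != 0 -> bad s') ->
  forall js s o, foldk D js (p, s) w o != 0 ->
    o = foldl (fun s j => step j s) s js \/ bad o.
Proof.
move=> Hstep Hbad.
have Hb js s o : bad s -> foldk D js (p, s) w o != 0 -> bad o.
  elim: js s => [|j js IH] s bs /=.
    by case: (o =P s) => [->|] //; rewrite eqxx.
  move=> Hn0; have [s' _] : exists2 s', true & D (p, (j, s)) w s' * foldk D js (p, s') w o != 0.
    by apply/exists2P; apply: contra_neqP Hn0 => H; rewrite big1 // => s' _;
      apply/eqP; apply: contra_notT H => h; exists s'.
  by rewrite mulf_eq0 negb_or => /andP[/(Hbad _ _ _ bs)]; exact: IH.
elim=> [|j js IH] s o /=; first by case: (o =P s) => [->|]; [left | rewrite eqxx].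
move=> Hn0; have [s' _] : exists2 s', true & D (p, (j, s)) w s' * foldk D js (p, s') w o != 0.
  by apply/exists2P; apply: contra_neqP Hn0 => H; rewrite big1 // => s' _;
    apply/eqP; apply: contra_notT H => h; exists s'.
rewrite mulf_eq0 negb_or => /andP[/Hstep[->|bs'] Ho]; first exact: IH.
by right; apply: Hb Ho.
Qed.

End Fold.

(** * Amplification by counting ones *)

Section Threshold.
Variables (P : finType) (k : nat) (D : P -> W -> bool -> RR) (m : nat).
Hypothesis HD : impl M k D.

Let count (q : P * (unit * 'I_m.+1)) (w : W) (c : 'I_m.+1) : RR :=
  \sum_(b : bool | @inord m (q.2.2 + b) == c) D q.1 w b.

Let impl_count : impl M k count.
Proof.
have := impl_pull (fun q : P * (unit * 'I_m.+1) => q.1) HD.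
exact: (impl_map (fun q : (P * (unit * 'I_m.+1)) * bool => @inord m (q.1.2.2 + q.2))).
Qed.

Let sum_count p w c (g : 'I_m.+1 -> RR) :
  \sum_c' count (p, (tt, c)) w c' * g c'
  = D p w true * g (@inord m (c + 1)) + (1 - D p w true) * g (inord c).
Proof.
have -> : 1 - D p w true = D p w false.
  by rewrite -(impl_sum1 HD p w) big_bool addrC addrA addNr add0r.
have -> : \sum_c' count (p, (tt, c)) w c' * g c'
  = \sum_c' \sum_(b : bool | @inord m (c + b) == c') D p w b * g (@inord m (c + b)).
  by apply: eq_bigr => c' _; rewrite /count mulr_suml; apply: eq_bigr => b /eqP ->.
rewrite (exchange_big_dep xpredT) //= big_bool.
rewrite (big_pred1 (@inord m (c + 1))); last by move=> j; rewrite /= eq_sym.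
rewrite (big_pred1 (@inord m (c + 0))); last by move=> j; rewrite /= eq_sym.
by rewrite addn0.
Qed.

(** Squared bias plus variance of the final count, about an arbitrary centre [a]; the induction
    moves the start [c]. The condition [c + j <= m] keeps [inord] away from its default value. *)
Let second_moment p w (a : RR) j (c : 'I_m.+1) : (c + j <= m)%N ->
  \sum_c' foldk count (nseq j tt) (p, c) w c' * (c'%:R - a) ^+ 2
  = (c%:R + j%:R * D p w true - a) ^+ 2
    + j%:R * (D p w true * (1 - D p w true)).
Proof.
elim: j c => [|j IH] c Hc /=.
  rewrite (bigD1 c) //= eqxx big1 ?addr0 => [|i /negbTE ->]; last by rewrite mul0r.
  rewrite mulr0n mulr1n; ring.
transitivity (\sum_c1 count (p, (tt, c)) w c1 *
    \sum_c' foldk count (nseq j tt) (p, c1) w c' * (c'%:R - a) ^+ 2).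
  under [RHS]eq_bigr do rewrite mulr_sumr.
  rewrite exchange_big /=; apply: eq_bigr => c' _.
  by rewrite mulr_suml; apply: eq_bigr => c1 _; rewrite mulrA.
have E1 : @inord m (c + 1) = (c + 1)%N :> nat by rewrite inordK // ; lia.
rewrite sum_count IH ?E1; last by lia.
rewrite inord_val IH; last by lia.
by rewrite natrD -natr1; ring.
Qed.

(* Chebyshev's inequality for the number of ones among m independent runs. *)
Lemma impl_threshold (th : RR) : (0 < m)%N ->
  exists2 D' : P -> W -> bool -> RR, impl M (m * k) D' &
  forall p w (e : RR), 0 < e ->
    (D p w true <= th - e -> D' p w true <= (4 * m%:R * e ^+ 2)^-1) /\
    (th + e <= D p w true -> D' p w false <= (4 * m%:R * e ^+ 2)^-1).
Proof.
move=> m_gt0.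
have HF := impl_pull (fun p : P => (p, ord0 : 'I_m.+1))
  (impl_fold impl_count (nseq m tt)).
exists (fun p w o => \sum_(c : 'I_m.+1 | (m%:R * th <= c%:R) == o)
   foldk count (nseq m tt) (p, ord0) w c).
  have := impl_map (fun q : P * 'I_m.+1 => m%:R * th <= q.2%:R) HF.
  by rewrite size_nseq.
move=> p w e e_gt0.
have mR : 0 < m%:R :> RR by rewrite ltr0n.
have me_gt0 : 0 < m%:R * e by rewrite mulr_gt0.
set pr := D p w true.
have pr0 : 0 <= pr := impl_ge0 HD _ _ _.
have := @second_moment p w (m%:R * pr) m ord0 (leqnn m).
rewrite -/pr add0r subrr expr0n add0r => Hvar.
have Hprp : pr * (1 - pr) <= 4^-1 by have := sqr_ge0 (pr - 2^-1); nra.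
have tail (Q : pred 'I_m.+1) :
  (forall c, Q c -> (m%:R * e) ^+ 2 <= (c%:R - m%:R * pr) ^+ 2) ->
  \sum_(c | Q c) foldk count (nseq m tt) (p, ord0) w c <= (4 * m%:R * e ^+ 2)^-1.
  move=> HQ.
  have F0 c : 0 <= foldk count (nseq m tt) (p, ord0) w c by exact: impl_ge0 HF _ _ _.
  have : (m%:R * e) ^+ 2 * (\sum_(c | Q c) foldk count (nseq m tt) (p, ord0) w c)
      <= m%:R * 4^-1.
    apply: (@le_trans _ _ (m%:R * (pr * (1 - pr)))); last first.
      by rewrite ler_pM2l.
    rewrite -Hvar mulr_sumr [leLHS]big_mkcond; apply: ler_sum => c _.
    case: ifP => [Qc|_]; last by rewrite mulr_ge0 ?sqr_ge0.
    by rewrite mulrC ler_wpM2l // HQ.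
  rewrite -ler_pdivlMl ?exprn_gt0 // => /le_trans; apply.
  rewrite le_eqVlt; apply/orP; left; apply/eqP; field.
  by rewrite !gt_eqF.
split=> H; apply: tail => c /eqP Hc; rewrite -subr_ge0 subr_sqr.
  have : m%:R * pr + m%:R * e <= c%:R.
    rewrite -mulrDr; apply: le_trans Hc; rewrite ler_pM2l //; lra.
  by move=> ?; rewrite mulr_ge0 //; lra.
have : c%:R + m%:R * e <= m%:R * pr.
  have /ltW : c%:R < m%:R * th by rewrite ltNge Hc.
  have : m%:R * (th + e) <= m%:R * pr by rewrite ler_pM2l.
  by rewrite mulrDr; lra.
by move=> ?; rewrite -mulrNN mulr_ge0 //; lra.
Qed.

End Threshold.
(** Chebyshev makes the number [m] of runs inverse in the error [d] instead of logarithmic. The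
    theorem absorbs the difference, since errors are needed only down to [1 / (4 k)]. *)
Lemma impl_amplify (P : finType) (F : P -> W -> option bool) k
    (D : P -> W -> bool -> RR) m (th e d : RR) :
  impl M k D -> (0 < m)%N -> 0 < e -> (4 * m%:R * e ^+ 2)^-1 <= d ->
  (forall p w, F p w = Some false -> D p w true <= th - e) ->
  (forall p w, F p w = Some true -> th + e <= D p w true) ->
  exists2 D' : P -> W -> bool -> RR, impl M (m * k) D' &
    forall p w v, F p w = Some v -> 1 - d <= D' p w v.
Proof.
move=> HD m0 e0 Hd H0 H1; have [D' HD' Hth] := impl_threshold HD th m0.
exists D' => // p w v Fv; have := impl_sum1 HD' p w; rewrite big_bool /=.
have [Hlo Hhi] := Hth p w e e0.
case: v Fv => [/H1/Hhi|/H0/Hlo] ? ?; lra.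
Qed.

Lemma sum_option_bool (G : option bool -> RR) :
  \sum_o G o = G None + (G (Some true) + G (Some false)).
Proof.
rewrite (bigD1 None) //= (bigD1 (Some true)) //= (bigD1 (Some false)) //=.
by rewrite big1 ?addr0 // => -[[]|].
Qed.

Lemma impl_bounded_of_zero_error (F : W -> option bool) k
    (D : unit -> W -> option bool -> RR) :
  impl M k D ->
  (forall w v, F w = Some v -> D tt w (Some (~~ v)) = 0 /\ D tt w None <= 1 / 2) ->
  exists2 D' : unit -> W -> option bool -> RR, impl M (12 * k) D' &
    forall w v, F w = Some v -> 2 / 3 <= D' tt w (Some v).
Proof.
move=> HD HF.
have HT := impl_map (fun q : unit * option bool => q.2 == Some true) HD.
have E w : \sum_(o | (o == Some true) == true) D tt w o = D tt w (Some true).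
  by rewrite (big_pred1 (Some true)) // => o; rewrite eqb_id.
(* Acceptance has probability 0 or at least 1/2. With threshold and margin 1/4, twelve runs leave
   the error [1 / (4 * 12 / 16) = 1 / 3]. *)
have [|||p w|p w|D' HD' Hv] := @impl_amplify unit (fun=> F) _ _ 12 (1 / 4) (1 / 4) (1 / 3) HT.
- by [].
- by lra.
- by rewrite -[leRHS]invrK lef_pV2 ?posrE; lra.
- case: p => Fw; rewrite /= E; have [-> _] := HF _ _ Fw; lra.
- case: p => Fw; rewrite /= E; have [] := HF _ _ Fw.
  by have := impl_sum1 HD tt w; rewrite sum_option_bool /=; lra.
exists (fun p w o => \sum_(b | Some b == o) D' p w b).
  exact: (impl_map (fun q : unit * bool => Some q.2) HD').
move=> w v Fw; rewrite (big_pred1 v) // ; have := Hv tt w v Fw; lra.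
Qed.

(* The next three lemmas hide the kernels produced by [impl_bind], [impl_map] and
   [impl_fold], keeping a lower bound on some probabilities and the support. *)
Lemma impl_bind_ex (P O1 O2 : finType) k1 k2 (D1 : P -> W -> O1 -> RR)
    (D2 : P * O1 -> W -> O2 -> RR) :
  impl M k1 D1 -> impl M k2 D2 ->
  exists2 D : P -> W -> O2 -> RR, impl M (k1 + k2) D &
    (forall p w o1 o2, D1 p w o1 * D2 (p, o1) w o2 <= D p w o2) /\
    (forall p w o2, D p w o2 != 0 ->
       exists o1, D1 p w o1 != 0 /\ D2 (p, o1) w o2 != 0).
Proof.
move=> H1 H2; have H := impl_bind H1 H2.
exists (fun p w o => \sum_o1 D1 p w o1 * D2 (p, o1) w o) => //.
split=> [p w o1 o2|p w o2 n0].
  rewrite (bigD1 o1) //= lerDl; apply: sumr_ge0 => o _.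
  by rewrite mulr_ge0 ?(impl_ge0 H1) ?(impl_ge0 H2).
apply: contrapT => Hno; move: n0; rewrite big1 ?eqxx // => o1 _.
apply/eqP; rewrite mulf_eq0; apply/negP => /negP; rewrite negb_or => /andP[n1 n2].
by apply: Hno; exists o1.
Qed.

Lemma impl_map_ex (P O1 O2 : finType) k (D : P -> W -> O1 -> RR) (g : P * O1 -> O2) :
  impl M k D ->
  exists2 D' : P -> W -> O2 -> RR, impl M k D' &
    (forall p w o, D p w o <= D' p w (g (p, o))) /\
    (forall p w o2, D' p w o2 != 0 -> exists o1, g (p, o1) = o2 /\ D p w o1 != 0).
Proof.
move=> HD; exists (fun p w o => \sum_(o1 | g (p, o1) == o) D p w o1).
  exact: impl_map.
split=> [p w o|p w o2 n0].
  by rewrite (bigD1 o) //= lerDl; apply: sumr_ge0 => *; exact: impl_ge0 HD _ _ _.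
apply: contrapT => Hno; move: n0; rewrite big1 ?eqxx // => o1 /eqP go.
by apply/eqP; apply/negP => /negP n1; apply: Hno; exists o1.
Qed.

Lemma impl_loop (P J S : finType) k (D : P * (J * S) -> W -> S -> RR) js :
  impl M k D ->
  exists2 D' : P * S -> W -> S -> RR, impl M (size js * k) D' &
    forall p w (step : J -> S -> S),
    (forall d, (forall j s, 1 - d <= D (p, (j, s)) w (step j s)) ->
     forall s, 1 - (size js)%:R * d <= D' (p, s) w (foldl (fun s j => step j s) s js)) /\
    (forall bad : pred S,
     (forall j s s', D (p, (j, s)) w s' != 0 -> s' = step j s \/ bad s') ->
     (forall j s s', bad s -> D (p, (j, s)) w s' != 0 -> bad s') ->
     forall s o, D' (p, s) w o != 0 ->
       o = foldl (fun s j => step j s) s js \/ bad o).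
Proof.
move=> HD; exists (foldk D js); first exact: impl_fold.
move=> p w step; split=> [d Hd s|bad H1 H2 s o]; first exact: (foldk_ideal HD Hd).
exact: (foldk_support H1 H2).
Qed.

Lemma foldl_upd (J : finType) (V : Type) (x : J -> V) js (s : {ffun J -> V}) i :
  foldl (fun s j => upd s j (x j)) s js i = if i \in js then x i else s i.
Proof.
elim: js s => //= j js IH s; rewrite IH in_cons ffunE.
by case: eqP => [->|] //=; rewrite if_same.
Qed.

Lemma impl_indicator (P O : finType) k (D : P -> W -> O -> RR) p w o o' :
  impl M k D -> 1 <= D p w o -> o' != o -> D p w o' = 0.
Proof.
move=> HD H1 no; apply/eqP; rewrite eq_le (impl_ge0 HD) andbT.
have := impl_sum1 HD p w; rewrite (bigD1 o) //= (bigD1 o') //=.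
have : 0 <= \sum_(i | (i != o) && (i != o')) D p w i.
  by apply: sumr_ge0 => *; exact: impl_ge0 HD _ _ _.
lra.
Qed.

End Loops.

(** * Query circuits *)

Definition mulop (T : finType) (U V : op T) : op T :=
  fun t s => \sum_r U t r * V r s.

Lemma apply_mulop (T : finType) (U V : op T) (v : vec T) :
  apply (mulop U V) v = apply U (apply V v).
Proof.
apply/funext => t; rewrite /apply /mulop.
under eq_bigr do rewrite mulr_suml.
rewrite exchange_big; apply: eq_bigr => r _ /=.
by rewrite mulr_sumr; apply: eq_bigr => s _; rewrite mulrA.
Qed.

Lemma unitary_mulop (T : finType) (U V : op T) :
  unitary U -> unitary V -> unitary (mulop U V).
Proof.
move=> HU HV s s'.
rewrite -HV; under eq_bigr do rewrite /mulop cconjE rmorph_sum mulr_suml.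
under eq_bigr do under eq_bigr do rewrite rmorphM mulr_sumr.
rewrite exchange_big; under eq_bigr do rewrite exchange_big /=.
apply: eq_bigr => r _.
rewrite (eq_bigr (fun r' => conjc (V r s) * V r' s' * (r == r')%:R)); last first.
  move=> r' _; rewrite -HU mulr_sumr cconjE; apply: eq_bigr => t _.
  ring.
rewrite (bigD1 r) //= eqxx mulr1 big1 ?addr0 ?cconjE // => r'.
by rewrite eq_sym => /negbTE ->; rewrite mulr0.
Qed.

(* A product decomposition [HC = C x H]; the factors may be stored in either order. *)
Record splitting (C H HC : Type) := Splitting {
  mk : C -> H -> HC;
  ctl : HC -> C;
  tgt : HC -> H;
  ctl_mk : forall c h, ctl (mk c h) = c;
  tgt_mk : forall c h, tgt (mk c h) = h;
  mk_ctl_tgt : forall t, mk (ctl t) (tgt t) = t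
}.

Definition split_fst (C H : Type) : splitting C H (C * H).
Proof. by apply: (@Splitting _ _ _ pair fst snd) => // -[]. Defined.

Definition split_snd (C H : Type) : splitting C H (H * C).
Proof. by apply: (@Splitting _ _ _ (fun c h => (h, c)) snd fst) => // -[]. Defined.

(** A trivial control register, so that the control lemmas also serve to reindex the parameter of a
    circuit. *)
Definition split_unit (H : Type) : splitting unit H H.
Proof. by apply: (@Splitting _ _ _ (fun _ h => h) (fun=> tt) id) => // -[]. Defined.

Section Control.
Variables (C H HC : finType) (sp : splitting C H HC).

Lemma sum_splitting (V : nmodType) (F : HC -> V) :
  \sum_t F t = \sum_c \sum_h F (mk sp c h).
Proof.
rewrite pair_big /= (reindex (fun q : C * H => mk sp q.1 q.2)) //.
exists (fun t => (ctl sp t, tgt sp t)) => [[c h] _|t _] /=.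
  by rewrite ctl_mk tgt_mk.
exact: mk_ctl_tgt.
Qed.

Definition ctrlop (U : C -> op H) : op HC :=
  fun t s => (ctl sp t == ctl sp s)%:R * U (ctl sp s) (tgt sp t) (tgt sp s).

Lemma apply_ctrlop (U : C -> op H) (v : vec HC) :
  apply (ctrlop U) v =
  (fun t => apply (U (ctl sp t)) (fun s => v (mk sp (ctl sp t) s)) (tgt sp t)).
Proof.
apply/funext => t; rewrite /apply sum_splitting (bigD1 (ctl sp t)) //=.
rewrite [X in _ + X]big1 ?addr0 => [|c /negbTE nc].
  by apply: eq_bigr => h _; rewrite /ctrlop ctl_mk tgt_mk eqxx mul1r.
by apply: big1 => h _; rewrite /ctrlop ctl_mk eq_sym nc !mul0r.
Qed.

Lemma unitary_ctrlop (U : C -> op H) :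
  (forall c, unitary (U c)) -> unitary (ctrlop U).
Proof.
move=> HU s s'; rewrite sum_splitting (bigD1 (ctl sp s)) //=.
rewrite [X in _ + X]big1 ?addr0 => [|c /negbTE nc]; last first.
  by apply: big1 => h _; rewrite /ctrlop ctl_mk nc mul0r cconjE rmorph0 mul0r.
rewrite /ctrlop; under eq_bigr do rewrite !ctl_mk !tgt_mk eqxx mul1r.
case: (ctl sp s =P ctl sp s') => [e|ne]; last first.
  rewrite big1 => [|h _]; last by rewrite mul0r mulr0.
  by case: (s =P s') ne => // ->.
under eq_bigr do rewrite mul1r e; rewrite HU; congr (_ %:R); congr nat_of_bool.
by apply/eqP/eqP => [et|-> //]; rewrite -(mk_ctl_tgt sp s) e et mk_ctl_tgt.
Qed.

End Control.

Lemma sum_involutive (T : finType) (V : nmodType) (phi : T -> T) (F : T -> V) :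
  involutive phi -> \sum_t F (phi t) = \sum_t F t.
Proof. by move=> phiK; rewrite [RHS](reindex_inj (inv_inj phiK)). Qed.

Section QueryCircuits.
Variable n : nat.
Let input := {ffun 'I_n -> bool}.

Definition query_map (H : Type) (x : input) (q : H -> option 'I_n) (nu : H -> H) (h : H) :=
  if (if q h is Some i then x i else false) then nu h else h.

Lemma query_mapK (H : Type) (x : input) (q : H -> option 'I_n) (nu : H -> H) :
  involutive nu -> (forall h, q (nu h) = q h) -> involutive (query_map x q nu).
Proof.
move=> nuK qnu h; rewrite {2}/query_map.
by case xq: (if q h is Some i then x i else false); rewrite /query_map ?qnu xq ?nuK.
Qed.

(* Queries act as generalized CNOT gates: the bit at position [q h] of the input
   controls an involution [nu] preserving [q]. *)
Inductive qcirc (P H : finType) : nat -> (P -> input -> vec H -> vec H) -> Prop :=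
| qc_id : qcirc 0 (fun _ _ v => v)
| qc_unitary k Phi (U : P -> op H) :
    (forall p, unitary (U p)) -> qcirc k Phi ->
    qcirc k (fun p x v => apply (U p) (Phi p x v))
| qc_query k Phi (q : P -> H -> option 'I_n) (nu : P -> H -> H) :
    (forall p, involutive (nu p)) -> (forall p h, q p (nu p h) = q p h) ->
    qcirc k Phi ->
    qcirc k.+1 (fun p x v h => Phi p x v (query_map x (q p) (nu p) h)).

Lemma qcirc_norm2 (P H : finType) k Phi : @qcirc P H k Phi ->
  forall p x v, norm2 (Phi p x v) = norm2 v.
Proof.
elim=> // {k Phi} [k Phi U HU _ IH|k Phi q nu nuK qnu _ IH] p x v.
  by rewrite norm2_apply.
rewrite -(IH p x v) /norm2.
apply: (@sum_involutive _ _ (query_map x (q p) (nu p)) (fun h => sqmod (Phi p x v h))).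
exact: query_mapK.
Qed.

Lemma qcirc_scale (P H : finType) k Phi : @qcirc P H k Phi ->
  forall p x v (c : Cx), Phi p x (fun s => c * v s) = (fun t => c * Phi p x v t).
Proof.
elim=> // {k Phi} [k Phi U HU _ IH|k Phi q nu nuK qnu _ IH] p x v c; rewrite IH //.
apply/funext => t; rewrite /apply mulr_sumr; apply: eq_bigr => s _.
by rewrite mulrCA.
Qed.

Lemma qcirc_comp (P H : finType) k1 k2 Phi1 Phi2 :
  @qcirc P H k1 Phi1 -> qcirc k2 Phi2 ->
  qcirc (k1 + k2) (fun p x v => Phi2 p x (Phi1 p x v)).
Proof.
move=> H1; elim=> {k2 Phi2} [|k Phi U HU _ IH|k Phi q nu nuK qnu _ IH].
- by rewrite addn0.
- exact: (qc_unitary HU IH).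
- by rewrite addnS; exact: (qc_query nuK qnu IH).
Qed.

(** The parameter may depend on the control register. This is deferred measurement: the outcome of
    an earlier circuit, left in superposition, selects the parameter of the next one. *)
Lemma qcirc_ctrl (P P' C H HC : finType) (sp : splitting C H HC)
    (kappa : P' -> C -> P) k Phi :
  @qcirc P H k Phi ->
  @qcirc P' HC k (fun p x v t =>
    Phi (kappa p (ctl sp t)) x (fun s => v (mk sp (ctl sp t) s)) (tgt sp t)).
Proof.
elim=> {k Phi} [|k Phi U HU _ IH|k Phi q nu nuK qnu _ IH].
- have := qc_id P' HC; congr (qcirc _ _).
  by apply/funext => p; apply/funext => x; apply/funext => v; apply/funext => t;
    rewrite mk_ctl_tgt.
- have HU' p : unitary (ctrlop sp (fun c => U (kappa p c))) by exact: unitary_ctrlop.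
  have := qc_unitary HU' IH; congr (qcirc _ _).
  apply/funext => p; apply/funext => x; apply/funext => v; rewrite apply_ctrlop.
  apply/funext => t; congr (apply _ _ _); apply/funext => s.
  by rewrite ctl_mk tgt_mk.
pose nu' p t := mk sp (ctl sp t) (nu (kappa p (ctl sp t)) (tgt sp t)).
pose q' p t := q (kappa p (ctl sp t)) (tgt sp t).
have nu'K p : involutive (nu' p).
  by move=> t; rewrite /nu' ctl_mk tgt_mk nuK mk_ctl_tgt.
have qnu' p h : q' p (nu' p h) = q' p h by rewrite /q' /nu' ctl_mk tgt_mk qnu.
have := qc_query nu'K qnu' IH; congr (qcirc _ _).
apply/funext => p; apply/funext => x; apply/funext => v; apply/funext => t.
rewrite /query_map /q' /nu'; case: (if _ is Some _ then _ else _) => //.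
by rewrite ctl_mk tgt_mk.
Qed.

Definition qimpl (P O : finType) (k : nat) (D : P -> input -> O -> RR) : Prop :=
  exists (H : finType) (h0 : H) (Phi : P -> input -> vec H -> vec H) (out : P -> H -> O),
    qcirc k Phi /\
    forall p x o, D p x o = \sum_(h | out p h == o) sqmod (Phi p x (ket h0) h).

Lemma qimpl_ge0 (P O : finType) k (D : P -> input -> O -> RR) :
  qimpl k D -> forall p x o, 0 <= D p x o.
Proof.
move=> [H [h0 [Phi [out [_ HD]]]]] p x o; rewrite HD.
by apply: sumr_ge0 => *; exact: sqmod_ge0.
Qed.

Lemma qimpl_sum1 (P O : finType) k (D : P -> input -> O -> RR) :
  qimpl k D -> forall p x, \sum_o D p x o = 1.
Proof.
move=> [H [h0 [Phi [out [HP HD]]]]] p x.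
rewrite -(norm2_ket h0) -(qcirc_norm2 HP p x) /norm2.
rewrite [RHS](partition_big (out p) xpredT) //=.
by apply: eq_bigr => o _; rewrite HD.
Qed.

Lemma qimpl_pure (P O : finType) (g : P -> O) :
  qimpl 0 (fun p (_ : input) o => (o == g p)%:R).
Proof.
exists unit, tt, (fun _ _ v => v), (fun p _ => g p); split; first exact: qc_id.
move=> p x o; rewrite eq_sym; case: eqP => _ /=; last by rewrite big_pred0.
by rewrite (big_pred1 tt) => [|[]] //; exact: esym sqmod1.
Qed.

Lemma qimpl_pull (P P' O : finType) k (D : P -> input -> O -> RR) (h : P' -> P) :
  qimpl k D -> qimpl k (fun p => D (h p)).
Proof.
move=> [H [h0 [Phi [out [HP HD]]]]].
exists H, h0, (fun p => Phi (h p)), (fun p => out (h p)); split.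
  exact: (qcirc_ctrl (split_unit H) (fun p _ => h p) HP).
by move=> p x o; rewrite HD.
Qed.

Lemma ket_pair (H1 H2 : finType) (h1 t1 : H1) (h2 t2 : H2) :
  ket (h1, h2) (t1, t2) = ket h2 t2 * ket h1 t1.
Proof. by rewrite /ket xpair_eqE -mulnb natrM mulrC. Qed.

(** The register of the first circuit is only a control for the second, so its basis states do not
    interfere and the amplitudes of the two circuits multiply. *)
Lemma qimpl_bind (P O1 O2 : finType) k1 k2 (D1 : P -> input -> O1 -> RR)
    (D2 : P * O1 -> input -> O2 -> RR) :
  qimpl k1 D1 -> qimpl k2 D2 ->
  qimpl (k1 + k2) (fun p x o => \sum_o1 D1 p x o1 * D2 (p, o1) x o).
Proof.
move=> [H1 [h1 [Phi1 [out1 [HP1 HD1]]]]] [H2 [h2 [Phi2 [out2 [HP2 HD2]]]]].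
have C1 := qcirc_ctrl (split_snd H2 H1) (fun p _ => p) HP1.
have C2 := qcirc_ctrl (split_fst H1 H2) (fun p h => (p, out1 p h)) HP2.
exists (H1 * H2)%type, (h1, h2).
exists (fun p x v => (fun t => Phi2 (p, out1 p t.1) x (fun s =>
   (fun t' => Phi1 p x (fun s' => v (s', t'.2)) t'.1) (t.1, s)) t.2)).
exists (fun p t => out2 (p, out1 p t.1) t.2); split.
  exact: (qcirc_comp C1 C2).
move=> p x o /=.
have E t : Phi2 (p, out1 p t.1) x (fun s =>
     Phi1 p x (fun s' => ket (h1, h2) (s', s)) t.1) t.2
   = Phi1 p x (ket h1) t.1 * Phi2 (p, out1 p t.1) x (ket h2) t.2.
  rewrite -[RHS](congr1 (@^~ t.2) (qcirc_scale HP2 _ _ _ _)).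
  congr (Phi2 _ _ _ _); apply/funext => s.
  rewrite mulrC -[RHS](congr1 (@^~ t.1) (qcirc_scale HP1 _ _ _ _)).
  congr (Phi1 _ _ _ _); apply/funext => s'.
  exact: ket_pair.
under [RHS]eq_bigr do rewrite E sqmodM.
transitivity (\sum_h1' sqmod (Phi1 p x (ket h1) h1') * D2 (p, out1 p h1') x o).
  rewrite [RHS](partition_big (out1 p) xpredT) //=; apply: eq_bigr => o1 _.
  by rewrite HD1 mulr_suml; apply: eq_bigr => h /eqP ->.
rewrite [RHS]big_mkcond (sum_splitting (split_fst H1 H2)) /=.
apply: eq_bigr => h1' _; rewrite HD2 -big_mkcond /= mulr_sumr.
by apply: eq_bigl => h.
Qed.

Definition qmodel : model input :=
  Model qimpl_ge0 qimpl_sum1 qimpl_pure qimpl_pull qimpl_bind.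

Lemma qimpl_read : @qimpl 'I_n bool 1 (fun i x o => (o == x i)%:R).
Proof.
exists bool, false.
exists (fun i x v h => v (query_map x (fun=> Some i) negb h)), (fun _ h => h).
split.
  exact: (qc_query (q := fun i _ => Some i) (fun _ => negbK) (fun _ _ => erefl) (qc_id _ _)).
move=> i x o; rewrite (big_pred1 o) // /ket sqmod_natr /query_map.
by case: (x i); case: o.
Qed.

(* The Householder reflection exchanging the unit vectors [v] and [ket h0]
   (the identity when they agree, as the junk value of the division is 0). *)
Lemma unitary_extension (H : finType) (h0 : H) (v : H -> RR) :
  \sum_t v t ^+ 2 = 1 ->
  exists2 U : op H, unitary U & forall t, U t h0 = (v t)%:C%C.
Proof.
move=> Hv; pose w t := v t - (t == h0)%:R.
have sumw (a : H -> RR) : \sum_t (t == h0)%:R * a t = a h0.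
  rewrite (bigD1 h0) //= eqxx mul1r big1 ?addr0 // => t /negbTE ->.
  by rewrite mul0r.
pose N := \sum_t w t ^+ 2.
have NE : N = 2 - 2 * v h0.
  transitivity (\sum_t (v t ^+ 2 + (t == h0)%:R * (1 - 2 * v t))).
    by apply: eq_bigr => t _; rewrite /w; case: (t == h0) => /=; ring.
  by rewrite big_split /= Hv sumw; ring.
pose c := 2 / N.
have cN : c ^+ 2 * N = 2 * c.
  have [N0|N0] := eqVneq N 0; first by rewrite /c N0 invr0; ring.
  by rewrite /c; field.
pose u t s : RR := (t == s)%:R - c * w t * w s.
exists (fun t s => (u t s)%:C%C) => [s s'|t].
  under eq_bigr do rewrite cconjE conjc_real -rmorphM /=.
  rewrite -rmorph_sum /= [X in X%:C%C](_ : _ = (s == s')%:R) ?rmorph_nat //.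
  transitivity (\sum_t ((t == s)%:R * (t == s')%:R - (t == s)%:R * (c * w t * w s')
    - (t == s')%:R * (c * w t * w s) + c ^+ 2 * w s * w s' * w t ^+ 2)).
    by apply: eq_bigr => t _; rewrite /u; ring.
  rewrite big_split !sumrB /= -mulr_sumr -/N.
  have sumd s1 (a : H -> RR) : \sum_t (t == s1)%:R * a t = a s1.
    rewrite (bigD1 s1) //= eqxx mul1r big1 ?addr0 // => t /negbTE ->.
    by rewrite mul0r.
  rewrite !sumd.
  have -> : c ^+ 2 * w s * w s' * N = 2 * c * w s * w s' by rewrite -cN; ring.
  by ring.
congr (_%:C)%C; rewrite /u.
have [N0|N0] := eqVneq N 0.
  have w0 : w t = 0.
    have /eqP := N0; rewrite psumr_eq0 => [/allP/(_ t)|? _]; last exact: sqr_ge0.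
    by rewrite mem_index_enum sqrf_eq0 => /(_ isT)/eqP.
  by rewrite /c N0 invr0 mulr0 !mul0r subr0; move/subr0_eq: w0.
have -> : c * w t * w h0 = - w t.
  have w0 : w h0 = - N / 2 by rewrite /w eqxx NE mulr1n; field.
  by rewrite /c w0; field.
by rewrite /w; ring.
Qed.

Lemma qimpl_random (P R : finType) (w : R -> RR) :
  (forall r, 0 <= w r) -> \sum_r w r = 1 -> qimpl 0 (fun (_ : P) _ r => w r).
Proof.
move=> w0 w1.
have [r0 _] : exists r : R, true.
  case: (pickP (fun _ : R => true)) => [r _|R0]; first by exists r.
  by move: w1; rewrite big_pred0 // => /eqP; rewrite eq_sym oner_eq0.
have Hs : \sum_r (Num.sqrt (w r)) ^+ 2 = 1.
  by rewrite -[RHS]w1; apply: eq_bigr => r _; rewrite sqr_sqrtr.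
have [U HU HU0] := unitary_extension r0 Hs.
exists R, r0, (fun _ _ v => apply U v), (fun _ r => r); split.
  exact: (qc_unitary (fun _ => HU) (qc_id _ _)).
move=> p x r; rewrite (big_pred1 r) // apply_ket HU0 sqmodR sqr_sqrtr //.
Qed.

End QueryCircuits.

(** * Query algorithms and circuits *)

Lemma ord_encoding (H : finType) (h0 : H) :
  exists (enc : H -> 'I_(#|H|.-1).+1) (dec : 'I_(#|H|.-1).+1 -> H),
    [/\ cancel enc dec, cancel dec enc & enc h0 = ord0].
Proof.
have card_H : (#|H|.-1).+1 = #|H| by rewrite prednK //; apply/card_gt0P; exists h0.
pose rk h := cast_ord (esym card_H) (enum_rank h).
(* The transposition moves [h0] to [ord0], the state in which algorithms and protocols start. *)
exists (fun h => tperm ord0 (rk h0) (rk h)).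
exists (fun z => enum_val (cast_ord card_H (tperm ord0 (rk h0) z))); split.
- by move=> h; rewrite tpermK /rk cast_ordKV enum_rankK.
- by move=> z; rewrite /rk enum_valK cast_ordK tpermK.
- by rewrite tpermR.
Qed.

Lemma oracle_flipK (n w : nat) (x : {ffun 'I_n -> bool}) :
  involutive (@oracle_flip n w x).
Proof. by move=> [[i b] z]; rewrite /oracle_flip -addbA addbb addbF. Qed.

Lemma apply_oracle (n w : nat) (x : {ffun 'I_n -> bool}) (v : vec (qbasis n w)) :
  apply (oracle x) v = (fun t => v (oracle_flip x t)).
Proof. exact: apply_permop (@oracle_flipK _ _ x). Qed.

Definition subst_input (n N : nat) (sigma : 'I_N -> bool + 'I_n) (x : {ffun 'I_n -> bool}) :
    {ffun 'I_N -> bool} :=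
  [ffun i => match sigma i with inl b => b | inr j => x j end].

Section Substitution.
Variables (n N : nat) (A : qalg N) (T : nat) (P O : finType).
Variables (sigma : P -> 'I_N -> bool + 'I_n) (tau : P -> nat).
Variable out : P -> qbasis N (qa_w A) -> O.
Hypotheses (HA : qalg_valid A) (tauT : forall p, (tau p <= T)%N) (TA : (T <= qa_T A)%N).

Let flip_const p (s : qbasis N (qa_w A)) : qbasis N (qa_w A) :=
  let: (i, b, z) := s in
  (i, b (+) (if i is Some i' then if sigma p i' is inl c then c else false else false), z).

Let flip_constK p : involutive (flip_const p).
Proof. by move=> [[i b] z]; rewrite /flip_const -addbA addbb addbF. Qed.

Let var p (s : qbasis N (qa_w A)) : option 'I_n :=
  if s.1.1 is Some i then if sigma p i is inr j then Some j else None else None.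

Let neg_ans (s : qbasis N (qa_w A)) : qbasis N (qa_w A) :=
  let: (i, b, z) := s in (i, ~~ b, z).

Let oracle_subst p x s :
  oracle_flip (subst_input (sigma p) x) s = flip_const p (query_map x (var p) neg_ans s).
Proof.
case: s => [[[i|] b] z]; rewrite /query_map /var /flip_const /= ?addbF //.
rewrite ffunE; case E: (sigma p i) => [c|j] /=; first by rewrite E.
by case: (x j); rewrite /= E ?addbT ?addbF.
Qed.

(** Positions holding a constant are answered by the input-independent [flip_const]. The time
    [tau p] at which the run stops varies with [p] while the shape of a circuit does not, so the
    gates after [tau p] become identities. *)
Lemma qimpl_subst : qimpl T (fun p x o =>
  \sum_(s | out p s == o) sqmod (qrun A (subst_input (sigma p) x) (tau p) s)).
Proof.
have step k : (k <= T)%N -> exists2 Phi, @qcirc n P (qbasis N (qa_w A)) k Phi &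
    forall p x, Phi p x (ket (None, false, ord0))
      = qrun A (subst_input (sigma p) x) (minn k (tau p)).
  elim: k => [|k IH] kT.
    exists (fun p x v => apply (qa_U A 0) v); last by move=> p x; rewrite min0n.
    exact: (qc_unitary (U := fun _ : P => qa_U A 0) (fun=> HA (leq0n _)) (@qc_id n P _)).
  have [|Phi HPhi E] := IH; first by lia.
  pose act p := (k < tau p)%N.
  have U1 p : unitary (if act p then permop (flip_const p) else @idop _).
    by case: ifP => _; [exact/unitary_permop/inv_inj | exact: unitary_idop].
  have U2 p : unitary (if act p then qa_U A k.+1 else @idop _).
    by case: ifP => _; [apply: HA; lia | exact: unitary_idop].
  have q1 : forall p h, (if act p then var p (neg_ans h) else None) = if act p then var p h else None.
    by move=> p [[i b] z].
  have nK : forall p : P, involutive neg_ans.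
    by move=> p [[i b] z]; rewrite /neg_ans negbK.
  have := qc_unitary U2 (qc_query (q := fun p h => if act p then var p h else None)
    nK q1 (qc_unitary U1 HPhi)).
  set Psi := (X in qcirc _ X) => HPsi; exists Psi => // p x.
  rewrite /Psi E /act; case: (boolP (k < tau p)%N) => ktau.
    rewrite (minn_idPl ktau) (minn_idPl (ltnW ktau)) /=.
    rewrite apply_permop // apply_oracle; congr apply; apply/funext => s.
    by rewrite oracle_subst.
  rewrite -leqNgt in ktau; rewrite (minn_idPr ktau) (minn_idPr (leqW ktau)) !apply_idop //.
have [Phi HPhi E] := step T (leqnn T).
exists (qbasis N (qa_w A)), (None, false, ord0), Phi, out; split=> // p x o.
by rewrite E (minn_idPr (tauT p)).
Qed.

End Substitution.

Lemma qimpl_qalg (n N : nat) (A : qalg N) (P : finType) (sigma : P -> 'I_N -> bool + 'I_n) :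
  qalg_valid A ->
  qimpl (qa_T A) (fun p x o => qalg_prob A (subst_input (sigma p) x) o).
Proof.
by move=> HA; apply: (@qimpl_subst _ _ A _ _ _ sigma (fun=> qa_T A) (fun=> qa_out A)).
Qed.

Lemma subst_input_id (n : nat) (x : {ffun 'I_n -> bool}) : subst_input inr x = x.
Proof. by apply/ffunP => i; rewrite ffunE. Qed.

(** * Compilation of query circuits into algorithms *)

Section ToAlgorithm.
Variables (n w : nat) (H : finType) (h0 : H) (enc : H -> 'I_w.+1) (dec : 'I_w.+1 -> H).
Hypotheses (encK : cancel enc dec) (decK : cancel dec enc) (enc0 : enc h0 = ord0).

Let run (U : nat -> op (qbasis n w)) (x : {ffun 'I_n -> bool}) :=
  fix run j := match j with
  | 0 => apply (U 0) (ket (None, false, ord0))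
  | j'.+1 => apply (U j) (apply (oracle x) (run j'))
  end.

Let eq_run U V x k : (forall j, (j <= k)%N -> U j = V j) -> run U x k = run V x k.
Proof.
elim: k => [|k IH] E /=; first by rewrite E.
by rewrite E // IH // => j jk; apply: E; apply: leqW.
Qed.

Let embed (v : vec H) : vec (qbasis n w) :=
  fun t => let: (i, b, z) := t in (i == None)%:R * (~~ b)%:R * v (dec z).

Let swap_none (c i : option 'I_n) :=
  if i == None then c else if i == c then None else i.

Let swap_noneK c : involutive (swap_none c).
Proof.
move=> i; rewrite /swap_none.
case: (i =P None) => [->|iN]; first by case: c => //= j; rewrite eqxx.
by case: (i =P c) => [->|iq]; rewrite ?eqxx //; do 2 case: eqP => //.
Qed.

(* A query of a circuit takes two oracle calls, the second one erasing the answer. *)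
Let load (q : H -> option 'I_n) (t : qbasis n w) : qbasis n w :=
  let: (i, b, z) := t in (swap_none (q (dec z)) i, b, z).

Let act (nu : H -> H) (t : qbasis n w) : qbasis n w :=
  let: (i, b, z) := t in (i, b, if b then enc (nu (dec z)) else z).

Let loadK q : involutive (load q).
Proof. by move=> [[i b] z]; rewrite /load swap_noneK. Qed.

Let actK nu : involutive nu -> involutive (act nu).
Proof.
by move=> nuK [[i b] z]; rewrite /act; case: b => //; rewrite encK nuK decK.
Qed.

Let embed_query x (q : H -> option 'I_n) nu (v : vec H) :
  involutive nu -> (forall h, q (nu h) = q h) ->
  apply (permop (load q)) (apply (oracle x) (apply (permop (act nu))
    (apply (oracle x) (apply (permop (load q)) (embed v)))))
  = embed (fun h => v (query_map x q nu h)).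
Proof.
move=> nuK qnu; rewrite (apply_permop _ (loadK q)) apply_oracle.
rewrite (apply_permop _ (actK nuK)) apply_oracle (apply_permop _ (loadK q)).
apply/funext => -[[i b] z] /=.
set a := (if swap_none _ _ is Some _ then _ else _).
(* Since [nu] preserves [q], the address is still readable after the action, so the second oracle
   call returns the same bit and erases it. *)
have -> : q (dec (if b (+) a then enc (nu (dec z)) else z)) = q (dec z).
  by case: ifP => _ //; rewrite encK qnu.
rewrite swap_noneK -addbA addbb addbF.
have [iN|iN] := eqVneq i None; last by rewrite !mul0r.
case: b; first by rewrite !(mulr0, mul0r).
rewrite addFb /query_map.
have -> : a = if q (dec z) is Some j then x j else false.
  by rewrite /a iN /swap_none eqxx.
by case: ifP => _; rewrite ?encK.
Qed.

Let simulation k Phi : @qcirc n unit H k Phi ->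
  exists2 U : nat -> op (qbasis n w), (forall j, unitary (U j)) &
    forall x, run U x k.*2 = embed (Phi tt x (ket h0)).
Proof.
elim=> {k Phi} [|k Phi V HV _ [U HU E]|k Phi q nu nuK qnu _ [U HU E]].
- exists (fun=> permop id) => [j|x]; first exact: unitary_permop.
  rewrite /= apply_permop //; apply/funext => -[[i b] z].
  rewrite /ket /embed !xpair_eqE -!mulnb !natrM (can2_eq decK encK) enc0.
  by case: b.
(* A gate without queries is merged into the last unitary, since a new step would cost an oracle
   call. *)
- pose lift := ctrlop (split_fst [the finType of (option 'I_n * bool)%type] [the finType of 'I_w.+1])
    (fun _ z z' => V tt (dec z) (dec z')).
  have HL : unitary lift.
    apply: unitary_ctrlop => _ z z'.
    rewrite (reindex enc) /=; last by exists dec => ? _; rewrite ?encK ?decK.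
    under eq_bigr do rewrite encK.
    by rewrite HV (inj_eq (can_inj decK)).
  exists (fun j => if j == k.*2 then mulop lift (U j) else U j) => [j|x].
    by case: ifP => _ //; exact: unitary_mulop.
  transitivity (apply lift (run U x k.*2)).
    case: k {E} => [|k] /=; first by rewrite apply_mulop.
    rewrite eqxx apply_mulop; congr (apply _ (apply _ (apply _ _))).
    by apply: (@eq_run _ _ x k.*2.+1) => j jk; rewrite ifF //; apply/eqP; lia.
  rewrite E apply_ctrlop; apply/funext => -[[i b] z] /=.
  rewrite /apply mulr_sumr (reindex enc) /=; last by exists dec => ? _; rewrite ?encK ?decK.
  by apply: eq_bigr => h _; rewrite encK mulrCA.
exists (fun j => if j == k.*2 then mulop (permop (load (q tt))) (U j)
   else if j == k.*2.+1 then permop (act (nu tt))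
   else if j == k.*2.+2 then permop (load (q tt)) else U j) => [j|x].
  case: ifP => _; first by apply: unitary_mulop => //; exact/unitary_permop/inv_inj.
  case: ifP => _; first exact/unitary_permop/inv_inj/actK/(nuK tt).
  by case: ifP => _ //; exact/unitary_permop/inv_inj.
rewrite doubleS /= eqxx -(embed_query _ _ (nuK tt) (qnu tt)) -E.
have -> : (k.*2.+2 == k.*2) = false by apply/eqP; lia.
have -> : (k.*2.+1 == k.*2) = false by apply/eqP; lia.
have -> : (k.*2.+2 == k.*2.+1) = false by apply/eqP; lia.
rewrite !eqxx; congr (apply _ (apply _ (apply _ (apply _ _)))).
case: k {E} => [|k] /=; first by rewrite apply_mulop.
rewrite eqxx apply_mulop; congr (apply _ (apply _ (apply _ _))).
apply: (@eq_run _ _ x k.*2.+1) => j jk.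
by do 3 (rewrite ifF; last by apply/eqP; lia).
Qed.

Lemma qalg_of_qcirc k Phi (out : H -> option bool) : @qcirc n unit H k Phi ->
  exists A : qalg n, [/\ qa_T A = k.*2, qalg_valid A & forall x o,
    qalg_prob A x o = \sum_(h | out h == o) sqmod (Phi tt x (ket h0) h)].
Proof.
move=> /simulation[U HU E].
pose A := @QAlg n w k.*2 U (fun t => out (dec t.2)).
exists A; split=> // x o.
have runE j : qrun A x j = run U x j by elim: j => //= j ->.
rewrite /qalg_prob /prob runE E big_mkcond /=.
rewrite (sum_splitting (split_fst [the finType of (option 'I_n * bool)%type] [the finType of 'I_w.+1])) /=.
rewrite (bigD1 (None, false)) //= [X in _ + X]big1 ?addr0 => [|[i b] nib].
  rewrite (reindex enc) /=; last by exists dec => ? _; rewrite ?encK ?decK.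
  by rewrite [RHS]big_mkcond; apply: eq_bigr => h _; rewrite encK mul1r mul1r.
apply: big1 => z _; rewrite (_ : _ * _ = 0 :> Cx) ?sqmod0 ?if_same //.
by move: nib; case: i => [i|]; case: b => //=; rewrite ?mulr0 !mul0r.
Qed.

End ToAlgorithm.

Lemma qalg_of_qimpl (n k : nat) (D : unit -> {ffun 'I_n -> bool} -> option bool -> RR) :
  qimpl k D -> exists A : qalg n,
    [/\ qa_T A = k.*2, qalg_valid A & forall x o, qalg_prob A x o = D tt x o].
Proof.
move=> [H [h0 [Phi [out [HP HD]]]]].
have [enc [dec [encK decK enc0]]] := ord_encoding h0.
have [A [TA VA EA]] := qalg_of_qcirc encK decK enc0 (out tt) HP.
by exists A; split=> // x o; rewrite EA HD.
Qed.

(** * Communication circuits *)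

Definition split_pairs (C1 C2 H1 H2 : Type) :
  splitting (C1 * C2) (H1 * H2) ((C1 * H1) * (C2 * H2)).
Proof.
apply: (@Splitting _ _ _ (fun c h => ((c.1, h.1), (c.2, h.2)))
  (fun t => (t.1.1, t.2.1)) (fun t => (t.1.2, t.2.2))).
- by move=> [? ?] [? ?].
- by move=> [? ?] [? ?].
- by move=> [[? ?] [? ?]].
Defined.

Section CommunicationCircuits.

Definition cflip (H H' : Type) (g : H -> bool) (nu : H' -> H') (a : H) (b : H') : H' :=
  if g a then nu b else b.

Definition on_fst (HA HB : finType) (U : op HA) (v : vec (HA * HB)%type) : vec (HA * HB)%type :=
  fun t => apply U (fun s => v (s, t.2)) t.1.
Definition on_snd (HA HB : finType) (U : op HB) (v : vec (HA * HB)%type) : vec (HA * HB)%type :=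
  fun t => apply U (fun s => v (t.1, s)) t.2.

(* The channel is replaced by CNOT-like gates between the registers of the two parties. *)
Inductive ccirc (IA IB : Type) (HA HB : finType) :
    nat -> (IA -> IB -> vec (HA * HB)%type -> vec (HA * HB)%type) -> Prop :=
| cc_id : ccirc 0 (fun _ _ v => v)
| cc_alice k Phi (U : IA -> op HA) :
    (forall x, unitary (U x)) -> ccirc k Phi ->
    ccirc k.+1 (fun x y v => on_fst (U x) (Phi x y v))
| cc_bob k Phi (U : IB -> op HB) :
    (forall y, unitary (U y)) -> ccirc k Phi ->
    ccirc k.+1 (fun x y v => on_snd (U y) (Phi x y v))
| cc_send k Phi (g : IA -> HA -> bool) (nu : IB -> HB -> HB) :
    (forall y, involutive (nu y)) -> ccirc k Phi ->
    ccirc k.+1 (fun x y v t => Phi x y v (t.1, cflip (g x) (nu y) t.1 t.2))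
| cc_recv k Phi (g : IB -> HB -> bool) (mu : IA -> HA -> HA) :
    (forall x, involutive (mu x)) -> ccirc k Phi ->
    ccirc k.+1 (fun x y v t => Phi x y v (cflip (g y) (mu x) t.2 t.1, t.2)).

Variables (IA IB : Type).

Lemma norm2_on_fst (HA HB : finType) (U : op HA) (v : vec (HA * HB)%type) :
  unitary U -> norm2 (on_fst U v) = norm2 v.
Proof.
move=> HU; rewrite /norm2 !(sum_splitting (split_snd HB HA)) /=.
by apply: eq_bigr => b _; exact: (norm2_apply (fun s => v (s, b)) HU).
Qed.

Lemma norm2_on_snd (HA HB : finType) (U : op HB) (v : vec (HA * HB)%type) :
  unitary U -> norm2 (on_snd U v) = norm2 v.
Proof.
move=> HU; rewrite /norm2 !(sum_splitting (split_fst HA HB)) /=.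
by apply: eq_bigr => a _; exact: (norm2_apply (fun s => v (a, s)) HU).
Qed.

Lemma ccirc_norm2 (HA HB : finType) k Phi : @ccirc IA IB HA HB k Phi ->
  forall x y v, norm2 (Phi x y v) = norm2 v.
Proof.
elim=> // {k Phi} [k Phi U HU _ IH|k Phi U HU _ IH|k Phi g nu nuK _ IH|k Phi g mu muK _ IH] x y v.
- by rewrite norm2_on_fst.
- by rewrite norm2_on_snd.
- rewrite -(IH x y v) /norm2.
  apply: (@sum_involutive _ _ (fun t : HA * HB => (t.1, cflip (g x) (nu y) t.1 t.2))
    (fun t => sqmod (Phi x y v t))).
  by move=> [a b]; rewrite /cflip /=; case: (g x a); rewrite ?nuK.
- rewrite -(IH x y v) /norm2.
  apply: (@sum_involutive _ _ (fun t : HA * HB => (cflip (g y) (mu x) t.2 t.1, t.2))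
    (fun t => sqmod (Phi x y v t))).
  by move=> [a b]; rewrite /cflip /=; case: (g y b); rewrite ?muK.
Qed.

Lemma ccirc_scale (HA HB : finType) k Phi : @ccirc IA IB HA HB k Phi ->
  forall x y v (c : Cx), Phi x y (fun s => c * v s) = (fun t => c * Phi x y v t).
Proof.
elim=> // {k Phi} [k Phi U HU _ IH|k Phi U HU _ IH|k Phi g nu nuK _ IH|k Phi g mu muK _ IH] x y v c;
  rewrite IH //; apply/funext => t; rewrite /on_fst /on_snd /apply mulr_sumr;
  by apply: eq_bigr => s _; rewrite mulrCA.
Qed.

Lemma ccirc_comp (HA HB : finType) k1 k2 Phi1 Phi2 :
  @ccirc IA IB HA HB k1 Phi1 -> ccirc k2 Phi2 ->
  ccirc (k1 + k2) (fun x y v => Phi2 x y (Phi1 x y v)).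
Proof.
move=> H1; elim=> {k2 Phi2} [|k Phi U HU _ IH|k Phi U HU _ IH|k Phi g nu nuK _ IH|k Phi g mu muK _ IH];
  rewrite ?addn0 ?addnS //.
- exact: (cc_alice HU IH).
- exact: (cc_bob HU IH).
- exact: (cc_send g nuK IH).
- exact: (cc_recv g muK IH).
Qed.

Lemma ccirc_ctrl (IA' IB' : Type) (CA HA HCA CB HB HCB : finType)
    (sA : splitting CA HA HCA) (sB : splitting CB HB HCB)
    (kA : IA' -> CA -> IA) (kB : IB' -> CB -> IB) k Phi :
  @ccirc IA IB HA HB k Phi ->
  @ccirc IA' IB' HCA HCB k (fun x y v t =>
    Phi (kA x (ctl sA t.1)) (kB y (ctl sB t.2))
      (fun s => v (mk sA (ctl sA t.1) s.1, mk sB (ctl sB t.2) s.2))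
      (tgt sA t.1, tgt sB t.2)).
Proof.
elim=> {k Phi} [|k Phi U HU _ IH|k Phi U HU _ IH|k Phi g nu nuK _ IH|k Phi g mu muK _ IH].
- have := cc_id IA' IB' HCA HCB; congr (ccirc _ _).
  apply/funext => x; apply/funext => y; apply/funext => v; apply/funext => -[a b] /=.
  by rewrite !mk_ctl_tgt.
- have HU' x : unitary (ctrlop sA (fun c => U (kA x c))) by exact: unitary_ctrlop.
  have := cc_alice HU' IH; congr (ccirc _ _).
  apply/funext => x; apply/funext => y; apply/funext => v; apply/funext => -[a b].
  rewrite /on_fst apply_ctrlop /=; congr (apply _ _ _); apply/funext => s.
  by rewrite ctl_mk tgt_mk.
- have HU' y : unitary (ctrlop sB (fun c => U (kB y c))) by exact: unitary_ctrlop.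
  have := cc_bob HU' IH; congr (ccirc _ _).
  apply/funext => x; apply/funext => y; apply/funext => v; apply/funext => -[a b].
  rewrite /on_snd apply_ctrlop /=; congr (apply _ _ _); apply/funext => s.
  by rewrite ctl_mk tgt_mk.
- pose nu' y t := mk sB (ctl sB t) (nu (kB y (ctl sB t)) (tgt sB t)).
  have nu'K y : involutive (nu' y).
    by move=> t; rewrite /nu' ctl_mk tgt_mk nuK mk_ctl_tgt.
  have := cc_send (fun x t => g (kA x (ctl sA t)) (tgt sA t)) nu'K IH; congr (ccirc _ _).
  apply/funext => x; apply/funext => y; apply/funext => v; apply/funext => -[a b].
  by rewrite /cflip /= /nu'; case: (g _ _); rewrite ?ctl_mk ?tgt_mk.
- pose mu' x t := mk sA (ctl sA t) (mu (kA x (ctl sA t)) (tgt sA t)).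
  have mu'K x : involutive (mu' x).
    by move=> t; rewrite /mu' ctl_mk tgt_mk muK mk_ctl_tgt.
  have := cc_recv (fun y t => g (kB y (ctl sB t)) (tgt sB t)) mu'K IH; congr (ccirc _ _).
  apply/funext => x; apply/funext => y; apply/funext => v; apply/funext => -[a b].
  by rewrite /cflip /= /mu'; case: (g _ _); rewrite ?ctl_mk ?tgt_mk.
Qed.

End CommunicationCircuits.

Section CommunicationModel.
Variables IA IB : Type.

(* Both parties know the classical parameter and must end up agreeing on the outcome. *)
Definition cimpl (P O : finType) (k : nat) (D : P -> IA * IB -> O -> RR) : Prop :=
  exists (HA HB : finType) (a0 : HA) (b0 : HB)
    (Phi : P * IA -> P * IB -> vec (HA * HB)%type -> vec (HA * HB)%type)
    (outA : P -> HA -> O) (outB : P -> HB -> O),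
    ccirc k Phi /\
    forall p x y,
      (forall a b, outA p a != outB p b -> Phi (p, x) (p, y) (ket (a0, b0)) (a, b) = 0) /\
      forall o, D p (x, y) o =
        \sum_(t | outA p t.1 == o) sqmod (Phi (p, x) (p, y) (ket (a0, b0)) t).

Lemma cimpl_ge0 (P O : finType) k (D : P -> IA * IB -> O -> RR) :
  cimpl k D -> forall p w o, 0 <= D p w o.
Proof.
move=> [HA [HB [a0 [b0 [Phi [outA [outB [_ HD]]]]]]]] p [x y] o.
have [_ ->] := HD p x y.
by apply: sumr_ge0 => *; exact: sqmod_ge0.
Qed.

Lemma cimpl_sum1 (P O : finType) k (D : P -> IA * IB -> O -> RR) :
  cimpl k D -> forall p w, \sum_o D p w o = 1.
Proof.
move=> [HA [HB [a0 [b0 [Phi [outA [outB [HP HD]]]]]]]] p [x y].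
rewrite -(norm2_ket (a0, b0)) -(ccirc_norm2 HP (p, x) (p, y)) /norm2.
rewrite [RHS](partition_big (fun t : HA * HB => outA p t.1) xpredT) //=.
by apply: eq_bigr => o _; have [_ ->] := HD p x y.
Qed.

Lemma cimpl_pure (P O : finType) (g : P -> O) :
  cimpl 0 (fun p (_ : IA * IB) o => (o == g p)%:R).
Proof.
exists unit, unit, tt, tt, (fun _ _ v => v), (fun p _ => g p), (fun p _ => g p).
split=> [|p x y]; first exact: cc_id.
split=> [a b|o]; first by rewrite eqxx.
rewrite eq_sym; case: eqP => _ /=; last by rewrite big_pred0.
by rewrite (big_pred1 (tt, tt)) => [|[[] []]] //; exact: esym sqmod1.
Qed.

Lemma cimpl_pull (P P' O : finType) k (D : P -> IA * IB -> O -> RR) (h : P' -> P) :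
  cimpl k D -> cimpl k (fun p => D (h p)).
Proof.
move=> [HA [HB [a0 [b0 [Phi [outA [outB [HP HD]]]]]]]].
have := ccirc_ctrl (split_unit HA) (split_unit HB)
  (fun px (_ : unit) => (h px.1, px.2)) (fun py (_ : unit) => (h py.1, py.2)) HP.
set Psi := (X in ccirc _ X) => HPsi.
exists HA, HB, a0, b0, Psi, (fun p => outA (h p)), (fun p => outB (h p)).
split=> // p x y; have [H1 H2] := HD (h p) x y.
have E : Psi (p, x) (p, y) (ket (a0, b0)) = Phi (h p, x) (h p, y) (ket (a0, b0)).
  rewrite /Psi /=; apply/funext => -[a b] /=; congr (Phi _ _ _ _).
by rewrite E; split.
Qed.

Lemma cimpl_bind (P O1 O2 : finType) k1 k2 (D1 : P -> IA * IB -> O1 -> RR)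
    (D2 : P * O1 -> IA * IB -> O2 -> RR) :
  cimpl k1 D1 -> cimpl k2 D2 ->
  cimpl (k1 + k2) (fun p w o => \sum_o1 D1 p w o1 * D2 (p, o1) w o).
Proof.
move=> [A1 [B1 [a1 [b1 [Phi1 [outA1 [outB1 [HP1 HD1]]]]]]]].
move=> [A2 [B2 [a2 [b2 [Phi2 [outA2 [outB2 [HP2 HD2]]]]]]]].
have C1 := ccirc_ctrl (split_snd A2 A1) (split_snd B2 B1)
  (fun px _ => px) (fun py _ => py) HP1.
have C2 := ccirc_ctrl (split_fst A1 A2) (split_fst B1 B2)
  (fun (px : P * IA) a => ((px.1, outA1 px.1 a), px.2))
  (fun (py : P * IB) b => ((py.1, outB1 py.1 b), py.2)) HP2.
have := ccirc_comp C1 C2; set Psi := (X in ccirc _ X) => HPsi.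
exists (A1 * A2)%type, (B1 * B2)%type, (a1, a2), (b1, b2), Psi.
exists (fun p t => outA2 (p, outA1 p t.1) t.2), (fun p t => outB2 (p, outB1 p t.1) t.2).
split=> // p x y.
have [N1 E1] := HD1 p x y.
have E t : Psi (p, x) (p, y) (ket ((a1, a2), (b1, b2))) t
   = Phi1 (p, x) (p, y) (ket (a1, b1)) (t.1.1, t.2.1) *
     Phi2 (p, outA1 p t.1.1, x) (p, outB1 p t.2.1, y) (ket (a2, b2)) (t.1.2, t.2.2).
  rewrite -[RHS](congr1 (@^~ _) (ccirc_scale HP2 _ _ _ _)).
  congr (Phi2 _ _ _ _); apply/funext => s.
  rewrite mulrC -[RHS](congr1 (@^~ _) (ccirc_scale HP1 _ _ _ _)).
  congr (Phi1 _ _ _ _); apply/funext => s' /=.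
  rewrite /ket -natrM mulnb; congr (_ %:R); congr nat_of_bool.
  by rewrite !xpair_eqE; case: s s' => [? ?] [? ?] /=; rewrite !xpair_eqE andbACA andbC.
split=> [[t1 t2] [u1 u2] /= H|o].
  (* Each party controls the second circuit by its own copy of the first outcome; where the copies
     differ, the amplitude is already 0. *)
  rewrite E /=; have [eo|no] := eqVneq (outA1 p t1) (outB1 p u1); last by rewrite N1 ?mul0r.
  have [N2 _] := HD2 (p, outA1 p t1) x y.
  by rewrite -eo in H *; rewrite N2 ?mulr0.
under [RHS]eq_bigr do rewrite E sqmodM.
transitivity (\sum_h1 sqmod (Phi1 (p, x) (p, y) (ket (a1, b1)) h1) *
    D2 (p, outA1 p h1.1) (x, y) o).
  rewrite [RHS](partition_big (fun h1 : A1 * B1 => outA1 p h1.1) xpredT) //=.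
  apply: eq_bigr => o1 _.
  by rewrite E1 mulr_suml; apply: eq_bigr => h /eqP ->.
rewrite [RHS]big_mkcond (sum_splitting (split_pairs _ _ _ _)) /=.
apply: eq_bigr => -[h1 h2] _; rewrite -big_mkcond /=.
have [eo|no] := eqVneq (outA1 p h1) (outB1 p h2); last first.
  by rewrite N1 // sqmod0 mul0r big1 // => *; rewrite mul0r.
have [_ ->] := HD2 (p, outA1 p h1) x y.
by rewrite mulr_sumr eo; apply: eq_bigr => -[? ?].
Qed.

Definition cmodel : model (IA * IB) :=
  Model cimpl_ge0 cimpl_sum1 cimpl_pure cimpl_pull cimpl_bind.

End CommunicationModel.

(** * Protocols and circuits *)

Definition split_assoc (A C B : Type) : splitting A (C * B) (A * C * B).
Proof.
by apply: (@Splitting _ _ _ (fun a s => (a, s.1, s.2)) (fun t => t.1.1) (fun t => (t.1.2, t.2)))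
  => [//|? []|[[]]].
Defined.

Definition split_channelA (A B : Type) : splitting bool (A * bool * B) (A * bool * (bool * B)).
Proof.
by apply: (@Splitting _ _ _ (fun c s => (s.1, (c, s.2))) (fun t => t.2.1)
  (fun t => (t.1, t.2.2))) => [//|? []|[? []]].
Defined.

Definition split_channelB (A B : Type) : splitting bool (A * bool * B) (A * bool * (bool * B)).
Proof.
by apply: (@Splitting _ _ _ (fun c s => ((s.1.1, c), (s.1.2, s.2))) (fun t => t.1.2)
  (fun t => (t.1.1, t.2.1, t.2.2))) => [//|? [[]]|[[? ?] []]].
Defined.

Lemma apply_liftA (da db : nat) (U : op ('I_da.+1 * bool)%type) v a c b :
  apply (liftA db U) v (a, c, b) = apply U (fun s => v (s, b)) (a, c).
Proof.
rewrite /apply (sum_splitting (split_fst ('I_da.+1 * bool)%type 'I_db.+1)) /=.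
apply: eq_bigr => -[a' c'] _; rewrite (bigD1 b) //= eqxx mulr1 big1 ?addr0 //.
by move=> b'; rewrite eq_sym => /negbTE ->; rewrite mulr0 mul0r.
Qed.

Lemma apply_liftB (da db : nat) (U : op (bool * 'I_db.+1)%type) v a c b :
  apply (liftB da U) v (a, c, b) = apply U (fun s => v (a, s.1, s.2)) (c, b).
Proof.
rewrite /apply (sum_splitting (split_assoc 'I_da.+1 bool 'I_db.+1)) /=.
rewrite (bigD1 a) //= [X in _ + X]big1 ?addr0 => [|a' /negbTE na].
  by apply: eq_bigr => -[c' b'] _ /=; rewrite eqxx mul1r.
by apply: big1 => s _; rewrite eq_sym na !mul0r.
Qed.

Section Announce.
Variables (P : finType) (IA IB : Type) (HA HB : finType) (a0 : HA) (b0 : HB) (k : nat).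
Variable Phi : P * IA -> P * IB -> vec (HA * HB)%type -> vec (HA * HB)%type.
Hypothesis HPhi : ccirc k Phi.

Let neg1 (H : Type) (t : H * (bool * bool)) := (t.1, (~~ t.2.1, t.2.2)).
Let neg2 (H : Type) (t : H * (bool * bool)) := (t.1, (t.2.1, ~~ t.2.2)).
Let neg1K H : involutive (@neg1 H).
Proof. by move=> [h [r1 r2]]; rewrite /neg1 /= negbK. Qed.
Let neg2K H : involutive (@neg2 H).
Proof. by move=> [h [r1 r2]]; rewrite /neg2 /= negbK. Qed.

Let decode (r : bool * bool) : option bool := if r.1 then Some r.2 else None.

(** A protocol leaves the answer with one party, whereas [cimpl] wants both to know it: two CNOT
    gates send the two bits encoding an [option bool], hence the cost [k.+2]. *)
Lemma cimpl_announceA (out : HA -> option bool) :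
  cimpl k.+2 (fun p (w : IA * IB) o =>
    \sum_(t | out t.1 == o) sqmod (Phi (p, w.1) (p, w.2) (ket (a0, b0)) t)).
Proof.
have := ccirc_ctrl (split_unit HA) (split_snd (bool * bool)%type HB)
  (fun px _ => px) (fun py _ => py) HPhi.
move/(cc_send (fun _ a => isSome (out a)) (fun _ => @neg1K HB)).
move/(cc_send (fun _ a => out a == Some true) (fun _ => @neg2K HB)).
set Psi := (X in ccirc _ X) => HPsi.
exists HA, (HB * (bool * bool))%type, a0, (b0, (false, false)), Psi.
exists (fun _ => out), (fun _ t => decode t.2); split=> // p x y.
(* The code word [(false, true)] also decodes to [None] but is never written; the factor
   [r.1 || ~~ r.2] removes it. *)
have E a b r : Psi (p, x) (p, y) (ket (a0, (b0, (false, false)))) (a, (b, r)) =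
    (out a == decode r)%:R * ((r.1 || ~~ r.2)%:R * Phi (p, x) (p, y) (ket (a0, b0)) (a, b)).
  transitivity (((isSome (out a) == r.1) && ((out a == Some true) == r.2))%:R
     * Phi (p, x) (p, y) (ket (a0, b0)) (a, b)); last first.
    by rewrite mulrA -natrM mulnb; case: r (out a) => [[] []] [[]|].
  rewrite -[RHS](congr1 (@^~ _) (ccirc_scale HPhi _ _ _ _)) /Psi /=.
  rewrite /cflip /neg1 /neg2; case: r (out a) => [[] []] [[]|] /=;
    congr (Phi _ _ _ _); apply/funext => -[a' b'];
    by rewrite /ket !xpair_eqE /= ?eqxx ?andbT ?andbF ?mul1r ?mul0r.
split=> [a [b r] /= no|o]; first by rewrite E (negbTE no) mul0r.
rewrite [LHS]big_mkcond [RHS]big_mkcond /=.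
rewrite (sum_splitting (split_fst HA HB)) (sum_splitting (split_fst HA (HB * (bool * bool))%type)) /=.
apply: eq_bigr => a _; rewrite (sum_splitting (split_fst HB (bool * bool)%type)) /=.
apply: eq_bigr => b _.
under [RHS]eq_bigr do rewrite E.
rewrite (sum_splitting (split_fst bool bool)) !big_bool /=.
by case: eqP => _; rewrite ?addr0 //; case: (out a) => [[]|];
   rewrite /= !(mul0r, mul1r) ?sqmod0 ?addr0 ?add0r.
Qed.

Lemma cimpl_announceB (out : HB -> option bool) :
  cimpl k.+2 (fun p (w : IA * IB) o =>
    \sum_(t | out t.2 == o) sqmod (Phi (p, w.1) (p, w.2) (ket (a0, b0)) t)).
Proof.
have := ccirc_ctrl (split_snd (bool * bool)%type HA) (split_unit HB)
  (fun px _ => px) (fun py _ => py) HPhi.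
move/(cc_recv (fun _ b => isSome (out b)) (fun _ => @neg1K HA)).
move/(cc_recv (fun _ b => out b == Some true) (fun _ => @neg2K HA)).
set Psi := (X in ccirc _ X) => HPsi.
exists (HA * (bool * bool))%type, HB, (a0, (false, false)), b0, Psi.
exists (fun _ t => decode t.2), (fun _ => out); split=> // p x y.
have E a b r : Psi (p, x) (p, y) (ket ((a0, (false, false)), b0)) ((a, r), b) =
    (out b == decode r)%:R * ((r.1 || ~~ r.2)%:R * Phi (p, x) (p, y) (ket (a0, b0)) (a, b)).
  transitivity (((isSome (out b) == r.1) && ((out b == Some true) == r.2))%:R
     * Phi (p, x) (p, y) (ket (a0, b0)) (a, b)); last first.
    by rewrite mulrA -natrM mulnb; case: r (out b) => [[] []] [[]|].
  rewrite -[RHS](congr1 (@^~ _) (ccirc_scale HPhi _ _ _ _)) /Psi /=.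
  rewrite /cflip /neg1 /neg2; case: r (out b) => [[] []] [[]|] /=;
    congr (Phi _ _ _ _); apply/funext => -[a' b'];
    by rewrite /ket !xpair_eqE /= ?eqxx ?andbT ?andbF ?mul1r ?mul0r.
split=> [[a r] b /= no|o].
  by rewrite E eq_sym (negbTE no) mul0r.
rewrite [LHS]big_mkcond [RHS]big_mkcond /=.
rewrite (sum_splitting (split_snd HB HA)) (sum_splitting (split_snd HB (HA * (bool * bool))%type)) /=.
apply: eq_bigr => b _; rewrite (sum_splitting (split_fst HA (bool * bool)%type)) /=.
apply: eq_bigr => a _.
under [RHS]eq_bigr do rewrite E.
rewrite (sum_splitting (split_fst bool bool)) !big_bool /= /decode /=.
case: (out b) => [[]|]; case: o => [[]|];
   by rewrite /= !(mul0r, mul1r) ?sqmod0 ?addr0 ?add0r.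
Qed.

End Announce.

(** * Simulation of a protocol by a circuit *)

Section FromProtocol.
Variables (IA IB IA' IB' : Type) (P : finType) (prot : qprot IA IB).
Hypothesis valid : qprot_valid prot.
Variables (rA : P -> IA' -> IA) (rB : P -> IB' -> IB).
Let HA : finType := ('I_(qp_da prot).+1 * bool)%type.
Let HB : finType := (bool * 'I_(qp_db prot).+1)%type.

(* Both parties own a copy of the channel qubit; the one of the party not
   holding the channel is [false]. *)
Let embed (j : nat) (v : vec (cbasis (qp_da prot) (qp_db prot))) : vec (HA * HB)%type :=
  fun t => if odd j then (~~ t.1.2)%:R * v (t.1.1, t.2.1, t.2.2)
           else (~~ t.2.1)%:R * v (t.1.1, t.1.2, t.2.2).

Let negA (s : HA) : HA := (s.1, ~~ s.2).
Let negB (s : HB) : HB := (~~ s.1, s.2).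
Let negAK : involutive negA.
Proof. by move=> [? ?]; rewrite /negA /= negbK. Qed.
Let negBK : involutive negB.
Proof. by move=> [? ?]; rewrite /negB /= negbK. Qed.

Let simulation j : (j <= qp_k prot)%N ->
  exists2 Phi : P * IA' -> P * IB' -> vec (HA * HB)%type -> vec (HA * HB)%type,
    ccirc (3 * j).+1 Phi & forall px py,
    Phi px py (ket ((ord0, false), (false, ord0)))
    = embed j (qp_run prot (rA px.1 px.2) (rB py.1 py.2) j).
Proof.
elim: j => [|j IH] jk.
  have U0 (px : P * IA') : unitary (qp_UA prot 0 (rA px.1 px.2)) by exact: (valid jk).1.
  have := cc_alice U0 (cc_id (P * IA') (P * IB') HA HB).
  set Phi := (X in ccirc _ X) => HPhi; exists Phi => // px py.
  apply/funext => -[[a c] [c' b]]; rewrite /Phi /embed /= /qp_step /= apply_liftA /on_fst /=.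
  rewrite /apply mulr_sumr; apply: eq_bigr => -[a1 c1] _.
  rewrite mulrCA; congr (_ * _); rewrite /ket -natrM mulnb !xpair_eqE /=.
  by case: c'; rewrite ?andbF //= ?andbT andbA.
have [|Phi HPhi E] := IH; first exact: ltnW.
have UA (px : P * IA') : unitary (qp_UA prot j.+1 (rA px.1 px.2)) by exact: (valid jk).1.
have UB (py : P * IB') : unitary (qp_UB prot j.+1 (rB py.1 py.2)) by exact: (valid jk).2.
have -> : (3 * j.+1).+1 = ((3 * j).+1).+3 by lia.
have E' px py a c c' b : Phi px py (ket ((ord0, false), (false, ord0))) ((a, c), (c', b))
  = embed j (qp_run prot (rA px.1 px.2) (rB py.1 py.2) j) ((a, c), (c', b)) by rewrite E.
(* Passing the channel qubit takes two CNOT gates, one writing it to the clear copy of the receiver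
   and one clearing the copy of the sender. With the local unitary this makes three gates per
   message. *)
case Ej: (odd j).
  have := cc_alice UA (cc_send (fun _ (a : HA) => a.2) (fun _ => negBK)
    (cc_recv (fun _ (b : HB) => b.1) (fun _ => negAK) HPhi)).
  set Psi := (X in ccirc _ X) => HPsi; exists Psi => // px py.
  apply/funext => -[[a c] [c' b]]; rewrite /Psi /on_fst /embed /= Ej /=.
  rewrite /qp_step /= Ej /= apply_liftA /apply mulr_sumr; apply: eq_bigr => -[a1 c1] _.
  rewrite mulrCA; congr (_ * _); rewrite /cflip /negA /negB /=.
  by case: c1; case: c' => /=; rewrite E' /embed Ej /= ?mul0r ?mul1r.
have := cc_bob UB (cc_recv (fun _ (b : HB) => b.1) (fun _ => negAK)
   (cc_send (fun _ (a : HA) => a.2) (fun _ => negBK) HPhi)).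
set Psi := (X in ccirc _ X) => HPsi; exists Psi => // px py.
apply/funext => -[[a c] [c' b]]; rewrite /Psi /on_snd /embed /= Ej /=.
rewrite /qp_step /= Ej /= apply_liftB /apply mulr_sumr; apply: eq_bigr => -[c1 b1] _.
rewrite mulrCA; congr (_ * _); rewrite /cflip /negA /negB /=.
by case: c1; case: c => /=; rewrite E' /embed Ej /= ?mul0r ?mul1r.
Qed.

Lemma cimpl_qprot : cimpl (3 * qp_k prot + 3)
  (fun p (w : IA' * IB') o => qprot_prob prot (rA p w.1) (rB p w.2) o).
Proof.
have [Phi HPhi E] := simulation (leqnn _).
have -> : (3 * qp_k prot + 3 = (3 * qp_k prot).+3)%N by lia.
case Ek: (odd (qp_k prot)).
  have := cimpl_announceB (ord0, false) (false, ord0) HPhi (qp_outB prot).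
  congr (cimpl _ _); apply/funext => p; apply/funext => w; apply/funext => o.
  rewrite E /qprot_prob /prob /embed Ek [LHS]big_mkcond [RHS]big_mkcond /=.
  rewrite (sum_splitting (split_channelB 'I_(qp_da prot).+1 'I_(qp_db prot).+1)).
  rewrite big_bool /= big1 ?add0r => [|t _]; last by rewrite mul0r sqmod0 if_same.
  by apply: eq_bigr => -[[a c] b] _; rewrite /= Ek mul1r.
have := cimpl_announceA (ord0, false) (false, ord0) HPhi (qp_outA prot).
congr (cimpl _ _); apply/funext => p; apply/funext => w; apply/funext => o.
rewrite E /qprot_prob /prob /embed Ek [LHS]big_mkcond [RHS]big_mkcond /=.
rewrite (sum_splitting (split_channelA 'I_(qp_da prot).+1 'I_(qp_db prot).+1)).
rewrite big_bool /= big1 ?add0r => [|t _]; last by rewrite mul0r sqmod0 if_same.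
by apply: eq_bigr => -[[a c] b] _; rewrite /= Ek mul1r.
Qed.

End FromProtocol.
Lemma apply_liftA_perm (da db : nat) (phi : 'I_da.+1 * bool -> 'I_da.+1 * bool) v :
  involutive phi ->
  apply (liftA db (permop phi)) v = (fun t => v (phi t.1, t.2)).
Proof.
by move=> phiK; apply/funext => -[[a c] b]; rewrite apply_liftA apply_permop.
Qed.

Lemma apply_liftB_perm (da db : nat) (phi : bool * 'I_db.+1 -> bool * 'I_db.+1) v :
  involutive phi ->
  apply (liftB da (permop phi)) v =
  (fun t => v (t.1.1, (phi (t.1.2, t.2)).1, (phi (t.1.2, t.2)).2)).
Proof.
by move=> phiK; apply/funext => -[[a c] b]; rewrite apply_liftB apply_permop.
Qed.

(** * Simulation of a circuit by a protocol *)

Section ToProtocol.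
Variables (IA IB : Type) (HA HB : finType) (a0 : HA) (b0 : HB).
Variables (da db : nat) (encA : HA -> 'I_da.+1) (decA : 'I_da.+1 -> HA).
Variables (encB : HB -> 'I_db.+1) (decB : 'I_db.+1 -> HB).
Hypotheses (encAK : cancel encA decA) (decAK : cancel decA encA) (encA0 : encA a0 = ord0).
Hypotheses (encBK : cancel encB decB) (decBK : cancel decB encB) (encB0 : encB b0 = ord0).

Let opA := op ('I_da.+1 * bool)%type.
Let opB := op (bool * 'I_db.+1)%type.

Let run (UA : nat -> IA -> opA) (UB : nat -> IB -> opB) x y :=
  fix run j : vec (cbasis da db) := match j with
  | 0 => apply (liftA db (UA 0 x)) (ket (ord0, false, ord0))
  | j'.+1 => apply (if odd j then liftB da (UB j y) else liftA db (UA j x)) (run j')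
  end.

Let eq_run UA UB UA' UB' x y k :
  (forall j, (j <= k)%N -> UA j = UA' j) -> (forall j, (j <= k)%N -> UB j = UB' j) ->
  run UA UB x y k = run UA' UB' x y k.
Proof.
elim: k => [|k IH] EA EB /=; first by rewrite EA.
rewrite EA // EB // IH // => j jk; [apply: EA|apply: EB]; exact: leqW.
Qed.

Let embed (v : vec (HA * HB)%type) : vec (cbasis da db) :=
  fun t => let: (a, c, b) := t in (~~ c)%:R * v (decA a, decB b).

Let runs k (Psi : IA -> IB -> vec (cbasis da db)) :=
  exists UA UB, [/\ forall j x, unitary (UA j x), forall j y, unitary (UB j y) &
    forall x y, run UA UB x y k = Psi x y].

(** Operations alternate between the parties, so every gate is padded to the period Bob, Alice, Bob,
    Alice. This suffices for a CNOT-like gate: the control bit is put on the channel, the other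
    party acts, and the bit is erased. *)
Let runs_extend k Psi (VB1 VB3 : IB -> opB) (VA2 VA4 : IA -> opA) :
  (forall y, unitary (VB1 y)) -> (forall x, unitary (VA2 x)) ->
  (forall y, unitary (VB3 y)) -> (forall x, unitary (VA4 x)) ->
  runs (4 * k) Psi ->
  runs (4 * k.+1) (fun x y => apply (liftA db (VA4 x)) (apply (liftB da (VB3 y))
    (apply (liftA db (VA2 x)) (apply (liftB da (VB1 y)) (Psi x y))))).
Proof.
move=> H1 H2 H3 H4 [UA [UB [HA' HB' E]]].
have -> : (4 * k.+1 = (4 * k).+4)%N by lia.
exists (fun j => if j == (4 * k).+2 then VA2 else if j == (4 * k).+4 then VA4 else UA j).
exists (fun j => if j == (4 * k).+1 then VB1 else if j == (4 * k).+3 then VB3 else UB j).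
split=> [j x|j y|x y]; [by do 2 case: ifP => _ // |by do 2 case: ifP => _ //|].
rewrite -E /= oddM /= !eqxx.
have -> : ((4 * k).+4 == (4 * k).+2) = false by apply/eqP; lia.
have -> : ((4 * k).+3 == (4 * k).+1) = false by apply/eqP; lia.
congr (apply _ (apply _ (apply _ (apply _ _)))).
by apply: eq_run => j jk; rewrite !ifF //; apply/eqP; lia.
Qed.

Let runs_circuit k Phi : @ccirc IA IB HA HB k Phi ->
  runs (4 * k) (fun x y => embed (Phi x y (ket (a0, b0)))).
Proof.
have idAK : involutive (@id ('I_da.+1 * bool)) by [].
have idBK : involutive (@id (bool * 'I_db.+1)) by [].
have idA (x : IA) : unitary (permop (@id ('I_da.+1 * bool))) by exact/unitary_permop.
have idB (y : IB) : unitary (permop (@id (bool * 'I_db.+1))) by exact/unitary_permop.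
elim=> {k Phi} [|k Phi U HU _ IH|k Phi U HU _ IH|k Phi g nu nuK _ IH|k Phi g mu muK _ IH].
- exists (fun _ => fun=> permop id), (fun _ => fun=> permop id); split=> [_|_|x y]; try by [].
  rewrite muln0 /= apply_liftA_perm //; apply/funext => -[[a c] b] /=.
  rewrite /ket !xpair_eqE (can2_eq decAK encAK) (can2_eq decBK encBK) encA0 encB0.
  by rewrite -natrM mulnb; case: c; rewrite ?andbF ?andbT.
- pose lU x := ctrlop (split_snd bool 'I_da.+1) (fun _ z z' => U x (decA z) (decA z')).
  have HL x : unitary (lU x).
    apply: unitary_ctrlop => _ z z'.
    rewrite (reindex encA) /=; last by exists decA => ? _; rewrite ?encAK ?decAK.
    under eq_bigr do rewrite encAK.
    by rewrite HU (inj_eq (can_inj decAK)).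
  have [UA [UB [? ? E]]] := runs_extend idB HL idB idA IH.
  exists UA, UB; split=> // x y; rewrite E apply_liftA_perm // !apply_liftB_perm //.
  apply/funext => -[[a c] b]; rewrite apply_liftA /lU apply_ctrlop /= /on_fst /apply mulr_sumr.
  rewrite (reindex encA) /=; last by exists decA => ? _; rewrite ?encAK ?decAK.
  by apply: eq_bigr => h _; rewrite encAK mulrCA.
- pose lU y := ctrlop (split_fst bool 'I_db.+1) (fun _ z z' => U y (decB z) (decB z')).
  have HL y : unitary (lU y).
    apply: unitary_ctrlop => _ z z'.
    rewrite (reindex encB) /=; last by exists decB => ? _; rewrite ?encBK ?decBK.
    under eq_bigr do rewrite encBK.
    by rewrite HU (inj_eq (can_inj decBK)).
  have [UA [UB [? ? E]]] := runs_extend HL idA idB idA IH.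
  exists UA, UB; split=> // x y; rewrite E !apply_liftA_perm // !apply_liftB_perm //.
  apply/funext => -[[a c] b]; rewrite apply_liftB /lU apply_ctrlop /= /on_snd /apply mulr_sumr.
  rewrite (reindex encB) /=; last by exists decB => ? _; rewrite ?encBK ?decBK.
  by apply: eq_bigr => h _; rewrite encBK mulrCA.
- pose fl x (s : 'I_da.+1 * bool) := (s.1, s.2 (+) g x (decA s.1)).
  pose ac y (s : bool * 'I_db.+1) := (s.1, if s.1 then encB (nu y (decB s.2)) else s.2).
  have flK x : involutive (fl x) by move=> [a c]; rewrite /fl /= addbK.
  have acK y : involutive (ac y).
    by move=> [c b]; rewrite /ac /=; case: c; rewrite // encBK nuK decBK.
  have HF x : unitary (permop (fl x)) by exact/unitary_permop/inv_inj.
  have HC y : unitary (permop (ac y)) by exact/unitary_permop/inv_inj.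
  have [UA [UB [? ? E]]] := runs_extend idB HF HC HF IH.
  exists UA, UB; split=> // x y; rewrite E !apply_liftA_perm // !apply_liftB_perm //.
  apply/funext => -[[a c] b] /=; rewrite addbK /cflip /=.
  by case: c; rewrite ?mul0r //=; case: (g x _); rewrite ?encBK.
- pose fl y (s : bool * 'I_db.+1) := (s.1 (+) g y (decB s.2), s.2).
  pose ac x (s : 'I_da.+1 * bool) := (if s.2 then encA (mu x (decA s.1)) else s.1, s.2).
  have flK y : involutive (fl y) by move=> [a c]; rewrite /fl /= addbK.
  have acK x : involutive (ac x).
    by move=> [b c]; rewrite /ac /=; case: c; rewrite // encAK muK decAK.
  have HF y : unitary (permop (fl y)) by exact/unitary_permop/inv_inj.
  have HC x : unitary (permop (ac x)) by exact/unitary_permop/inv_inj.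
  have [UA [UB [? ? E]]] := runs_extend HF HC HF idA IH.
  exists UA, UB; split=> // x y; rewrite E !apply_liftA_perm // !apply_liftB_perm //.
  apply/funext => -[[a c] b] /=; rewrite addbK /cflip /=.
  by case: c; rewrite ?mul0r //=; case: (g y _); rewrite ?encAK.
Qed.

Lemma qprot_of_ccirc (k : nat) Phi (out : HA -> option bool) : @ccirc IA IB HA HB k Phi ->
  exists prot : qprot IA IB, [/\ qp_k prot = (4 * k)%N, qprot_valid prot & forall x y o,
    qprot_prob prot x y o = \sum_(t | out t.1 == o) sqmod (Phi x y (ket (a0, b0)) t)].
Proof.
move=> /runs_circuit[UA [UB [HUA HUB E]]].
(* The length [4 * k] is even, so Alice is the one who measures. *)
pose prot := @QProt IA IB da db (4 * k) UA UB (fun s => out (decA s.1)) (fun=> None).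
exists prot; split=> // x y o.
have runE j : qp_run prot x y j = run UA UB x y j by elim: j => //= j ->.
rewrite /qprot_prob /prob runE E [LHS]big_mkcond [RHS]big_mkcond /=.
rewrite (sum_splitting (split_assoc 'I_da.+1 bool 'I_db.+1)) /=.
rewrite (sum_splitting (split_fst HA HB)) (reindex encA) /=; last first.
  by exists decA => ? _; rewrite ?encAK ?decAK.
apply: eq_bigr => a _; rewrite (sum_splitting (split_fst bool 'I_db.+1)) big_bool /=.
rewrite big1 ?add0r => [|b _]; last by rewrite mul0r sqmod0 if_same.
rewrite (reindex encB) /=; last by exists decB => ? _; rewrite ?encBK ?decBK.
by apply: eq_bigr => b _; rewrite oddM /= !encAK encBK mul1r.
Qed.

End ToProtocol.

Lemma qprot_of_cimpl (IA IB : Type) (k : nat) (D : unit -> IA * IB -> option bool -> RR) :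
  cimpl k D -> exists prot : qprot IA IB, [/\ qp_k prot = (4 * k)%N, qprot_valid prot &
    forall x y o, qprot_prob prot x y o = D tt (x, y) o].
Proof.
move=> [HA [HB [a0 [b0 [Phi [outA [outB [HP HD]]]]]]]].
have := ccirc_ctrl (split_unit HA) (split_unit HB)
  (fun x (_ : unit) => (tt, x)) (fun y (_ : unit) => (tt, y)) HP.
have [encA [decA [encAK decAK encA0]]] := ord_encoding a0.
have [encB [decB [encBK decBK encB0]]] := ord_encoding b0.
move/(qprot_of_ccirc encAK decAK encA0 encBK decBK encB0 (outA tt)) => [prot [Ek V E]].
exists prot; split=> // x y o; rewrite E; have [_ ->] := HD tt x y.
by apply: eq_bigr => -[a b] _ /=; congr (sqmod (Phi _ _ _ _)); apply/funext => -[].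
Qed.

(** * Minimax *)

(* Blackwell's approachability argument: as long as every distribution [mu] admits
   a good row, playing against the positive part of the accumulated deficit keeps
   the squared deficit linear in the number of rounds. *)
Lemma approx_minimax (R I : finType) (M : R -> I -> RR) (i0 : I) (eta : RR) :
  0 < eta <= 1 -> (forall r i, `|M r i| <= 1) ->
  (exists w : R -> RR, [/\ forall r, 0 <= w r, \sum_r w r = 1 &
     forall i, eta / 2 <= \sum_r w r * M r i]) \/
  (exists mu : I -> RR, [/\ forall i, 0 <= mu i, \sum_i mu i = 1 &
     forall r, \sum_i mu i * M r i <= eta]).
Proof.
move=> /andP[eta0 eta1] HM.
case: (pselect (exists mu : I -> RR, [/\ forall i, 0 <= mu i, \sum_i mu i = 1 &
     forall r, \sum_i mu i * M r i <= eta])) => [Hmu|Hno]; [by right|left].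
have row (a : I -> RR) : (forall i, 0 <= a i) ->
    exists r, \sum_i a i * (eta - M r i) <= 0.
  move=> a0; have [sa0|sa0] := eqVneq (\sum_i a i) 0.
    have az i : a i = 0 by have /eqP := psumr_eq0P (fun i _ => a0 i) sa0 (i := i) isT => /eqP.
    (* Without any deficit every row will do. If there were no row, a point mass would satisfy the
       second alternative vacuously, against [Hno]. *)
    have [r _] : exists r : R, True.
      apply: contrapT => Hr; apply: Hno; exists (fun i => (i == i0)%:R); split=> [i|| r].
      - by rewrite ler0n.
      - by rewrite (bigD1 i0) //= eqxx big1 ?addr0 // => i /negbTE ->.
      - by case: Hr; exists r.
    by exists r; rewrite big1 // => i _; rewrite az mul0r.
  have sa_gt0 : 0 < \sum_i a i by rewrite lt_neqAle eq_sym sa0 sumr_ge0.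
  apply: contrapT => Hr; apply: Hno; exists (fun i => a i / \sum_i a i); split=> [i||r].
  - by rewrite divr_ge0 // ltW.
  - by rewrite -mulr_suml mulfV.
  - have -> : \sum_i a i / (\sum_i a i) * M r i = (\sum_i a i * M r i) / \sum_i a i.
      by rewrite mulr_suml; apply: eq_bigr => i _; rewrite mulrAC.
    rewrite ler_pdivrMr // mulr_sumr leNgt; apply/negP => Hlt; apply: Hr; exists r.
    under eq_bigr do rewrite mulrBr [a _ * eta]mulrC.
    by rewrite sumrB subr_le0 ltW.
pose pos (u : RR) := Num.max u 0.
have pos0 u : 0 <= pos u by rewrite le_max lexx orbT.
have posD u d : pos (u + d) ^+ 2 <= pos u ^+ 2 + 2 * (pos u * d) + d ^+ 2.
  have -> : pos u ^+ 2 + 2 * (pos u * d) + d ^+ 2 = (pos u + d) ^+ 2 by ring.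
  rewrite {1}/pos; case: (leP (u + d) 0) => ud; first by rewrite expr0n sqr_ge0.
  rewrite ler_sqr ?nnegrE; last 2 first.
  - exact: ltW.
  - by apply: le_trans (ltW ud) _; rewrite lerD2r le_max lexx.
  by rewrite lerD2r le_max lexx.
pose deficit n (c : R -> nat) i := n%:R * eta - \sum_r (c r)%:R * M r i.
(* [c] counts how often each row was played. By [row] the cross term is never positive, and
   [(eta - M r i)^2 <= 4] bounds the growth in one round by [4 |I|]. *)
have play n : exists2 c : R -> nat, (\sum_r c r = n)%N &
    \sum_i pos (deficit n c i) ^+ 2 <= 4 * n%:R * #|I|%:R.
  elim: n => [|n [c sc Hc]].
    exists (fun=> 0%N); first by rewrite big1.
    rewrite mulr0 mul0r big1 // => i _; rewrite /deficit mul0r big1 ?subr0.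
      by rewrite /pos maxxx expr0n.
    by move=> r _; rewrite mul0r.
  have [r0 Hr0] := row (fun i => pos (deficit n c i)) (fun i => pos0 _).
  exists (fun r => (c r + (r == r0))%N).
    rewrite big_split /= sc (bigD1 r0) //= eqxx big1 ?addn0 ?addn1 //.
    by move=> r /negbTE ->.
  have E i : deficit n.+1 (fun r => (c r + (r == r0))%N) i
      = deficit n c i + (eta - M r0 i).
    rewrite /deficit; under eq_bigr do rewrite natrD mulrDl.
    rewrite big_split /= [X in _ - (_ + X)](bigD1 r0) //= eqxx mul1r.
    rewrite [X in _ - (_ + (_ + X))]big1 => [|r /negbTE ->]; last by rewrite mul0r.
    by rewrite -natr1; ring.
  apply: (@le_trans _ _ (\sum_i (pos (deficit n c i) ^+ 2
     + 2 * (pos (deficit n c i) * (eta - M r0 i)) + 4))).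
    apply: ler_sum => i _; rewrite E; apply: le_trans (posD _ _) _.
    rewrite lerD2l; have := HM r0 i; rewrite ler_norml => /andP[? ?]; nra.
  rewrite !big_split /= -mulr_sumr sumr_const -natr1.
  by lra.
(* Such an [n] makes [4 n |I|] at most [(n eta / 2)^2], so the average falls short of [eta] by at
   most half. *)
have [n HnR] : exists n : nat, 16 * #|I|%:R / eta ^+ 2 < n%:R.
  exists (Num.truncn (16 * #|I|%:R / eta ^+ 2)).+1; exact: truncnS_gt.
have I0 : 0 < #|I|%:R :> RR by rewrite ltr0n; apply/card_gt0P; exists i0.
have n0 : 0 < n%:R :> RR.
  by apply: lt_trans HnR; rewrite divr_gt0 ?mulr_gt0 ?exprn_gt0.
have [c sc Hc] := play n.
exists (fun r => (c r)%:R / n%:R); split=> [r||i].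
- by rewrite divr_ge0.
- by rewrite -mulr_suml -natr_sum sc mulfV // gt_eqF.
have : pos (deficit n c i) ^+ 2 <= (n%:R * eta / 2) ^+ 2.
  apply: (@le_trans _ _ (\sum_i pos (deficit n c i) ^+ 2)).
    by rewrite (bigD1 i) //= lerDl; apply: sumr_ge0 => *; exact: sqr_ge0.
  apply: le_trans Hc _; move: HnR; rewrite ltr_pdivrMr ?exprn_gt0 // => HnR.
  by nra.
have hn : 0 <= n%:R * eta / 2 by rewrite divr_ge0 // mulr_ge0 // ltW.
rewrite ler_sqr ?nnegrE // => Hp.
have : deficit n c i <= n%:R * eta / 2 by apply: le_trans Hp; rewrite le_max lexx.
rewrite /deficit => Hd.
have -> : \sum_r (c r)%:R / n%:R * M r i = (\sum_r (c r)%:R * M r i) / n%:R.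
  by rewrite mulr_suml; apply: eq_bigr => r _; rewrite mulrAC.
rewrite ler_pdivlMr //; lra.
Qed.

(** * The adversary bound for cheat sheets *)

Lemma sqmodB_le (th : RR) (a b : Cx) : 0 < th ->
  sqmod (a - b) <= (1 + th) * sqmod a + (1 + th^-1) * sqmod b.
Proof.
move=> th0; case: a b => [a1 a2] [b1 b2]; rewrite /sqmod /=.
have aux (u v : RR) : (u - v) ^+ 2 <= (1 + th) * u ^+ 2 + (1 + th^-1) * v ^+ 2.
  rewrite -subr_ge0.
  have -> : (1 + th) * u ^+ 2 + (1 + th^-1) * v ^+ 2 - (u - v) ^+ 2
    = (th * u + v) ^+ 2 / th by field; rewrite gt_eqF.
  by rewrite divr_ge0 ?sqr_ge0 // ltW.
by have := aux a1 b1; have := aux a2 b2; lra.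
Qed.

Lemma sqmodB_ge (th : RR) (a b : Cx) : 0 < th ->
  (1 - th) * sqmod a + (1 - th^-1) * sqmod b <= sqmod (a - b).
Proof.
move=> th0; case: a b => [a1 a2] [b1 b2]; rewrite /sqmod /=.
have aux (u v : RR) : (1 - th) * u ^+ 2 + (1 - th^-1) * v ^+ 2 <= (u - v) ^+ 2.
  rewrite -subr_ge0.
  have -> : (u - v) ^+ 2 - ((1 - th) * u ^+ 2 + (1 - th^-1) * v ^+ 2)
    = (th * u - v) ^+ 2 / th by field; rewrite gt_eqF.
  by rewrite divr_ge0 ?sqr_ge0 // ltW.
by have := aux a1 b1; have := aux a2 b2; lra.
Qed.

Definition dist2 (T : finType) (v w : vec T) : RR := norm2 (fun t => v t - w t).

Lemma dist2_triangle (T : finType) (u v w : vec T) :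
  dist2 v w <= 2 * dist2 u v + 2 * dist2 u w.
Proof.
rewrite /dist2 /norm2 !mulr_sumr -big_split; apply: ler_sum => t _ /=.
have -> : v t - w t = (u t - w t) - (u t - v t) by ring.
by apply: le_trans (sqmodB_le _ _ ltr01) _; rewrite invr1; lra.
Qed.

Lemma dist2_ge (T : finType) (v w : vec T) (Q : pred T) :
  prob w Q = 0 -> prob v Q <= dist2 v w.
Proof.
move=> w0; rewrite /dist2 /norm2 (bigID Q) /= -[leLHS]addr0; apply: lerD; last first.
  by apply: sumr_ge0 => *; exact: sqmod_ge0.
apply: ler_sum => t Qt; rewrite (_ : w t = 0) ?subr0 //.
apply: sqmod_eq0; have /eqP := w0; rewrite /prob psumr_eq0 => [|*]; last exact: sqmod_ge0.
by move=> /allP/(_ t); rewrite mem_index_enum Qt => /(_ isT)/eqP.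
Qed.

Section Adversary.
Variables (N : nat) (A : qalg N).
Hypothesis HA : qalg_valid A.

Lemma qrun_norm2 x t : (t <= qa_T A)%N -> norm2 (qrun A x t) = 1.
Proof.
elim: t => [|t IH] tT /=; first by rewrite norm2_apply ?norm2_ket //; exact: HA.
rewrite norm2_apply; last exact: HA.
rewrite apply_oracle -(IH (ltnW tT)) /norm2.
exact: (sum_involutive (fun s => sqmod (qrun A x t s)) (@oracle_flipK _ _ x)).
Qed.

Definition query_mass (Q : pred (option 'I_N)) x t : RR :=
  \sum_(s | Q s.1.1) sqmod (qrun A x t s).

Lemma query_mass_ge0 Q x t : 0 <= query_mass Q x t.
Proof. by apply: sumr_ge0 => *; exact: sqmod_ge0. Qed.

Lemma query_mass_le1 Q x t : (t <= qa_T A)%N -> query_mass Q x t <= 1.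
Proof.
move=> tT; rewrite -(qrun_norm2 x tT) /norm2 (bigID (fun s : qbasis _ _ => Q s.1.1)) /=.
by rewrite lerDl; apply: sumr_ge0 => *; exact: sqmod_ge0.
Qed.

Variables (x y : {ffun 'I_N -> bool}) (c : 'I_N) (th : RR).
Hypotheses (xy : forall i, i != c -> x i = y i) (th0 : 0 < th).

(* Only the part of the state querying [c] matters; its cross term is split by AM-GM
   with weight [th], so that the masses on both inputs are weighted differently. *)
Lemma dist2_step (v w : vec (qbasis N (qa_w A))) :
  dist2 (apply (oracle x) v) (apply (oracle y) w) <= dist2 v w
   + 2 * th * (\sum_(s | s.1.1 == Some c) sqmod (v s))
   + 2 * th^-1 * (\sum_(s | s.1.1 == Some c) sqmod (w s)).
Proof.
pose at_c (s : qbasis N (qa_w A)) := s.1.1 == Some c.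
have at_flip z s : at_c (oracle_flip z s) = at_c s by case: s => [[]].
have flip_sum z (F : qbasis N (qa_w A) -> RR) :
    \sum_(s | at_c s) F (oracle_flip z s) = \sum_(s | at_c s) F s.
  rewrite [RHS](reindex_inj (inv_inj (@oracle_flipK _ _ z))) /=.
  by apply: eq_bigl => s; rewrite at_flip.
have flip_sumN z (F : qbasis N (qa_w A) -> RR) :
    \sum_(s | ~~ at_c s) F (oracle_flip z s) = \sum_(s | ~~ at_c s) F s.
  rewrite [RHS](reindex_inj (inv_inj (@oracle_flipK _ _ z))) /=.
  by apply: eq_bigl => s; rewrite at_flip.
rewrite !apply_oracle /dist2 /norm2 (bigID at_c) [X in _ <= X + _ + _](bigID at_c) /=.
have -> : \sum_(s | ~~ at_c s) sqmod (v (oracle_flip x s) - w (oracle_flip y s))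
   = \sum_(s | ~~ at_c s) sqmod (v s - w s).
  rewrite -[RHS](flip_sumN x); apply: eq_bigr => -[[i b] z] nc.
  rewrite (_ : oracle_flip y (i, b, z) = oracle_flip x (i, b, z)) //.
  rewrite /oracle_flip; case: i nc => [i|] //; rewrite /at_c /= => ic.
  by rewrite xy.
have up : \sum_(s | at_c s) sqmod (v (oracle_flip x s) - w (oracle_flip y s))
  <= (1 + th) * (\sum_(s | at_c s) sqmod (v s)) + (1 + th^-1) * (\sum_(s | at_c s) sqmod (w s)).
  rewrite -(flip_sum x (fun s => sqmod (v s))) -(flip_sum y (fun s => sqmod (w s))).
  by rewrite !mulr_sumr -big_split; apply: ler_sum => s _; exact: sqmodB_le.
(* Bounding the old distance from below in the same way cancels the terms with coefficient 1; only
   the cross terms [2 th V] and [2 W' / th] remain. *)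
have lo : (1 - th) * (\sum_(s | at_c s) sqmod (v s)) + (1 - th^-1) * (\sum_(s | at_c s) sqmod (w s))
  <= \sum_(s | at_c s) sqmod (v s - w s).
  by rewrite !mulr_sumr -big_split; apply: ler_sum => s _; exact: sqmodB_ge.
move: up lo; rewrite /at_c; set V := \sum_(s | _) sqmod (v s); set W' := \sum_(s | _) sqmod (w s).
by move=> up lo; nra.
Qed.

Lemma dist2_qrun t : (t <= qa_T A)%N ->
  dist2 (qrun A x t) (qrun A y t) <=
  \sum_(t' < t) (2 * th * query_mass (pred1 (Some c)) x t'
               + 2 * th^-1 * query_mass (pred1 (Some c)) y t').
Proof.
elim: t => [|t IH] tT.
  rewrite big_ord0 /dist2 /norm2 big1 // => s _ /=; rewrite subrr; exact: sqmod0.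
rewrite big_ord_recr /= {1}/dist2 -applyB norm2_apply; last exact: HA.
by apply: le_trans (dist2_step _ _) _; rewrite -addrA lerD2r IH // ltnW.
Qed.

End Adversary.

(** * The cheat sheet function and the masses of its cells *)

Section CheatSheet.
Variables (n k S : nat).
Let cells := ({ffun 'I_k -> bool} * bool * 'I_S)%type.
Let coords := ('I_k * 'I_n + cells)%type.
Let N := #|{: coords}|.

Definition cs_encode (xs : 'I_k -> {ffun 'I_n -> bool}) (z : {ffun cells -> bool}) :
    {ffun 'I_N -> bool} :=
  [ffun i => match enum_val i with inl (a, q) => xs a q | inr c => z c end].
Definition cs_copy (w : {ffun 'I_N -> bool}) (a : 'I_k) : {ffun 'I_n -> bool} :=
  [ffun q => w (enum_rank (inl (a, q) : coords))].
Definition cs_cells (w : {ffun 'I_N -> bool}) : {ffun cells -> bool} :=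
  [ffun c => w (enum_rank (inr c : coords))].
Definition parity (z : {ffun cells -> bool}) (l : {ffun 'I_k -> bool}) (b : bool) : bool :=
  \big[addb/false]_(j < S) z (l, b, j).
Definition cs_index (f : pfun n) (w : {ffun 'I_N -> bool}) : {ffun 'I_k -> bool} :=
  [ffun a => f (cs_copy w a) == Some true].

(* [k] inputs of [f] together with an array indexed by [{0,1}^k] whose entries are
   pairs of [S]-bit strings; the only string of odd parity is the one with index
   [(f x_1, .., f x_k)] and label [v], where [v] is the value of the function. *)
Definition cheat_sheet (f : pfun n) : pfun N := fun w =>
  let v := parity (cs_cells w) (cs_index f w) true in
  if [forall a, f (cs_copy w a) != None] &&
     [forall l, forall b, parity (cs_cells w) l b == (l == cs_index f w) && (b == v)]
  then Some v else None.

Lemma cs_copy_encode xs z a : cs_copy (cs_encode xs z) a = xs a.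
Proof. by apply/ffunP => q; rewrite !ffunE enum_rankK. Qed.

Lemma cs_cells_encode xs z : cs_cells (cs_encode xs z) = z.
Proof. by apply/ffunP => c; rewrite !ffunE enum_rankK. Qed.

Lemma cheat_sheet_encode f xs z (l : {ffun 'I_k -> bool}) v :
  (forall a, f (xs a) = Some (l a)) ->
  (forall l' b, parity z l' b = (l' == l) && (b == v)) ->
  cheat_sheet f (cs_encode xs z) = Some v.
Proof.
move=> Hxs Hz.
have El : cs_index f (cs_encode xs z) = l.
  by apply/ffunP => a; rewrite ffunE cs_copy_encode Hxs; case: (l a).
have Ev : parity z l true = v by rewrite Hz eqxx; case: v {Hz}.
rewrite /cheat_sheet El cs_cells_encode Ev ifT //; apply/andP; split.
  by apply/forallP => a; rewrite cs_copy_encode Hxs.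
by apply/forallP => l'; apply/forallP => b; rewrite Hz.
Qed.

Lemma cheat_sheet_some f w v : cheat_sheet f w = Some v ->
  (forall a, f (cs_copy w a) = Some (cs_index f w a)) /\
  (forall l b, parity (cs_cells w) l b = (l == cs_index f w) && (b == v)).
Proof.
rewrite /cheat_sheet; case: ifP => // /andP[/forallP H1 /forallP H2] [Ev].
split=> [a|l b]; last by rewrite -Ev; apply/eqP; move/forallP: (H2 l); apply.
by rewrite ffunE; move: (H1 a); case: (f _) => // -[].
Qed.

Definition flip_cell (c : cells) (z : {ffun cells -> bool}) : {ffun cells -> bool} :=
  [ffun c' => z c' (+) (c' == c)].

Lemma flip_cellK c : involutive (flip_cell c).
Proof. by move=> z; apply/ffunP => c'; rewrite !ffunE -addbA addbb addbF. Qed.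

Lemma parity_flip l b j z l' b' :
  parity (flip_cell (l, b, j) z) l' b' = parity z l' b' (+) ((l' == l) && (b' == b)).
Proof.
rewrite /parity; under eq_bigr do rewrite ffunE.
rewrite big_split /=; congr (_ (+) _).
rewrite (bigD1 j) //= !xpair_eqE eqxx andbT big1 ?addbF // => j' /negbTE nj.
by rewrite !xpair_eqE nj andbF.
Qed.

(** Null arrays are outside the domain of [cheat_sheet] and independent of any index. For [S > 0]
    each of them is nevertheless one bit away from a valid array for every [l] and every value. *)
Definition null_cells (z : {ffun cells -> bool}) := [forall l, forall b, ~~ parity z l b].
Definition planted (l : {ffun 'I_k -> bool}) (v : bool) (z : {ffun cells -> bool}) :=
  [forall l', forall b, parity z l' b == (l' == l) && (b == v)].

(** Hence each flip is a bijection between null arrays and arrays planted at [(l, b)], which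
    [mass_bound] uses to reindex sums. *)
Lemma planted_flip l b j z : planted l b (flip_cell (l, b, j) z) = null_cells z.
Proof.
apply: eq_forallb => l'; apply: eq_forallb => b'; rewrite parity_flip.
by case: (parity _ _ _); case: (_ && _).
Qed.

Definition in_cell (l : {ffun 'I_k -> bool}) : pred (option 'I_N) := fun i =>
  if i is Some i then if enum_val i is inr (l', _, _) then l' == l else false else false.

Section CellMass.
Variables (f : pfun n) (A : qalg N).
Hypotheses (HA : qalg_valid A) (S_gt0 : (0 < S)%N).
Hypothesis A_cs : forall w v, cheat_sheet f w = Some v ->
  qalg_prob A w (Some (~~ v)) = 0 /\ qalg_prob A w None <= 1 / 2.
Let T := qa_T A.
Variables (xs : 'I_k -> {ffun 'I_n -> bool}) (l : {ffun 'I_k -> bool}).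
Hypothesis Hxs : forall a, f (xs a) = Some (l a).

Let at_bit b j := pred1 (Some (enum_rank (inr (l, b, j) : coords))).

Let sum_at_bit w t :
  \sum_b \sum_j query_mass A (at_bit b j) w t = query_mass A (in_cell l) w t.
Proof.
rewrite pair_big /= /query_mass.
under eq_bigr do rewrite big_mkcond.
rewrite exchange_big /= [RHS]big_mkcond; apply: eq_bigr => -[[i b0] z] _ /=.
case: i => [i|] /=; last by rewrite big1.
rewrite -(enum_valK i) enum_rankK.
case: (enum_val i) => [q|[[l' b] j]].
  rewrite big1 // => p _; rewrite ifF //; apply/negbTE/eqP => -[/enum_rank_inj].
  by [].
case: (l' =P l) => [->|ne]; last first.
  rewrite big1 // => p _; rewrite ifF //; apply/negbTE/eqP => -[/enum_rank_inj[]].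
  by [].
rewrite (bigD1 (b, j)) //= eqxx big1 ?addr0 // => -[b' j'] ne.
rewrite ifF //; apply/negbTE/eqP => -[/enum_rank_inj[eb ej]].
by move: ne; rewrite eb ej eqxx.
Qed.

(** Flipping position [j] in one or the other string of cell [l] gives inputs of values 0 and 1; the
    answer [Some false] has probability at least 1/2 on the first and 0 on the second. *)
Let flip_far z j : null_cells z ->
  2^-1 <= dist2 (qrun A (cs_encode xs (flip_cell (l, false, j) z)) T)
             (qrun A (cs_encode xs (flip_cell (l, true, j) z)) T).
Proof.
move=> Hz.
have val b : cheat_sheet f (cs_encode xs (flip_cell (l, b, j) z)) = Some b.
  apply: (cheat_sheet_encode Hxs) => l' b'; apply/eqP.
  by have := planted_flip l b j z; rewrite Hz => /forallP/(_ l')/forallP/(_ b').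
have [t0 _] := A_cs (val true); have [f0 fN] := A_cs (val false).
have := dist2_ge (qrun A (cs_encode xs (flip_cell (l, false, j) z)) T) t0.
apply: le_trans.
have := qrun_norm2 HA (cs_encode xs (flip_cell (l, false, j) z)) (leqnn T).
rewrite /norm2 (partition_big (@qa_out _ A) xpredT) //=.
have E o : \sum_(s | qa_out A s == o) sqmod (qrun A (cs_encode xs (flip_cell (l, false, j) z)) T s)
   = qalg_prob A (cs_encode xs (flip_cell (l, false, j) z)) o by [].
under eq_bigr do rewrite E.
rewrite (bigD1 None) //= (bigD1 (Some true)) //= (bigD1 (Some false)) //= big1; last first.
  by move=> [[]|].
move: f0 fN; rewrite /qalg_prob /= => ->.
set p0 := prob _ _; set p1 := prob _ _ => ? ?; lra.
Qed.

Let hybrid (th : RR) z j b : 0 < th ->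
  dist2 (qrun A (cs_encode xs z) T) (qrun A (cs_encode xs (flip_cell (l, b, j) z)) T)
  <= \sum_(t < T) (2 * th * query_mass A (at_bit b j) (cs_encode xs z) t
     + 2 * th^-1 * query_mass A (at_bit b j) (cs_encode xs (flip_cell (l, b, j) z)) t).
Proof.
move=> th0; apply: dist2_qrun => // i ic; rewrite !ffunE.
case E: (enum_val i) => [//|c]; rewrite ffunE.
rewrite (_ : c == _ = false) ?addbF //; apply: contraNF ic => /eqP Ec.
by rewrite -Ec -E enum_valK.
Qed.

Let M : RR := \sum_(z | null_cells z) \sum_(t < T) query_mass A (in_cell l) (cs_encode xs z) t.
Let Z : RR := #|[pred z | null_cells z]|%:R.

Let card_planted b (j : 'I_S) : \sum_(z | planted l b z) 1 = Z :> RR.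
Proof.
rewrite /Z (reindex_inj (inv_inj (@flip_cellK (l, b, j)))) /=.
by under eq_bigl do rewrite planted_flip; rewrite sumr_const.
Qed.

(* The mass at the flipped position on the planted input is only known to be at most 1,
   hence [cell_mass_ge] takes [th] of order [T / S]. *)
Let mass_bound (th : RR) : 0 < th -> Z * S%:R / 2 <= 4 * th * M + 8 * th^-1 * (T%:R * Z).
Proof.
move=> th0.
have j0 := Ordinal S_gt0.
pose D b z j := dist2 (qrun A (cs_encode xs z) T) (qrun A (cs_encode xs (flip_cell (l, b, j) z)) T).
have step1 : Z * S%:R / 2 <= \sum_(z | null_cells z) \sum_(j < S) \sum_b 2 * D b z j.
  have -> : Z * S%:R / 2 = \sum_(z | null_cells z) \sum_(j < S) (2^-1 : RR).
    by rewrite !sumr_const card_ord -mulr_natr -mulr_natr -/Z; ring.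
  apply: ler_sum => z Hz; apply: ler_sum => j _; rewrite big_bool /= addrC.
  exact: le_trans (flip_far j Hz) (dist2_triangle _ _ _).
apply: le_trans step1 _.
pose B1 := \sum_(z | null_cells z) \sum_(t < T) \sum_b \sum_(j < S)
   query_mass A (at_bit b j) (cs_encode xs z) t.
pose B2 := \sum_(t < T) \sum_b \sum_(j < S) \sum_(z | null_cells z)
   query_mass A (at_bit b j) (cs_encode xs (flip_cell (l, b, j) z)) t.
have EB1 : B1 = M.
  by apply: eq_bigr => z _; apply: eq_bigr => t _; exact: sum_at_bit.
(* For fixed [b], all flips carry the null arrays to the same set of planted arrays. After
   reindexing, the [S] positions are queried on one and the same input, so at each time their masses
   sum to at most 1 instead of [S]. *)
have EB2 : B2 <= 2 * (T%:R * Z).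
  apply: (@le_trans _ _ (\sum_(t < T) \sum_(b : bool) Z)).
    apply: ler_sum => t _; apply: ler_sum => b _.
    rewrite -(card_planted b j0).
    apply: (@le_trans _ _ (\sum_(z | planted l b z) \sum_(j < S) query_mass A (at_bit b j) (cs_encode xs z) t)).
      rewrite [leRHS]exchange_big /=; apply: ler_sum => j _.
      rewrite [leRHS](reindex_inj (inv_inj (@flip_cellK (l, b, j)))) /=.
      by under [leRHS]eq_bigl do rewrite planted_flip.
    apply: ler_sum => z _; apply: le_trans (query_mass_le1 HA (in_cell l) (cs_encode xs z) (ltnW (ltn_ord t))).
    rewrite -sum_at_bit (bigD1 b) //= lerDl.
    by apply: sumr_ge0 => *; apply: sumr_ge0 => *; exact: query_mass_ge0.
  by rewrite !sumr_const card_ord card_bool -[_ *+ T]mulr_natr mulr2n; lra.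
apply: (@le_trans _ _ (4 * th * B1 + 4 * th^-1 * B2)); last first.
  rewrite EB1 lerD2l.
  have : th^-1 * B2 <= th^-1 * (2 * (T%:R * Z)) by rewrite ler_pM2l ?invr_gt0.
  lra.
apply: (@le_trans _ _ (\sum_(z | null_cells z) \sum_(j < S) \sum_b
   (4 * th * (\sum_(t < T) query_mass A (at_bit b j) (cs_encode xs z) t)
  + 4 * th^-1 * (\sum_(t < T) query_mass A (at_bit b j) (cs_encode xs (flip_cell (l, b, j) z)) t)))).
  apply: ler_sum => z Hz; apply: ler_sum => j _; apply: ler_sum => b _.
  have := hybrid z j b th0; rewrite -/(D b z j) big_split /= -!mulr_sumr; lra.
rewrite le_eqVlt; apply/orP; left; apply/eqP.
under eq_bigr do under eq_bigr do rewrite big_split /= -!mulr_sumr.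
under eq_bigr do rewrite big_split /= -!mulr_sumr.
rewrite big_split /= -!mulr_sumr; congr (_ * _ + _ * _).
  apply: eq_bigr => z _; rewrite exchange_big /=.
  under eq_bigr do rewrite exchange_big /=.
  by rewrite exchange_big.
rewrite exchange_big /=; under eq_bigr do rewrite exchange_big /=.
under eq_bigr do under eq_bigr do rewrite exchange_big /=.
rewrite exchange_big /=; under eq_bigr do rewrite exchange_big /=.
by rewrite exchange_big.
Qed.

Lemma null_cells_gt0 : 0 < Z.
Proof.
rewrite ltr0n; apply/card_gt0P; exists [ffun=> false]; rewrite inE.
apply/forallP => l'; apply/forallP => b; rewrite /parity big1 // => j _.
by rewrite ffunE.
Qed.

Lemma cs_queries_gt0 : (0 < T)%N.
Proof.
rewrite lt0n; apply/eqP => T0; have := mass_bound ltr01.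
have -> : M = 0 by rewrite /M big1 // => z _; rewrite T0 big_ord0.
rewrite T0 mul0r !mulr0 addr0 leNgt divr_gt0 // mulr_gt0 ?null_cells_gt0 //.
by rewrite ltr0n.
Qed.

Lemma cell_mass_ge (D : nat) : (T <= S * D)%N ->
  Z * T%:R * (512 * D%:R ^+ 2)^-1 <= M.
Proof.
move=> TSD.
have T0 : 0 < T%:R :> RR by rewrite ltr0n cs_queries_gt0.
have S0 : 0 < S%:R :> RR by rewrite ltr0n.
have Z0 := null_cells_gt0.
have D0 : 0 < D%:R :> RR.
  by rewrite ltr0n; case: (D) TSD cs_queries_gt0 => // ; rewrite muln0 leqn0 => /eqP ->.
have TSD' : T%:R <= S%:R * D%:R :> RR by rewrite -natrM ler_nat.
(* This [th] makes the last term of [mass_bound] equal to [Z S / 4], half of the left side. The rest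
   reads [Z S^2 <= 512 T M], to be combined with [S >= T / D]. *)
have th0 : 0 < 32 * T%:R / S%:R :> RR by rewrite divr_gt0 // mulr_gt0.
have := mass_bound th0; rewrite invf_div.
have -> : 8 * (S%:R / (32 * T%:R)) * (T%:R * Z) = Z * S%:R / 4.
  by field; rewrite gt_eqF.
move=> H.
have H1 : Z * S%:R ^+ 2 <= 512 * T%:R * M.
  have : 4 * (32 * T%:R / S%:R) * M >= Z * S%:R / 4 by lra.
  have -> : 4 * (32 * T%:R / S%:R) * M = 128 * T%:R * M / S%:R by field; rewrite gt_eqF.
  by rewrite ler_pdivlMr //; lra.
rewrite ler_pdivrMr ?mulr_gt0 ?exprn_gt0 // -(ler_pM2l T0).
apply: (@le_trans _ _ (Z * (S%:R * D%:R) ^+ 2)).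
  have : T%:R ^+ 2 <= (S%:R * D%:R) ^+ 2 :> RR.
    by rewrite ler_sqr ?nnegrE ?mulr_ge0 // ltW.
  by rewrite -(ler_pM2l Z0); lra.
have : Z * S%:R ^+ 2 * D%:R ^+ 2 <= 512 * T%:R * M * D%:R ^+ 2.
  by rewrite ler_pM2r ?exprn_gt0.
by lra.
Qed.

End CellMass.
End CheatSheet.

(** * From cell mass to an algorithm for [f] *)

(** Exchanging coordinate [h] with the fresh sample preserves the product weight. *)
Lemma sum_resample (K I : finType) (mu : I -> RR) (H : {ffun K -> I} -> RR) (h : K) :
  \sum_i mu i = 1 ->
  \sum_(pi : {ffun K -> I}) (\prod_a mu (pi a)) * H pi =
  \sum_(pi : {ffun K -> I}) (\prod_a mu (pi a)) * \sum_i mu i * H (upd pi h i).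
Proof.
move=> mu1.
pose sw (q : {ffun K -> I} * I) := (upd q.1 h q.2, q.1 h).
have swK : involutive sw.
  move=> [pi i]; rewrite /sw /= ffunE eqxx; congr (_, _).
  by apply/ffunP => a; rewrite !ffunE; case: eqP => // ->.
transitivity (\sum_(q : {ffun K -> I} * I) (\prod_a mu (q.1 a)) * mu q.2 * H q.1).
  rewrite -(pair_big xpredT xpredT (fun (pi : {ffun K -> I}) i => (\prod_a mu (pi a)) * mu i * H pi)) /=.
  apply: eq_bigr => pi _; under [RHS]eq_bigr do rewrite mulrAC.
  by rewrite -mulr_sumr mu1 mulr1.
rewrite -(sum_involutive _ swK).
under [RHS]eq_bigr do rewrite mulr_sumr.
rewrite pair_big /=; apply: eq_bigr => -[pi i] _ /=; rewrite mulrA; congr (_ * _).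
rewrite (bigD1 h) //= [in RHS](bigD1 h) //= ffunE eqxx.
rewrite (eq_bigr (fun a => mu (pi a))) => [|a /negbTE na]; last by rewrite ffunE na.
by ring.
Qed.

Section LowerBound.
Variables (n k S : nat) (f : pfun n) (A : qalg #|{: 'I_k * 'I_n + {ffun 'I_k -> bool} * bool * 'I_S}|).
Let X := {ffun 'I_n -> bool}.
Let L := {ffun 'I_k -> bool}.
Let cells := (L * bool * 'I_S)%type.
Let T := qa_T A.
Hypotheses (HA : qalg_valid A) (S_gt0 : (0 < S)%N).
Hypothesis A_cs : forall w v, cheat_sheet f w = Some v ->
  qalg_prob A w (Some (~~ v)) = 0 /\ qalg_prob A w None <= 1 / 2.

Let I := {p : X * X | (f p.1 == Some false) && (f p.2 == Some true)}.
Let R := ('I_k * L * {ffun 'I_k -> X} * {ffun cells -> bool} * 'I_T)%type.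

Let mass (r : R) (x : X) : RR :=
  let: (a, l, xs, z, t) := r in
  query_mass A (in_cell l) (cs_encode (upd xs a x) z) t.

Let W (mu : I -> RR) (pi : {ffun 'I_k -> I}) : RR := \prod_a mu (pi a).

(** Hybrids between a tuple of 0-inputs ([h = 0], the same for every [l]) and a tuple of index [l]
    ([h = k]). *)
Let sel (l : L) (h : nat) (pi : {ffun 'I_k -> I}) : {ffun 'I_k -> X} :=
  [ffun a => if l a && (a < h)%N then (val (pi a)).2 else (val (pi a)).1].

Let F (l : L) (xs : {ffun 'I_k -> X}) : RR :=
  \sum_(z : {ffun cells -> bool} | null_cells z) \sum_(t < T)
    query_mass A (in_cell l) (cs_encode xs z) t.

Let Z : RR := #|[pred z : {ffun cells -> bool} | null_cells z]|%:R.

Let sum_in_cell w t : (t <= T)%N -> \sum_l query_mass A (in_cell l) w t <= 1.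
Proof.
move=> tT; rewrite -(qrun_norm2 HA w tT) /query_mass /norm2.
under eq_bigr do rewrite big_mkcond.
rewrite exchange_big /=; apply: ler_sum => -[[i b] z] _ /=.
have s0 := sqmod_ge0 (qrun A w t (i, b, z)).
case: i s0 => [i|] s0 /=; last by rewrite big1.
case: (enum_val i) => [q|[[l' b'] j]]; first by rewrite big1.
by rewrite (bigD1 l') //= eqxx big1 ?addr0 // => l /negbTE; rewrite eq_sym => ->.
Qed.

(* Moving one coordinate of [x_1, .., x_k] at a time from 0-inputs to 1-inputs,
   each cell [l] would receive almost the same mass on inputs with index [l] as
   on inputs with index [0]; but these masses add up to at most one. *)
Let no_hard_pairs (mu : I -> RR) (D : nat) (eta : RR) :
  (forall i, 0 <= mu i) -> \sum_i mu i = 1 -> (T <= S * D)%N -> 0 <= eta ->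
  (2 ^ k)%:R^-1 + k%:R * eta < (512 * D%:R ^+ 2)^-1 ->
  (forall r, \sum_i mu i * (mass r (val i).2 - mass r (val i).1) <= eta) -> False.
Proof.
move=> mu0 mu1 TSD eta0 Heta Hmass.
have i0 : I.
  case: (pickP (fun _ : I => true)) => [i _ //|I0].
  by move: mu1; rewrite big_pred0 // => /eqP; rewrite eq_sym oner_eq0.
have sel_f l pi a : f (sel l k pi a) = Some (l a).
  rewrite ffunE ltn_ord andbT.
  by case: (pi a) => -[x0 x1] /= /andP[/eqP ? /eqP ?]; case: (l a).
have Z0 : 0 < Z by exact: null_cells_gt0.
have T0 : 0 < T%:R :> RR.
  rewrite ltr0n; pose l : L := [ffun=> false].
  exact: (cs_queries_gt0 HA S_gt0 A_cs (sel_f l [ffun=> i0])).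
have W0 pi : 0 <= W mu pi by apply: prodr_ge0.
have W1 : \sum_pi W mu pi = 1.
  rewrite /W -(bigA_distr_bigA (fun (_ : 'I_k) i => mu i)) /=.
  by rewrite big1.
have avg (c : RR) : c = \sum_pi W mu pi * c by rewrite -mulr_suml W1 mul1r.
pose G l h := \sum_pi W mu pi * F l (sel l h pi).
have Gtop l : Z * T%:R * (512 * D%:R ^+ 2)^-1 <= G l k.
  rewrite [leLHS]avg; apply: ler_sum => pi _.
  by apply: ler_wpM2l => //; exact: (cell_mass_ge HA S_gt0 A_cs (sel_f l pi) TSD).
have Gbot : \sum_l G l 0%N <= Z * T%:R.
  rewrite exchange_big /= [leRHS]avg; apply: ler_sum => pi _.
  rewrite -mulr_sumr; apply: ler_wpM2l => //.
  (* At [h = 0] all cells are measured on the same run, so they share a total mass of at most 1 at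
     each time. *)
  have E l : sel l 0%N pi = sel [ffun=> false] 0%N pi.
    by apply/ffunP => a; rewrite !ffunE ltn0 !andbF.
  under eq_bigr do rewrite E /F.
  rewrite exchange_big /=; apply: (@le_trans _ _ (\sum_(z : {ffun cells -> bool} | null_cells z) T%:R)).
    apply: ler_sum => z _; rewrite exchange_big /=.
    apply: (@le_trans _ _ (\sum_(t < T) 1)); last by rewrite sumr_const card_ord.
    by apply: ler_sum => t _; apply: sum_in_cell; apply: ltnW.
  by rewrite sumr_const /Z mulr_natl.
have Gstep l h : (h < k)%N -> G l h.+1 <= G l h + Z * T%:R * eta.
  move=> hk; pose h' := Ordinal hk.
  rewrite -lerBlDl /G -sumrB; under eq_bigr do rewrite -mulrBr.
  have ZTeta : \sum_(z : {ffun cells -> bool} | null_cells z) \sum_(t < T) eta = Z * T%:R * eta.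
    by rewrite !sumr_const card_ord -mulr_natr -[_ *+ T]mulr_natr /Z; ring.
  rewrite (sum_resample (fun pi => F l (sel l h.+1 pi) - F l (sel l h pi)) h' mu1).
  rewrite [leRHS]avg; apply: ler_sum => pi _.
  apply: ler_wpM2l; first exact: W0.
  have E0 i : sel l h (upd pi h' i) = upd (sel l h pi) h' (val i).1.
    apply/ffunP => a; rewrite !ffunE; case: eqP => [->|//].
    by rewrite /= ltnn andbF.
  have E1 i : sel l h.+1 (upd pi h' i) = upd (sel l h pi) h' (if l h' then (val i).2 else (val i).1).
    apply/ffunP => a; rewrite !ffunE; case: eqP => [->|ne].
      by rewrite /= ltnSn andbT.
    rewrite ltnS leq_eqVlt; case: eqP => [e|//] /=.
    by case: ne; apply: val_inj.
  under eq_bigr do rewrite /= E0 E1.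
  case: (boolP (l h')) => lh; last first.
    rewrite big1 => [|i _]; last by rewrite subrr mulr0.
    rewrite -ZTeta; apply: sumr_ge0 => z _; apply: sumr_ge0 => t _.
    exact: eta0.
  rewrite -ZTeta /F; under eq_bigr do rewrite -sumrB mulr_sumr.
  rewrite exchange_big /=; apply: ler_sum => z _.
  under eq_bigr do rewrite -sumrB mulr_sumr.
  rewrite exchange_big /=; apply: ler_sum => t _.
  exact: (Hmass (h', l, sel l h pi, z, t)).
have Gle l h : (h <= k)%N -> G l h <= G l 0%N + h%:R * (Z * T%:R * eta).
  elim: h => [|h IH] hk; first by rewrite mul0r addr0.
  have := Gstep l h hk; have := IH (ltnW hk); rewrite -natr1; lra.
have : \sum_(l : L) Z * T%:R * (512 * D%:R ^+ 2)^-1 <=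
       \sum_l (G l 0%N + k%:R * (Z * T%:R * eta)).
  by apply: ler_sum => l _; apply: le_trans (Gtop l) (Gle l k (leqnn k)).
rewrite big_split /= !sumr_const card_ffun card_bool card_ord.
rewrite -[_ *+ (2 ^ k)]mulr_natr -[X in _ + X]mulr_natr.
have P0 : 0 < (2 ^ k)%:R :> RR by rewrite ltr0n expn_gt0.
have ZTP : 0 < Z * T%:R * (2 ^ k)%:R by rewrite !mulr_gt0.
move: Heta; rewrite -(ltr_pM2l ZTP) => H1 H2.
have : Z * T%:R * (2 ^ k)%:R * ((2 ^ k)%:R^-1 + k%:R * eta)
   = Z * T%:R + k%:R * (Z * T%:R * eta) * (2 ^ k)%:R.
  by field; rewrite gt_eqF.
by move: H1 H2 Gbot; lra.
Qed.

(** Minimax turns the absence of a hard distribution on pairs into a single mixture [w] that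
    separates all pairs at once. *)
Let mixture (D : nat) (eta : RR) x0 x1 :
  f x0 = Some false -> f x1 = Some true -> (T <= S * D)%N -> 0 < eta <= 1 ->
  (2 ^ k)%:R^-1 + k%:R * eta < (512 * D%:R ^+ 2)^-1 ->
  exists w : R -> RR, [/\ forall r, 0 <= w r, \sum_r w r = 1 &
    forall y0 y1, f y0 = Some false -> f y1 = Some true ->
      \sum_r w r * mass r y0 + eta / 2 <= \sum_r w r * mass r y1].
Proof.
move=> f0 f1 TSD Heta Heps.
have fp y0 y1 : f y0 = Some false -> f y1 = Some true ->
    (f (y0, y1).1 == Some false) && (f (y0, y1).2 == Some true).
  by move=> /= -> ->.
have M1 (r : R) (i : I) : `|mass r (val i).2 - mass r (val i).1| <= 1.
  move: r => [[[[a l] xs] z] t] /=.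
  have b x : 0 <= query_mass A (in_cell l) (cs_encode (upd xs a x) z) t <= 1.
    by rewrite query_mass_ge0 query_mass_le1 // ltnW.
  have := b (val i).2; have := b (val i).1; rewrite ler_norml; lra.
have [[w [w0 w1 Hw]]|[mu [mu0 mu1 Hmu]]] :=
    approx_minimax (exist _ (x0, x1) (fp _ _ f0 f1) : I) Heta M1; last first.
  by case/andP: Heta => /ltW e0 _; case: (no_hard_pairs mu0 mu1 TSD e0 Heps Hmu).
exists w; split=> // y0 y1 g0 g1; have /= := Hw (exist _ (y0, y1) (fp _ _ g0 g1)).
by under eq_bigr do rewrite mulrBr; rewrite sumrB; lra.
Qed.

Let sigma (q : unit * R) (i : 'I_#|{: 'I_k * 'I_n + cells}|) : bool + 'I_n :=
  let: (_, (a, _, xs, z, _)) := q in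
  match enum_val i with
  | inl (a', j) => if a' == a then inr j else inl (xs a' j)
  | inr c => inl (z c)
  end.

(* A random [r] is drawn, the input is planted as the [a]-th copy and a measurement
   at time [t] tells whether the algorithm is querying cell [l]. *)
Let impl_mixture (w : R -> RR) : (forall r, 0 <= w r) -> \sum_r w r = 1 ->
  exists2 D : unit -> X -> bool -> RR, qimpl T D &
    forall x, D tt x true = \sum_r w r * mass r x.
Proof.
move=> w0 w1.
have H1 : qimpl 0 (fun (_ : unit) (_ : X) r => w r) by exact: qimpl_random.
have H2 := @qimpl_subst n _ A T (unit * R)%type bool sigma
  (fun q => q.2.2) (fun q s => in_cell q.2.1.1.1.2 s.1.1) HA
  (fun q => ltnW (ltn_ord q.2.2)) (leqnn T).
exists (fun p x o => \sum_r w r * \sum_(s | in_cell r.1.1.1.2 s.1.1 == o)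
   sqmod (qrun A (subst_input (sigma (p, r)) x) r.2 s)).
  by have := qimpl_bind H1 H2; rewrite add0n.
move=> x; apply: eq_bigr => -[[[[a l] xs] z] t] _; congr (_ * _) => /=.
rewrite /query_mass (_ : subst_input _ _ = cs_encode (upd xs a x) z).
  by apply: eq_bigl => s; rewrite eqb_id.
apply/ffunP => i; rewrite !ffunE /sigma; case: (enum_val i) => [[a' j]|c] //.
by rewrite ffunE; case: eqP.
Qed.

(* [2^-k + k eta <= 1 / (1024 D^2)] for [eta = 1 / (2048 k D^2)]; amplifying the
   gap [eta / 2] takes [3 / (eta / 2)^2] repetitions. *)
Lemma cheat_sheet_lower_aux D x0 x1 :
  f x0 = Some false -> f x1 = Some true -> (0 < k)%N -> (0 < D)%N ->
  (T <= S * D)%N -> (2048 * D ^ 2 <= 2 ^ k)%N ->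
  exists2 P : unit -> X -> bool -> RR, qimpl (3 * (4096 * (k * D ^ 2)) ^ 2 * T) P &
    forall x v, f x = Some v -> 2 / 3 <= P tt x v.
Proof.
move=> f0 f1 k0 D0 TSD Hk.
have k1 : 1 <= k%:R :> RR by rewrite ler1n.
have D1 : 1 <= D%:R ^+ 2 :> RR by rewrite exprn_ege1 // ler1n.
have kD : 1 <= k%:R * D%:R ^+ 2 :> RR by nra.
have kN : k%:R != 0 :> RR by rewrite pnatr_eq0 -lt0n.
have DN : D%:R != 0 :> RR by rewrite pnatr_eq0 -lt0n.
pose eta : RR := (2048 * (k%:R * D%:R ^+ 2))^-1.
have eta_gt0 : 0 < eta by rewrite invr_gt0; lra.
have eta_le1 : eta <= 1 by rewrite invf_le1; lra.
have Heps : (2 ^ k)%:R^-1 + k%:R * eta < (512 * D%:R ^+ 2)^-1.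
  have -> : k%:R * eta = (2048 * D%:R ^+ 2)^-1.
    by rewrite /eta; field; rewrite kN DN.
  have : (2 ^ k)%:R^-1 <= (2048 * D%:R ^+ 2)^-1 :> RR.
    rewrite lef_pV2 ?posrE ?ltr0n ?expn_gt0 //; last by lra.
    by rewrite -natrX -natrM ler_nat.
  have -> : (512 * D%:R ^+ 2)^-1 = 4 * (2048 * D%:R ^+ 2)^-1 :> RR.
    by field; rewrite DN.
  have : 0 < (2048 * D%:R ^+ 2)^-1 :> RR by rewrite invr_gt0; lra.
  by lra.
have [|w [w0 w1 Hw]] := mixture f0 f1 TSD _ Heps; first by rewrite eta_gt0.
have [P HP EP] := impl_mixture w0 w1.
(* The threshold sits halfway above the largest acceptance probability of a 0-input. *)
pose p (x : X) : RR := P tt x true.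
have Hgap y0 y1 : f y0 = Some false -> f y1 = Some true -> p y0 + eta / 2 <= p y1.
  by move=> g0 g1; rewrite /p !EP; exact: Hw.
have [y0 [g0 Hy0]] : exists y0, f y0 = Some false /\ forall y, f y = Some false -> p y <= p y0.
  have P0 : [pred y | f y == Some false] x0 by rewrite /= f0.
  case: (@Order.TotalTheory.arg_maxP _ _ _ x0 [pred y | f y == Some false] p P0) => y0 /eqP g0 Hmax.
  by exists y0; split=> // y gy; apply: Hmax; rewrite /= gy.
have [|||u y|u y|P' HP' Hv] := @impl_amplify _ (qmodel n) unit (fun=> f) _ _
   (3 * (4096 * (k * D ^ 2)) ^ 2) (p y0 + eta / 4) (eta / 4) (1 / 3) HP.
- by rewrite !(muln_gt0, expn_gt0) k0 D0.
- by lra.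
- rewrite !(natrM, natrX) -[leRHS]invrK lef_pV2 ?posrE.
  + rewrite /eta le_eqVlt; apply/orP; left; apply/eqP; field.
    by rewrite kN DN.
  + have k2 : 0 < 4096 * (k%:R * D%:R ^+ 2) :> RR by lra.
    have e4 : 0 < eta / 4 by lra.
    apply: mulr_gt0; last exact: exprn_gt0.
    by apply: mulr_gt0 => //; apply: mulr_gt0 => //; exact: exprn_gt0.
  + lra.
- case: u => gy; have := Hy0 y gy; rewrite /p; lra.
- case: u => gy; have := Hgap _ _ g0 gy; rewrite /p; lra.
by exists P' => // x v fx; have := Hv tt x v fx; lra.
Qed.

End LowerBound.

Lemma bounded_query_of_impl (n k : nat) (f : pfun n)
    (D : unit -> {ffun 'I_n -> bool} -> option bool -> RR) : qimpl k D ->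
  (forall x v, f x = Some v -> 2 / 3 <= D tt x (Some v)) -> bounded_query_alg f k.*2.
Proof.
move=> /qalg_of_qimpl[A [TA VA EA]] HD; exists A; split=> // x v fx.
by rewrite EA HD.
Qed.

Lemma cheat_sheet_lower (n k S D T : nat) (f : pfun n) x0 x1 :
  zero_error_query_alg (@cheat_sheet n k S f) T ->
  f x0 = Some false -> f x1 = Some true -> (0 < S)%N -> (0 < k)%N -> (0 < D)%N ->
  (T <= S * D)%N -> (2048 * D ^ 2 <= 2 ^ k)%N ->
  bounded_query_alg f (3 * (4096 * (k * D ^ 2)) ^ 2 * T).*2.
Proof.
move=> [A [<- VA HA]] f0 f1 S0 k0 D0 TSD Hk.
have [P HP EP] := cheat_sheet_lower_aux VA S0 HA f0 f1 k0 D0 TSD Hk.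
have HP' := impl_map (M := qmodel n) (fun q : unit * bool => Some q.2) HP.
apply: (bounded_query_of_impl HP') => x v fx.
by rewrite (big_pred1 v) //; exact: EP.
Qed.

Lemma bounded_query_const (n : nat) (f : pfun n) (b : bool) :
  (forall x v, f x = Some v -> v = b) -> bounded_query_alg f 0.
Proof.
move=> Hf; have := impl_pure (qmodel n) (fun _ : unit => Some b).
move=> H0; apply: (bounded_query_of_impl (k := 0) H0) => x v /Hf ->.
by rewrite eqxx mulr1n; lra.
Qed.

(** Twelve runs for the amplification, times two oracle calls per query of a circuit. *)
Lemma bounded_query_of_zero_error (n T : nat) (f : pfun n) :
  zero_error_query_alg f T -> bounded_query_alg f (24 * T).
Proof.
move=> [A [<- VA HA]].
have H1 := qimpl_qalg (fun _ : unit => @inr bool 'I_n) VA.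
have [|D HD EF] := impl_bounded_of_zero_error (M := qmodel n) (F := f) H1.
  by move=> x v fx; rewrite subst_input_id; exact: HA.
by have := bounded_query_of_impl HD EF; rewrite -mul2n mulnA.
Qed.

(** Reading the whole input always works; hence [Q0query] is attained and never a default value. *)
Lemma zero_error_query_exists (n : nat) (f : pfun n) : exists T, zero_error_query_alg f T.
Proof.
pose S := {ffun 'I_n -> bool}.
have H1 := impl_pull (m := qmodel n) (fun q : unit * ('I_n * S) => q.2.1) (qimpl_read n).
have [D2 H2 [E2 _]] := impl_map_ex (M := qmodel n)
  (fun q : unit * ('I_n * S) * bool => upd q.1.2.2 q.1.2.1 q.2) H1.
have [D3 H3 E3] := impl_loop (enum 'I_n) H2.
have H4 := impl_pull (fun p : unit => (p, [ffun=> false] : S)) H3.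
have [D5 H5 [E5 _]] := impl_map_ex (fun q : unit * S => f q.2) H4.
have [A [TA VA EA]] := qalg_of_qimpl H5.
exists (qa_T A), A; split=> // x v fx.
have full : 1 <= D5 tt x (Some v).
  rewrite -fx; apply: le_trans (E5 tt x x).
  have [/(_ 0) E _] := E3 tt x (fun j s => upd s j (x j)).
  have foldx : foldl (fun s j => upd s j (x j)) ([ffun=> false] : S) (enum 'I_n) = x.
    by apply/ffunP => i; rewrite foldl_upd mem_enum.
  have := E _ [ffun=> false]; rewrite foldx mulr0 subr0; apply=> j s.
  by apply: le_trans (E2 (tt, (j, s)) x (x j)); rewrite eqxx.
by rewrite !EA; split; rewrite (impl_indicator H5 full) //; case: v {fx full} => //; lra.
Qed.

(** * The zero-error protocol for cheat sheets *)

Lemma impl_retry (W : Type) (M : model W) (P : finType) k (D : P -> W -> option bool -> RR)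
    (v : P -> W -> bool) m :
  impl M k D ->
  (forall p w, D p w (Some (~~ v p w)) = 0 /\ D p w None <= 1 / 2) ->
  exists2 D' : P -> W -> option bool -> RR, impl M (m * k) D' &
    forall p w, D' p w (Some (~~ v p w)) = 0 /\ D' p w None <= (2 ^+ m)^-1.
Proof.
move=> HD Hv; elim: m => [|m [Dm HDm Hm]].
  exists (fun _ _ o => (o == None)%:R); first exact: (impl_pure M (fun _ : P => None : option bool)).
  by move=> p w; split=> //; rewrite eqxx expr0 invr1.
have H1 := impl_pull (fun q : P * option bool => q.1) HDm.
have H2 := impl_map (fun q : P * option bool * option bool => if q.1.2 is Some b then Some b else q.2) H1.
have H3 := impl_bind HD H2.
rewrite mulSn; set D' := (X in impl M _ X) in H3; exists D' => // p w.
have [v0 vN] := Hv p w; have [m0 mN] := Hm p w.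
have DN0 : 0 <= D p w None := impl_ge0 HD _ _ _.
have mN0 : 0 <= Dm p w None := impl_ge0 HDm _ _ _.
have E o : D' p w o = D p w None * Dm p w o
    + \sum_b D p w (Some b) * \sum_(o2 | Some b == o) Dm p w o2.
  rewrite /D' sum_option_bool big_bool; congr (_ * _ + _).
  by rewrite (big_pred1 o) // => o2 /=.
split; rewrite E.
  rewrite m0 mulr0 add0r big1 // => b _.
  have [->|nb] := eqVneq b (~~ v p w); first by rewrite v0 mul0r.
  by rewrite big_pred0 ?mulr0 // => o2; apply/negbTE; apply: contra nb => /eqP[->].
rewrite big1 ?addr0 => [|b _]; last by rewrite big_pred0 ?mulr0.
rewrite exprS invfM; apply: ler_pM => //.
by move: vN; rewrite mul1r.
Qed.

Section CheatSheetProtocol.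
Variables (X Y : Type) (G : X -> Y -> bool) (n k S : nat) (f : pfun n).
Let L := {ffun 'I_k -> bool}.
Let cells := (L * bool * 'I_S)%type.
Let coords := ('I_k * 'I_n + cells)%type.
Let N := #|{: coords}|.
Let IA := 'I_N -> X.
Let IB := 'I_N -> Y.
Let M := cmodel IA IB.
Let gad (w : IA * IB) : {ffun 'I_N -> bool} := [ffun i => G (w.1 i) (w.2 i)].

Let impl_guess C : (0 < k)%N -> bounded_prot (lift_fun G f) C ->
  exists2 D : unit -> IA * IB -> L -> RR, impl M (k * (36 * k * (3 * C + 3))) D &
    forall w (l : L), (forall a, f (cs_copy (gad w) a) = Some (l a)) -> 3 / 4 <= D tt w l.
Proof.
move=> k0 [prot [EC V HP]].
have k1 : 0 < k%:R :> RR by rewrite ltr0n.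
have H0 : impl M _ _ := cimpl_qprot V
   (fun (a : 'I_k) (x : IA) q => x (enum_rank (inl (a, q) : coords)))
   (fun (a : 'I_k) (y : IB) q => y (enum_rank (inl (a, q) : coords))).
rewrite EC in H0; set D0 := (X in impl M _ X) in H0.
have E0 a w v : f (cs_copy (gad w) a) = Some v -> 2 / 3 <= D0 a w (Some v).
  move=> fv; apply: HP; rewrite /lift_fun -fv; congr f.
  by apply/ffunP => q; rewrite !ffunE.
have [D1 H1 [E1 _]] := impl_map_ex (fun q : 'I_k * option bool => q.2 == Some true) H0.
(* Success 2/3 lies 1/6 above the threshold 1/2, so [36 k] runs err with probability at most
   [1 / (4 k)]; over [k] copies this leaves 3/4. *)
have [|||a w fa|a w fa|D2 H2 E2] := @impl_amplify _ M _ (fun a w => f (cs_copy (gad w) a))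
  _ _ (36 * k) (1 / 2) (1 / 6) (4 * k%:R)^-1 H1.
- by rewrite muln_gt0.
- by lra.
- by rewrite [X in X^-1 <= _](_ : _ = 4 * k%:R) // natrM; field.
- have e1 : D0 a w (Some false) <= D1 a w false := E1 a w (Some false).
  have e0 := E0 a w _ fa; have := impl_sum1 H1 a w.
  by rewrite big_bool /=; lra.
- have e1 : D0 a w (Some true) <= D1 a w true := E1 a w (Some true).
  by have := E0 a w _ fa; lra.
have H3 := impl_pull (fun q : unit * ('I_k * L) => q.2.1) H2.
have [D4 H4 [E4 _]] := impl_map_ex
  (fun q : unit * ('I_k * L) * bool => upd q.1.2.2 q.1.2.1 q.2) H3.
have [D5 H5 E5] := impl_loop (enum 'I_k) H4.
rewrite size_enum_ord in H5.
exists (fun p => D5 (p, [ffun=> false] : L)).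
  exact: (impl_pull (fun p : unit => (p, [ffun=> false] : L)) H5).
move=> w l Hl.
have [/(_ (4 * k%:R)^-1) E _] := E5 tt w (fun a s => upd s a (l a)).
have foldl_l : foldl (fun s a => upd s a (l a)) ([ffun=> false] : L) (enum 'I_k) = l.
  by apply/ffunP => a; rewrite foldl_upd mem_enum.
have := E _ [ffun=> false]; rewrite foldl_l size_enum_ord.
have -> : 1 - k%:R * (4 * k%:R)^-1 = 3 / 4 :> RR by field; rewrite gt_eqF.
apply=> a s; apply: le_trans (E4 (tt, (a, s)) w (l a)).
exact: E2.
Qed.

Let parities (z : {ffun cells -> bool}) (l : L) : {ffun bool -> bool} := [ffun b => parity z l b].

Let answer (s : option {ffun bool -> bool}) : option bool :=
  if s is Some g then if g true then Some true else if g false then Some false else None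
  else None.

Let impl_parities q m : (8 * S <= 2 ^ m)%N -> zero_error_prot (fun x y => Some (G x y)) q ->
  exists2 D : L -> IA * IB -> option bool -> RR, impl M (2 * S * (m * (3 * q + 3))) D &
    forall l w, 3 / 4 <= D l w (answer (Some (parities (cs_cells (gad w)) l))) /\
      forall o, D l w o != 0 -> o = None \/ o = answer (Some (parities (cs_cells (gad w)) l)).
Proof.
move=> Sm [prot [Eq V HP]].
have H0 : impl M _ _ := cimpl_qprot V
   (fun (c : cells) (x : IA) => x (enum_rank (inr c : coords)))
   (fun (c : cells) (y : IB) => y (enum_rank (inr c : coords))).
rewrite Eq in H0.
have [|D1 H1 E1] := impl_retry (v := fun c w => cs_cells (gad w) c) m H0.
  by move=> c w; rewrite !ffunE; apply: HP.
have R1 c w : 1 - (2 ^+ m)^-1 <= D1 c w (Some (cs_cells (gad w) c)).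
  have [E0 EN] := E1 c w; have := impl_sum1 H1 c w; rewrite sum_option_bool.
  by move: E0; case: (cs_cells _ c) => /= E0 Hs; lra.
have S1 c w o : D1 c w o != 0 -> o = None \/ o = Some (cs_cells (gad w) c).
  have [E0 _] := E1 c w; case: o => [b|]; last by left.
  have [->|] := eqVneq b (cs_cells (gad w) c); first by right.
  by move=> nb; rewrite (_ : b = ~~ cs_cells (gad w) c) ?E0 ?eqxx //;
    case: b nb; case: (cs_cells _ c).
pose St := option {ffun bool -> bool}.
(* The state holds the two parities computed so far; [None] records that some bit could not be read,
   and is absorbing. *)
pose st (u : bool) (b : bool) (s : St) : St :=
  if s is Some g then Some (upd g b (g b (+) u)) else None.
have H2 := impl_pull (fun q : L * ((bool * 'I_S) * St) => (q.1, q.2.1.1, q.2.1.2)) H1.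
have [D3 H3 [E3 S3]] := impl_map_ex
  (fun q : L * ((bool * 'I_S) * St) * option bool =>
     if q.2 is Some u then st u q.1.2.1.1 q.1.2.2 else None) H2.
have [D4 H4 E4] := impl_loop (enum {: bool * 'I_S}) H3.
have size_js : size (enum {: bool * 'I_S}) = (2 * S)%N.
  by rewrite -cardE card_prod card_bool card_ord.
have H5 := impl_pull (fun l : L => (l, Some [ffun=> false] : St)) H4.
have [D6 H6 [E6 S6]] := impl_map_ex (fun q : L * St => answer q.2) H5.
rewrite size_js in H6; exists D6 => // l w.
pose z := cs_cells (gad w).
pose step (p : bool * 'I_S) (s : St) : St := st (z (l, p.1, p.2)) p.1 s.
have fold_st js g : foldl (fun s p => step p s) (Some g) js =
    Some [ffun b => g b (+) \big[addb/false]_(p <- js | p.1 == b) z (l, p.1, p.2)].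
  elim: js g => [|p js IH] g /=.
    by congr Some; apply/ffunP => b; rewrite ffunE big_nil addbF.
  rewrite IH; congr Some; apply/ffunP => b; rewrite !ffunE big_cons eq_sym.
  by case: eqP => [->|_ //]; rewrite -addbA /z !ffunE.
have fold_parities : foldl (fun s p => step p s) (Some [ffun=> false]) (enum {: bool * 'I_S})
    = Some (parities z l).
  rewrite fold_st; congr Some; apply/ffunP => b; rewrite !ffunE addFb big_enum_cond /=.
  rewrite (eq_bigl (fun p : bool * 'I_S => (p.1 == b) && true)); last by move=> p; rewrite andbT.
  rewrite -(pair_big (fun b' => b' == b) xpredT (fun b' j => z (l, b', j))) /=.
  by rewrite big_pred1_eq.
have [/(_ (2 ^+ m)^-1) E4' /(_ (fun s => s == None)) S4] := E4 l w step.
split=> [|o /S6[s [<- Hs]]].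
  apply: le_trans (E6 l w (Some (parities z l))).
  rewrite -fold_parities.
  apply: (@le_trans _ _ (1 - (size (enum {: bool * 'I_S}))%:R * (2 ^+ m)^-1)); last first.
    apply: E4' => -[b j] s; apply: le_trans (R1 (l, b, j) w) _.
    exact: (E3 (l, ((b, j), s)) w (Some (z (l, b, j)))).
  rewrite size_js.
  (* Union bound over [2 S] bits, each unreadable with probability at most [2^-m <= 1 / (8 S)]. *)
  have : (8 * S)%:R <= 2 ^+ m :> RR by rewrite -natrX ler_nat.
  have P0 : 0 < 2 ^+ m :> RR by rewrite exprn_gt0.
  rewrite !natrM => H; have : (2 * S%:R) / 2 ^+ m <= 1 / 4 :> RR.
    by rewrite ler_pdivrMr //; lra.
  lra.
have [||->|/eqP->] := S4 _ _ _ _ Hs.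
- move=> [b j] s1 s2 /S3[o1 [/= <-]]; case/S1 => ->; first by right.
  by left.
- by move=> [b j] s1 s2 /eqP -> /S3[[u|] [/= <- _]].
- by right; rewrite fold_parities.
- by left.
Qed.

Lemma cheat_sheet_upper C q m : (0 < k)%N -> (8 * S <= 2 ^ m)%N ->
  bounded_prot (lift_fun G f) C -> zero_error_prot (fun x y => Some (G x y)) q ->
  zero_error_prot (lift_fun G (@cheat_sheet n k S f))
    (4 * (k * (36 * k * (3 * C + 3)) + 2 * S * (m * (3 * q + 3)))).
Proof.
move=> k0 Sm /(impl_guess k0)[D1 H1 E1] /(impl_parities Sm)[D2 H2 E2].
have H2' := impl_pull (fun p : unit * L => p.2) H2.
have [D H [E S']] := impl_bind_ex H1 H2'.
have [prot [Ek V EP]] := qprot_of_cimpl H.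
exists prot; split=> // x y v; rewrite /lift_fun -/(gad (x, y)) => /cheat_sheet_some[Hl Hz].
set w := (x, y) in Hl Hz *; set l := cs_index f (gad w) in Hl Hz.
have ans l' : parities (cs_cells (gad w)) l' = [ffun b => (l' == l) && (b == v)].
  by apply/ffunP => b; rewrite !ffunE Hz.
(* A right guess and a readable cell have probability at least [(3/4)^2 = 9/16], which leaves less
   than 1/2 for [None]. *)
have good : 9 / 16 <= D tt w (Some v).
  have [] := E2 l w; rewrite ans /answer !ffunE eqxx /=.
  have := E1 w l Hl; have := E tt w l (Some v).
  by case: v {Hz ans} => /= ? ? ? _; nra.
have bad : D tt w (Some (~~ v)) = 0.
  apply/eqP; apply: contraT => /S'[l' [_ /=]].
  have [_ H2l] := E2 l' w => /H2l[//|].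
  by rewrite ans /answer !ffunE; case: (l' == l); case: v {Hz good ans}.
rewrite !EP bad; split=> //.
have := impl_sum1 H tt w; rewrite sum_option_bool.
by move: bad good; case: v {Hz ans} => /= ->; lra.
Qed.

End CheatSheetProtocol.

(** * Comparing the bounds *)

Lemma nat_minP (Q : nat -> Prop) : (exists m, Q m) -> Q (nat_min Q).
Proof.
by move=> H; rewrite /nat_min; case: pselect => // H'; case: ex_minnP => m /asboolP.
Qed.

Lemma nat_min_le (Q : nat -> Prop) m : Q m -> (nat_min Q <= m)%N.
Proof.
move=> Qm; rewrite /nat_min; case: pselect => // H'.
by case: ex_minnP => m' _; apply; apply/asboolP.
Qed.

Lemma nat_min_gt0 (Q : nat -> Prop) : (0 < nat_min Q)%N -> Q (nat_min Q).
Proof. by rewrite {1}/nat_min; case: pselect => // H _; exact: nat_minP. Qed.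

Lemma bounded_prot_of_zero_error (IA IB : Type) (F : IA -> IB -> option bool) k :
  zero_error_prot F k -> exists k', bounded_prot F k'.
Proof.
move=> [prot [_ V HP]].
have H0 : impl (cmodel IA IB) _ _ := cimpl_qprot V (fun (_ : unit) (x : IA) => x) (fun _ (y : IB) => y).
have [|D H E] := impl_bounded_of_zero_error (F := fun w : IA * IB => F w.1 w.2) H0.
  by move=> w v; exact: HP.
have [prot' [_ V' E']] := qprot_of_cimpl H.
by exists (qp_k prot'), prot'; split=> // x y v Fv; rewrite E'; exact: (E (x, y)).
Qed.

Section XorInput.
Variables (n : nat) (f : pfun n).

(** The hypothesis is informative only for functions of large [Q0query], so it cannot be applied to
    one copy of [G]. Here the hardness comes from [f], and the extra bit lets [G] survive once the
    input of [f] is fixed. *)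
Definition xor_input : pfun n.+1 := fun x =>
  omap (addb (x ord0)) (f [ffun i => x (lift ord0 i)]).

Lemma bounded_query_of_xor_input T : zero_error_query_alg xor_input T ->
  bounded_query_alg f (24 * T).
Proof.
move=> [A [<- VA HA]].
pose sigma (_ : unit) (i : 'I_n.+1) : bool + 'I_n :=
  if unlift ord0 i is Some j then inr j else inl false.
have H1 := qimpl_qalg sigma VA.
have [|D HD EF] := impl_bounded_of_zero_error (M := qmodel n) (F := f) H1.
  move=> x v fx; apply: HA; rewrite /xor_input !ffunE /sigma unlift_none /=.
  rewrite (_ : [ffun i => _] = x) ?fx //.
  by apply/ffunP => i; rewrite !ffunE liftK.
by have := bounded_query_of_impl HD EF; rewrite -mul2n mulnA.
Qed.

(* Fixing the inputs of [f] to encode a string of the domain leaves the gadget, up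
   to a negation. *)
Lemma zero_error_prot_gadget (X Y : Type) (G : X -> Y -> bool) x v k :
  f x = Some v -> zero_error_prot (lift_fun G xor_input) k ->
  exists q, zero_error_prot (fun a b => Some (G a b)) q.
Proof.
move=> fx [prot [_ V HP]].
have const b : (forall a a', G a a' = b) -> exists q, zero_error_prot (fun a b => Some (G a b)) q.
  move=> Gb; have H := impl_pure (cmodel X Y) (fun _ : unit => Some b).
  have [prot' [_ V' E']] := qprot_of_cimpl H.
  exists (qp_k prot'), prot'; split=> // a a' _ [<-]; rewrite !E' Gb /=.
  by split; [case: b {Gb H E'} | lra].
(* Encoding [x] takes inputs of [G] for both values; a constant [G] has a protocol without
   communication. *)
case: (pselect (exists a a', G a a' = true)) => [[a1 [b1 G1]]|N1]; last first.
  apply: (const false) => a a'; case E: (G a a') => //.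
  by case: N1; exists a, a'.
case: (pselect (exists a a', G a a' = false)) => [[a0 [b0 G0]]|N0]; last first.
  apply: (const true) => a a'; case E: (G a a') => //.
  by case: N0; exists a, a'.
pose rA (_ : unit) (a : X) (i : 'I_n.+1) :=
  if unlift ord0 i is Some j then if x j then a1 else a0 else a.
pose rB (_ : unit) (b : Y) (i : 'I_n.+1) :=
  if unlift ord0 i is Some j then if x j then b1 else b0 else b.
have H0 : impl (cmodel X Y) _ _ := cimpl_qprot V rA rB.
have H1 := impl_map (fun q : unit * option bool => omap (addb v) q.2) H0.
have [prot' [_ V' E']] := qprot_of_cimpl H1.
exists (qp_k prot'), prot'; split=> // a b _ [<-]; rewrite !E'.
have Fv : lift_fun G xor_input (rA tt a) (rB tt b) = Some (G a b (+) v).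
  rewrite /lift_fun /xor_input !ffunE /rA /rB unlift_none /=.
  rewrite (_ : [ffun i => _] = x) ?fx //.
  by apply/ffunP => i; rewrite !ffunE liftK; case: (x i).
have [P0 PN] := HP _ _ _ Fv; split.
  rewrite (big_pred1 (Some (~~ (G a b (+) v)))) // => -[u|] //=.
  by case: u; case: v {fx H1 E' Fv P0}; case: (G a b).
by rewrite (big_pred1 None) // => -[u|].
Qed.

End XorInput.

Lemma Qquery_gt0 n (f : pfun n) : (0 < Qquery f)%N ->
  exists x0 x1, f x0 = Some false /\ f x1 = Some true.
Proof.
move=> Q0; have H b : exists x, f x = Some b.
  apply: contrapT => Hno; have : bounded_query_alg f 0.
    apply: (@bounded_query_const _ _ (~~ b)) => x v fx.
    by apply: contrapT => nv; apply: Hno; exists x; rewrite fx; case: v b nv {fx} => [] [].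
  by move/nat_min_le; rewrite -/(Qquery f) leqNgt Q0.
by have [x0 ?] := H false; have [x1 ?] := H true; exists x0, x1.
Qed.

Lemma Q0query_attained n (f : pfun n) : zero_error_query_alg f (Q0query f).
Proof. exact: nat_minP (zero_error_query_exists f). Qed.

(** With [h] the integer part of [l / (2 e)], [l <= 2 e (h + 1) <= (h + 1)^2], so
    [l^e <= (h + 1)^(2 e) <= 2^(2 e h) <= 2^l]. *)
Lemma expn_le_exp2 (e l : nat) : (0 < e)%N -> (4 * e ^ 2 <= l)%N -> (l ^ e <= 2 ^ l)%N.
Proof.
move=> e0 el; pose h := (l %/ (2 * e))%N.
have e2 : (0 < 2 * e)%N by rewrite muln_gt0.
have lh : (l <= 2 * e * h.+1)%N by rewrite ltnW // mulnC -ltn_divLR.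
have hl : (h * (2 * e) <= l)%N by rewrite leq_trunc_div.
have eh : (2 * e <= h.+1)%N.
  apply: leqW; rewrite leq_divRL // (leq_trans _ el) //.
  by rewrite -mulnn; lia.
apply: (@leq_trans (2 ^ (h * (2 * e)))); last by rewrite leq_exp2l.
apply: (@leq_trans ((2 * e * h.+1) ^ e)); first by rewrite leq_exp2r.
apply: (@leq_trans (h.+1 ^ (2 * e))).
  by rewrite expnM leq_exp2r // -mulnn leq_mul.
by rewrite [(2 ^ _)%N]expnM leq_exp2r // ltn_expl.
Qed.

Lemma poly_le_exp2 (a e : nat) : exists l0, forall l, (l0 <= l)%N -> (a * l ^ e <= 2 ^ l)%N.
Proof.
exists (a + 4 * e.+1 ^ 2)%N => l Hl.
apply: leq_trans (expn_le_exp2 (ltn0Sn e) _); last by lia.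
by rewrite expnS leq_mul2r; apply/orP; right; lia.
Qed.

Lemma ln2_bounds : 1 / 2 <= ln (2 : RR) <= 1.
Proof.
have e2 : expR (1 / 2) <= 2 :> RR.
  have := expR_ge1Dx (- (1 / 2) : RR); rewrite expRN => H.
  rewrite -[leLHS]invrK -[leRHS]invrK lef_pV2 ?posrE ?invr_gt0 ?expR_gt0 //; lra.
apply/andP; split.
  by rewrite -[leLHS]expRK ler_ln ?posrE ?expR_gt0.
have := expR_ge1Dx (1 : RR) => H.
by rewrite -[leRHS]expRK ler_ln ?posrE ?expR_gt0; lra.
Qed.

(** With [a = ln s] and [b = ln t], [(b / a)^c <= exp (c (b - a) / a) <= exp (b - a) = t / s] as
    soon as [c <= a], which [4^c <= s] guarantees. Monotonicity is needed because [T] is only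
    bounded from below, by [S * D]. *)
Lemma div_ln_pow_mono (c : nat) (s t : RR) : (4 : RR) ^+ c <= s -> 4 <= s -> s <= t ->
  s / ln s ^+ c <= t / ln t ^+ c.
Proof.
move=> cs s4 st.
have s0 : 0 < s by lra.
have t0 : 0 < t by lra.
have e4 : expR 1 <= 4 :> RR.
  have := expR_ge1Dx (- (1 / 2) : RR); rewrite expRN => H.
  have e0 := expR_gt0 (1 / 2 : RR).
  have -> : expR 1 = expR (1 / 2) * expR (1 / 2) :> RR by rewrite -expRD; congr expR; lra.
  have : expR (1 / 2) <= 2 :> RR.
    by rewrite -[leLHS]invrK -[leRHS]invrK lef_pV2 ?posrE ?invr_gt0 //; lra.
  nra.
have lns1 : 1 <= ln s by rewrite -[leLHS]expRK ler_ln ?posrE ?expR_gt0 // (le_trans e4).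
have lnsc : c%:R <= ln s.
  rewrite -[leLHS]expRK ler_ln ?posrE ?expR_gt0 //; apply: le_trans cs.
  by rewrite -[c%:R]mulr1 expRM_natl lerXn2r ?nnegrE // ltW ?expR_gt0.
have lnst : ln s <= ln t by rewrite ler_ln.
set a := ln s in lns1 lnsc lnst *; set b := ln t in lnst *.
have Es : s = expR a by rewrite lnK.
have Et : t = expR b by rewrite lnK.
have a0 : 0 < a by lra.
have b0 : 0 < b by lra.
rewrite ler_pdivrMr ?exprn_gt0 // mulrAC ler_pdivlMr ?exprn_gt0 //.
have -> : t = s * expR (b - a) by rewrite Es Et -expRD; congr expR; lra.
rewrite -mulrA ler_pM2l // -ler_pdivrMr ?exprn_gt0 // -expr_div_n.
have -> : b / a = 1 + (b - a) / a by field; rewrite gt_eqF.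
apply: (@le_trans _ _ (expR ((b - a) / a) ^+ c)).
  rewrite lerXn2r ?nnegrE ?expR_ge0 ?expR_ge1Dx //.
  by rewrite addr_ge0 // divr_ge0 ?subr_ge0 // ltW.
rewrite -expRM_natl ler_expR mulrA ler_pdivrMr // mulrC ler_wpM2l ?subr_ge0 //.
Qed.
(** The factor [k^2 D^5] is the number of repetitions, of order [(k D^2)^2], times the [D] of
    [S D]. *)
Lemma cheat_sheet_query_bound : exists Cst, forall n k S D (f : pfun n),
  (0 < S)%N -> (0 < k)%N -> (0 < D)%N -> (2048 * D ^ 2 <= 2 ^ k)%N -> (0 < Qquery f)%N ->
  (Q0query (@cheat_sheet n k S f) <= S * D)%N -> (Qquery f <= Cst * k ^ 2 * D ^ 5 * S)%N.
Proof.
have [a Ea] : exists a, a = 4096%N by exists 4096%N.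
exists (6 * a ^ 2)%N => n k S D f S0 k0 D0 Hk /Qquery_gt0[x0 [x1 [f0 f1]]] HT.
have := cheat_sheet_lower (Q0query_attained _) f0 f1 S0 k0 D0 HT Hk.
rewrite -Ea => /nat_min_le/leq_trans; apply.
rewrite -mul2n; apply: (@leq_trans (2 * (3 * (a * (k * D ^ 2)) ^ 2 * (S * D)))).
  by rewrite !leq_mul2l HT !orbT.
by rewrite !expnS !expn0; lia.
Qed.

(** The upper bound is that of [cheat_sheet_upper] with at most [2 l] retries: [432 = 4 * 36 * 3]
    and [48 = 4 * 2 * 2 * 3]. The lower bound is of order [S l^3], as [ln (S D) <= 2 l]; its excess
    over [l^2] absorbs the term in [q] and the constants. *)
Lemma cell_size_le (K : RR) (c q S C l T : nat) :
  0 < K -> (4 <= l)%N -> (0 < S)%N -> (S * l ^ (c + 3) < 2 ^ l.+1)%N ->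
  (S * l ^ (c + 3) <= T)%N -> 2 ^+ c * 1728 * (q%:R + 1) <= K * l%:R ->
  K * T%:R / ln T%:R ^+ c <= (432 * l ^ 2 * (C + 1) + 48 * S * l * (q + 1))%:R ->
  (S <= C)%N.
Proof.
move=> K0 l4 S0; set D := (l ^ (c + 3))%N => SDl SDT Kl low.
have l0 : (0 < l)%N by apply: leq_trans l4.
have lR4 : 4 <= l%:R :> RR by rewrite ler_nat.
have lR0 : 0 < l%:R :> RR by rewrite ltr0n.
have DSD : (D <= S * D)%N by rewrite leq_pmull.
have SD4 : 4 <= (S * D)%:R :> RR.
  rewrite ler_nat (leq_trans l4) // (leq_trans _ DSD) // -[leqLHS]expn1.
  by rewrite leq_pexp2l // addn3.
have SDc : 4 ^+ c <= (S * D)%:R :> RR.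
  rewrite -natrX ler_nat (leq_trans _ DSD) // (@leq_trans (l ^ c)) //.
    by case: (c) => // c'; rewrite leq_exp2r.
  by rewrite leq_pexp2l // leq_addr.
have SD0 : 0 < (S * D)%:R :> RR by apply: lt_le_trans SD4.
have lnSD0 : 0 < ln (S * D)%:R :> RR by rewrite ln_gt0 // (lt_le_trans _ SD4) // ltr1n.
have lnSD : ln (S * D)%:R <= 2 * l%:R :> RR.
  apply: (@le_trans _ _ (ln (2 ^+ l.+1))).
    by rewrite ler_ln ?posrE ?exprn_gt0 // -natrX ler_nat ltnW.
  rewrite lnXn // -[_ *+ l.+1]mulr_natl -natr1; move: ln2_bounds lR4; clear.
  by move: (ln 2) (l%:R) => u x /andP[u1 u2] x4; nra.
have STR : (S * D)%:R <= T%:R :> RR by rewrite ler_nat.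
have mono := div_ln_pow_mono SDc SD4 STR.
have H1 : K * S%:R * l%:R ^+ 3 <= 2 ^+ c * (432 * l ^ 2 * (C + 1) + 48 * S * l * (q + 1))%:R.
  have -> : K * S%:R * l%:R ^+ 3 = 2 ^+ c * (K * ((S * D)%:R / (2 * l%:R) ^+ c)).
    rewrite natrM /D natrX exprD exprMn; field.
    by rewrite !expf_neq0 ?gt_eqF.
  rewrite ler_pM2l ?exprn_gt0 //; apply: le_trans low; rewrite -mulrA ler_pM2l //.
  apply: le_trans mono; rewrite ler_pM2l // lef_pV2 ?posrE ?exprn_gt0 ?mulr_gt0 //.
  by rewrite lerXn2r ?nnegrE // ltW ?mulr_gt0.
have S1 : 1 <= S%:R :> RR by rewrite ler1n.
have q0 : 0 <= q%:R :> RR by rewrite ler0n.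
have P0 : 0 < 2 ^+ c :> RR by rewrite exprn_gt0.
rewrite -(ler_nat RR).
move: H1 Kl K0 lR4 lR0 S1 q0 P0; rewrite natrD !natrM !natrD; clear.
move: (2 ^+ c) (l%:R) (S%:R) (q%:R) (C%:R) => P x s y z H1 Kx K0 x4 x0 s1 y0 P0.
have s0 : 0 <= s by lra.
have h1 : s * x * (P * 1728 * (y + 1)) <= s * x * (K * x).
  by rewrite ler_wpM2l // mulr_ge0 // ltW.
have h2 : K * s * x ^+ 2 * 1 <= K * s * x ^+ 2 * x.
  by apply: ler_wpM2l; [rewrite mulr_ge0 ?sqr_ge0 // mulr_ge0 // ltW | lra].
have h3 : s * x ^+ 2 * (P * 1728) <= s * x ^+ 2 * (K * x).
  apply: ler_wpM2l; first by rewrite mulr_ge0 ?sqr_ge0.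
  by apply: le_trans Kx; rewrite ler_peMr //; lra.
have Pl : 0 < P * x ^+ 2 by rewrite mulr_gt0 ?exprn_gt0.
(* [2 S <= C + 1] together with [1 <= S] gives [S <= C]. *)
have : P * x ^+ 2 * (2 * s) <= P * x ^+ 2 * (z + 1).
  have : 0 <= P * x ^+ 2 * s by rewrite mulr_ge0 // ltW.
  lra.
rewrite ler_pM2l // => H2; lra.
Qed.

Lemma div_ln_pow_le (A e B C l : nat) :
  (0 < A)%N -> (1 < B)%N -> (2 ^ l <= B)%N -> (B <= 4 * C * (A * l ^ e))%N ->
  (4 * A%:R * 2 ^+ e)^-1 * B%:R / ln B%:R ^+ e <= C%:R :> RR.
Proof.
move=> A0 B1 lB BE.
have B0 : (0 < B)%N by apply: ltnW.
have lnB0 : 0 < ln B%:R :> RR by rewrite ln_gt0 // ltr1n.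
have AR : 0 < A%:R :> RR by rewrite ltr0n.
have llnB : l%:R <= 2 * ln B%:R :> RR.
  have : ln (2 ^+ l) <= ln B%:R :> RR.
    by rewrite ler_ln ?posrE ?exprn_gt0 ?ltr0n // -natrX ler_nat.
  rewrite lnXn // -[_ *+ l]mulr_natl; have : 0 <= l%:R :> RR by rewrite ler0n.
  move: ln2_bounds; clear; move: (l%:R) (ln 2) (ln B%:R) => x y z /andP[y1 y2] x0 xy; nra.
rewrite -mulrA ler_pdivrMl; last by rewrite mulr_gt0 ?exprn_gt0 // mulr_gt0.
rewrite ler_pdivrMr ?exprn_gt0 //.
apply: (@le_trans _ _ (4 * C * (A * l ^ e))%:R); first by rewrite ler_nat.
rewrite !natrM natrX.
have -> : 4 * A%:R * 2 ^+ e * C%:R * ln B%:R ^+ e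
   = 4 * C%:R * (A%:R * (2 * ln B%:R) ^+ e) :> RR by rewrite exprMn; ring.
rewrite ler_wpM2l ?mulr_ge0 // ler_wpM2l //.
by rewrite lerXn2r ?nnegrE // ltW // mulr_gt0.
Qed.

Theorem theorem18 (X Y : Type) (G : X -> Y -> bool) :
  omega_tilde_all (fun n f => Q0cc (lift_fun G f)) (fun n f => Q0query f) ->
  omega_tilde_all (fun n f => Qcc (lift_fun G f)) (fun n f => Qquery f).
Proof.
move=> [K [c [N [K0 Hyp]]]].
(* A positive lower bound on [Q0cc] excludes the default value of [nat_min]; with at least 3 queries
   the logarithm is positive. *)
have attained n (f : pfun n) : (N + 3 <= Q0query f)%N ->
    exists k, zero_error_prot (lift_fun G f) k.
  move=> HQ; exists (Q0cc (lift_fun G f)); apply: nat_min_gt0.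
  have Q3 : 3 <= (Q0query f)%:R :> RR by rewrite ler_nat; lia.
  rewrite -(ltr0n RR); apply: lt_le_trans (Hyp n f _); last by lia.
  by rewrite divr_gt0 ?mulr_gt0 ?exprn_gt0 ?ln_gt0 //; lra.
(* If [Qquery] is bounded, a threshold beyond all its values makes the conclusion vacuous. Otherwise
   some [f0] is hard enough to yield a protocol for [G]. *)
case: (pselect (exists n (f : pfun n), (24 * (N + 3) <= Qquery f)%N)) => [[n0 [f0 Qf0]]|Hno];
  last first.
  exists 1, 0%N, (24 * (N + 3))%N; split=> [|n f HQ]; first exact: ltr01.
  by case: Hno; exists n, f.
have [q Hq] : exists q, zero_error_prot (fun a b => Some (G a b)) q.
  have [|x0 [_ [fx0 _]]] := @Qquery_gt0 n0 f0; first by lia.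
  have [|k Hk] := attained _ (xor_input f0).
    have /bounded_query_of_xor_input/nat_min_le := Q0query_attained (xor_input f0).
    by rewrite -/(Qquery f0) => H; rewrite -(@leq_pmul2l 24) // (leq_trans Qf0).
  exact: zero_error_prot_gadget fx0 Hk.
have [Cst HC] := cheat_sheet_query_bound.
(* [d] is the exponent of [D = l^d] in [cell_size_le], and [l^e] is the [l^2 D^5] of
   [cheat_sheet_query_bound]. *)
pose d := (c + 3)%N; pose e := (2 + 5 * d)%N.
have [l1 Hl1] := poly_le_exp2 2048 (2 * d).
have [l2 Hl2] := poly_le_exp2 (2 * Cst.+1) e.
pose lr := 2 ^+ c * 1728 * (q%:R + 1) / K : RR.
pose l3 := (Num.truncn lr).+1.
(* The threshold ensures [2048 D^2 <= 2^l] (by [l1]), [1 <= S] (by [l2]), the largeness of [l]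
   required by [cell_size_le] (by [l3] and 4), and values of [Q0query] above the threshold of the
   hypothesis (by the terms in [N]). *)
exists (4 * Cst.+1%:R * 2 ^+ e)^-1, e, (2 ^ (l1 + l2 + l3 + N + 4) + 24 * (N + 3))%N.
split=> [|n f HB]; first by rewrite invr_gt0; apply: mulr_gt0; [apply: mulr_gt0 | apply: exprn_gt0].
set B := Qquery f in HB *; pose l := trunc_log 2 B.
have B0 : (0 < B)%N by lia.
have l0 : (l1 + l2 + l3 + N + 4 <= l)%N by apply: trunc_log_max => //; lia.
have [lB Bl] : (2 ^ l <= B /\ B < 2 ^ l.+1)%N.
  by split; [exact: trunc_logP | exact: trunc_log_ltn].
(* The 2 in the denominator of [S] makes [E * S < B], so that [T <= S * D] is contradictory in
   [ST]. *)
pose D := (l ^ d)%N; pose E := (Cst.+1 * l ^ e)%N; pose S := (B %/ (2 * E))%N.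
have l_gt0 : (0 < l)%N by lia.
have D0 : (0 < D)%N by rewrite expn_gt0 l_gt0.
have E0 : (0 < E)%N by rewrite muln_gt0 expn_gt0 l_gt0.
have EB : (2 * E <= B)%N by apply: leq_trans lB; rewrite mulnA; apply: Hl2; lia.
have S0 : (0 < S)%N by rewrite divn_gt0 // muln_gt0.
have S2E : (S * (2 * E) <= B)%N by exact: leq_trunc_div.
have BS : (B < S.+1 * (2 * E))%N by rewrite -ltn_divLR; [exact: ltnSn | rewrite muln_gt0].
have lD : (l <= D)%N by rewrite -[leqLHS]expn1 leq_exp2l ?/d; lia.
pose T := Q0query (@cheat_sheet n l S f).
have DE : (Cst.+1 * l ^ 2 * D ^ 5 = E)%N.
  by rewrite /E /D -mulnA -expnM -expnD /e [(5 * d)%N]mulnC.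
have ST : (S * D < T)%N.
  rewrite ltnNge; apply/negP => /(HC _ _ _ _ _ S0 l_gt0 D0) => H.
  have : (B <= Cst * l ^ 2 * D ^ 5 * S)%N.
    by apply: H => //; rewrite /D -expnM mulnC; rewrite mulnC [(d * 2)%N]mulnC; apply: Hl1; lia.
  have : (Cst * l ^ 2 * D ^ 5 * S <= E * S)%N.
    by rewrite -DE leq_mul2r !leq_mul2r leqnSn !orbT.
  have : (E * S < B)%N by nia.
  by lia.
have SDB : (S * D <= B)%N.
  apply: leq_trans S2E; rewrite leq_mul2l; apply/orP; right.
  apply: (@leq_trans (D ^ 5)); first by rewrite -[leqLHS]expn1 leq_pexp2l.
  by rewrite -DE mulnA leq_pmull // !muln_gt0 l_gt0.
set C := Qcc (lift_fun G f).
have HP : bounded_prot (lift_fun G f) C.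
  have [|k Hk] := attained n f.
    have /bounded_query_of_zero_error/nat_min_le := Q0query_attained f.
    by rewrite -/(Qquery f) -/B => H; rewrite -(@leq_pmul2l 24) //; lia.
  exact: nat_minP (bounded_prot_of_zero_error Hk).
(* [l + 4] retries per bit are enough, since [S <= B < 2^(l+1)]. *)
have S8 : (8 * S <= 2 ^ (l + 4))%N.
  have : (S <= B)%N by exact: leq_div.
  have : (2 ^ (l + 4) = 2 ^ l.+1 * 8)%N by rewrite -[8%N]/(2 ^ 3)%N -expnD; congr (2 ^ _)%N; lia.
  by lia.
have up := nat_min_le (cheat_sheet_upper l_gt0 S8 HP Hq).
have DSD : (D <= S * D)%N by rewrite leq_pmull.
have TN : (N <= T)%N by apply: leq_trans (ltnW ST); apply: leq_trans DSD; lia.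
have low : K * T%:R / ln T%:R ^+ c <= (Q0cc (lift_fun G (@cheat_sheet n l S f)))%:R := Hyp _ _ TN.
have SC : (S <= C)%N.
  apply: (cell_size_le (q := q) K0 _ S0 _ (ltnW ST) _ (le_trans low _)).
  - by lia.
  - exact: leq_ltn_trans SDB Bl.
  - have : lr <= l%:R.
      apply: ltW; apply: lt_le_trans (truncnS_gt lr) _.
      by rewrite -/l3 ler_nat; lia.
    by rewrite /lr ler_pdivrMr // [l%:R * K]mulrC; apply.
  rewrite ler_nat; apply: leq_trans up _.
  have : ((l + 4) * (3 * q + 3) <= 2 * l * (3 * q + 3))%N.
    by rewrite leq_mul2r; apply/orP; right; lia.
  move=> H4; apply: (@leq_trans (4 * (l * (36 * l * (3 * C + 3)) + 2 * S * (2 * l * (3 * q + 3))))).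
    by rewrite leq_mul2l leq_add2l leq_mul2l H4 !orbT.
  by rewrite -mulnn; lia.
have B1 : (1 < B)%N by lia.
apply: (div_ln_pow_le (ltn0Sn _) B1 lB).
apply: leq_trans (ltnW BS) _; apply: (@leq_trans (2 * C * (2 * E))); last by rewrite -/E; lia.
by rewrite leq_mul2r; apply/orP; right; lia.
Qed.
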